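(* Let $f=h+\overline g$ be a sense-preserving harmonic diffeomorphism of $\mathbb D$ onto $\mathbb D$, with $h(z)=\sum_{n\ge0}a_nz^n$ and $g(z)=\sum_{n\ge1}b_nz^n$ holomorphic in $\mathbb D$. Assume $f$ extends to an orientation-preserving homeomorphism of $\overline{\mathbb D}$ whose boundary values are odd: $f(-\zeta)=-f(\zeta)$ for $|\zeta|=1$. Then \[ |a_1|^2+|b_1|^2\ge\frac8{\pi^2}. \] The constant is sharp: the infimum of $|a_1|^2+|b_1|^2$ over all such $f$ equals $8/\pi^2$.
   Context: $\mathbb D$ is the open unit disk and $\overline{\mathbb D}$ its closure. *)

(* Defs.v *)
From Stdlib Require Import Reals.
From Coquelicot Require Import Coquelicot.
Open Scope R_scope.

Definition inD (z : C) : Prop := Cmod z < 1.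
Definition inDbar (z : C) : Prop := Cmod z <= 1.
Definition onT (z : C) : Prop := Cmod z = 1.

Definition power_series_on_D (a : nat -> C) (h : C -> C) : Prop :=
  forall z : C, inD z -> is_pseries (K := C_AbsRing) (V := C_NormedModule) a z (h z).

Definition cderiv (h : C -> C) (z l : C) : Prop :=
  is_derive (K := C_AbsRing) (V := C_NormedModule) h z l.

Definition bij_onto (A B : C -> Prop) (f : C -> C) : Prop :=
  (forall z, A z -> B (f z)) /\
  (forall z w, A z -> A w -> f z = f w -> z = w) /\
  (forall w, B w -> exists z, A z /\ f z = w).

Definition cont_within (A : C -> Prop) (F : C -> C) (z : C) : Prop :=
  forall eps : R, 0 < eps -> exists del : R, 0 < del /\
    forall w, A w -> Cmod (w - z) < del -> Cmod (F w - F z) < eps.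

Definition homeo_Dbar (F : C -> C) : Prop :=
  bij_onto inDbar inDbar F /\
  (forall z, inDbar z -> cont_within inDbar F z) /\
  (exists G : C -> C, (forall z, inDbar z -> G (F z) = z) /\
     (forall w, inDbar w -> F (G w) = w) /\
     (forall w, inDbar w -> cont_within inDbar G w)).

(* The class of the theorem, parametrised by the coefficient sequences
   a (of h) and b (of g).  f = h + conj g.
   - h, g holomorphic in D with the given Taylor expansions, b_0 = 0;
   - f is a bijection of D onto D;
   - f is sense-preserving: Jacobian |h'|^2 - |g'|^2 > 0 on D
     (with injectivity this makes f a diffeomorphism of D);
   - f extends to a homeomorphism F of the closed disk with odd boundary
     values F(-zeta) = - F(zeta), |zeta| = 1. *)
Definition admissible (a b : nat -> C) : Prop :=
  exists h g : C -> C,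
    power_series_on_D a h /\ power_series_on_D b g /\ b O = 0%C /\
    (let f := fun z => (h z + Cconj (g z))%C in
     bij_onto inD inD f /\
     (forall z, inD z -> exists h' g' : C,
         cderiv h z h' /\ cderiv g z g' /\ Cmod g' < Cmod h') /\
     (exists F : C -> C, homeo_Dbar F /\
        (forall z, inD z -> F z = f z) /\
        (forall zeta, onT zeta -> F (- zeta)%C = (- F zeta)%C))).

(* Main.v *)
Require Import Defs.
From Stdlib Require Import Reals.
From Stdlib Require Import ZArith Lra Lia Psatz Classical ClassicalEpsilon.
From Coquelicot Require Import Coquelicot.
Open Scope R_scope.

(** The boundary curve [g(t) = F(cis t)] is odd and traverses the circle monotonically.  With
    [K(u)] the integral of [<g(t), g(t+u)>] over a half period, [L(u) = pi - K(u)] is superadditive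
    on [[0, pi]], because the angle at q is obtuse when q lies on the minor arc from p to r; oddness
    gives [L(pi/2) = pi].  Superadditivity makes [x |-> x^-2 * int_0^x (L(u) - 2u) du] increasing,
    hence nonpositive on [[0, pi/2]], and integrating against the cosine gives
    [int_0^pi K(u) cos u du >= 4].  The left-hand side is the sum of the squared moduli of the
    integrals of [g cos] and [g sin] over a half period, that is,
    [(pi^2 / 2) (|a_1|^2 + |b_1|^2)].

    For sharpness, F is the map [zeta = x + i y |-> (x + i k y) / |x + i k y|] with k -> 0.  That
    its Poisson extension is a diffeomorphism follows from one remark: the difference of two
    Poisson kernels, or a directional derivative of the Poisson kernel, is a positive function times
    a trigonometric polynomial of degree 1, which changes sign at the ends of one arc; the chord
    joining the images of these two points separates the contributions of the two arcs, so the
    difference, or the derivative, of the extension cannot vanish.  Surjectivity is obtained by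
    minimising the hyperbolic distance from f to a given point. *)

(** * Integration of continuous real functions *)

(** Equality throughout the lower bound belongs to a degenerate curve: if F takes the values 1 and
    -1, each on a half circle, then K(u) = pi - 2u and L(u) = 2u. This is the origin of the
    comparison function 2u, of the constant 4 and of the limit k -> 0. That curve is not injective,
    so sharpness has to approach it by genuine homeomorphisms, about whose extension everything must
    be read off the boundary values. The chord argument shows that the Jacobian has no zero, but not
    which sign it has. The sign is fixed at the origin, where the symmetry of the ellipse reduces
    the Jacobian to a product of two nonnegative moments, and continuity along radii carries it to
    the whole disk. An invertible differential also lets the image point be pushed in any direction,
    so that a minimiser of the hyperbolic distance to a target must hit the target. *)

Ltac Req := match goal with |- @eq _ ?a ?b => change (@eq R a b) end.

(** Continuity on the whole line, not on an interval, so that integrability on any [[a, b]] needs no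
    side condition. *)
Definition contR (f : R -> R) : Prop := forall x, continuous f x.

Lemma contR_const c : contR (fun _ => c).
Proof. intros x. apply continuous_const. Qed.

Lemma contR_id : contR (fun x => x).
Proof. intros x. apply continuous_id. Qed.

Lemma contR_plus f g : contR f -> contR g -> contR (fun x => f x + g x).
Proof. intros Hf Hg x. apply (continuous_plus f g); auto. Qed.

Lemma contR_opp f : contR f -> contR (fun x => - f x).
Proof. intros Hf x. apply (continuous_opp f); auto. Qed.

Lemma contR_minus f g : contR f -> contR g -> contR (fun x => f x - g x).
Proof. intros Hf Hg x. apply (continuous_minus f g); auto. Qed.

Lemma contR_mult f g : contR f -> contR g -> contR (fun x => f x * g x).
Proof. intros Hf Hg x. apply (continuous_mult f g); auto. Qed.

Lemma contR_comp f g : contR f -> contR g -> contR (fun x => f (g x)).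
Proof. intros Hf Hg x. apply (continuous_comp g f); auto. Qed.

Lemma contR_cos : contR cos.
Proof. intros x. apply continuity_pt_filterlim, continuity_cos. Qed.

Lemma contR_sin : contR sin.
Proof. intros x. apply continuity_pt_filterlim, continuity_sin. Qed.

Lemma contR_inv f : contR f -> (forall x, f x <> 0) -> contR (fun x => / f x).
Proof.
  intros Hf H0 x. apply continuity_pt_filterlim.
  apply (continuity_pt_inv f); [apply continuity_pt_filterlim, Hf | apply H0].
Qed.

Lemma contR_Rabs f : contR f -> contR (fun x => Rabs (f x)).
Proof.
  intros Hf x. apply (continuous_comp f Rabs); [apply Hf|].
  apply continuity_pt_filterlim, Rcontinuity_abs.
Qed.

Lemma contR_ext f g : (forall x, f x = g x) -> contR f -> contR g.
Proof. intros E Hf x. apply (continuous_ext f); auto. Qed.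

Ltac contR_step :=
  match goal with
  | H : contR ?f |- contR ?f => exact H
  | |- contR (fun _ => ?c) => exact (contR_const c)
  | |- contR (fun x => x) => exact contR_id
  | |- contR cos => exact contR_cos
  | |- contR sin => exact contR_sin
  | |- contR (fun x => @?f x + @?g x) => apply (contR_plus f g)
  | |- contR (fun x => @?f x - @?g x) => apply (contR_minus f g)
  | |- contR (fun x => @?f x * @?g x) => apply (contR_mult f g)
  | |- contR (fun x => - @?f x) => apply (contR_opp f)
  | |- contR (fun x => Rabs (@?f x)) => apply (contR_Rabs f)
  | |- contR (fun x => cos (@?g x)) => apply (contR_comp cos g); [exact contR_cos|]
  | |- contR (fun x => sin (@?g x)) => apply (contR_comp sin g); [exact contR_sin|]
  | H : contR ?f |- contR (fun x => ?f (@?g x)) => apply (contR_comp f g); [exact H|]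
  | H : forall _, contR _ |- _ => apply H
  end.
Ltac contR := repeat contR_step.

Lemma contR_continuity f : contR f -> continuity f.
Proof. intros Hf x. apply continuity_pt_filterlim, Hf. Qed.

Lemma ex_RInt_contR f a b : contR f -> ex_RInt f a b.
Proof. intros Hf. apply (ex_RInt_continuous (V := R_CompleteNormedModule)). intros; apply Hf. Qed.

Lemma RInt_plusR f g a b : contR f -> contR g ->
  RInt (fun x => f x + g x) a b = RInt f a b + RInt g a b.
Proof. intros Hf Hg. apply (RInt_plus f g); apply ex_RInt_contR; auto. Qed.

Lemma RInt_minusR f g a b : contR f -> contR g ->
  RInt (fun x => f x - g x) a b = RInt f a b - RInt g a b.
Proof. intros Hf Hg. apply (RInt_minus f g); apply ex_RInt_contR; auto. Qed.

Lemma RInt_scalR f l a b : contR f -> RInt (fun x => l * f x) a b = l * RInt f a b.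
Proof. intros Hf. apply (RInt_scal f); apply ex_RInt_contR; auto. Qed.

Lemma RInt_oppR f a b : contR f -> RInt (fun x => - f x) a b = - RInt f a b.
Proof. intros Hf. apply (RInt_opp f); apply ex_RInt_contR; auto. Qed.

Lemma RInt_constR c a b : RInt (fun _ => c) a b = (b - a) * c.
Proof. rewrite RInt_const. reflexivity. Qed.

Lemma RInt_extR (f g : R -> R) a b : (forall x, f x = g x) -> RInt f a b = RInt g a b.
Proof. intros E. apply RInt_ext. intros; apply E. Qed.

Lemma RInt_leR f g a b : a <= b -> contR f -> contR g ->
  (forall x, a < x < b -> f x <= g x) -> RInt f a b <= RInt g a b.
Proof. intros Hab Hf Hg H. apply RInt_le; auto; apply ex_RInt_contR; auto. Qed.

Lemma RInt_ChaslesR f a b c : contR f -> RInt f a b + RInt f b c = RInt f a c.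
Proof. intros Hf. apply (RInt_Chasles f); apply ex_RInt_contR; auto. Qed.

Lemma RInt_nonnegR f a b : a <= b -> contR f -> (forall x, a < x < b -> 0 <= f x) -> 0 <= RInt f a b.
Proof. intros Hab Hf H. apply RInt_ge_0; auto. apply ex_RInt_contR; auto. Qed.

Lemma RInt_absR f a b M : a <= b -> contR f -> (forall x, a < x < b -> Rabs (f x) <= M) ->
  Rabs (RInt f a b) <= (b - a) * M.
Proof.
  intros Hab Hf H.
  assert (H' : forall x, a < x < b -> - M <= f x <= M)
    by (intros; apply Rabs_le_between, H; auto).
  assert (H1 : RInt f a b <= RInt (fun _ => M) a b)
    by (apply RInt_leR; auto; [contR | apply H']).
  assert (H2 : RInt (fun _ => - M) a b <= RInt f a b)
    by (apply RInt_leR; auto; [contR | apply H']).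
  rewrite RInt_constR in H1, H2. apply Rabs_le. lra.
Qed.

Lemma RInt_shiftR f a b c : contR f -> RInt (fun x => f (x + c)) a b = RInt f (a + c) (b + c).
Proof.
  intros Hf.
  assert (H := RInt_comp_lin f 1 c a b).
  rewrite !Rmult_1_l in H.
  rewrite <- H by (apply ex_RInt_contR; auto).
  apply RInt_extR. intros x. unfold scal; simpl; unfold mult; simpl. rewrite !Rmult_1_l. reflexivity.
Qed.

Lemma RInt_reflectR f a b c : contR f -> RInt (fun x => f (c - x)) a b = RInt f (c - b) (c - a).
Proof.
  intros Hf.
  assert (H := RInt_comp_lin f (-1) c b a).
  replace (-1 * b + c) with (c - b) in H by ring. replace (-1 * a + c) with (c - a) in H by ring.
  rewrite <- H by (apply ex_RInt_contR; auto).
  rewrite <- (opp_RInt_swap (fun x => f (c - x))) by (apply ex_RInt_contR; contR).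
  replace (opp (RInt (fun x : R => f (c - x)) b a)) with (-1 * RInt (fun x : R => f (c - x)) b a)
    by (unfold opp; simpl; ring).
  rewrite <- RInt_scalR by contR.
  apply RInt_extR. intros x. unfold scal; simpl; unfold mult; simpl.
  do 2 f_equal. ring.
Qed.

Lemma is_derive_RIntR f a x : contR f -> is_derive (fun x => RInt f a x) x (f x).
Proof.
  intros Hf. apply (is_derive_RInt f (fun x => RInt f a x) a x); [|apply Hf].
  exists (mkposreal 1 Rlt_0_1). intros y _. apply (RInt_correct f). apply ex_RInt_contR; auto.
Qed.

Lemma contR_RInt f a : contR f -> contR (fun x => RInt f a x).
Proof.
  intros Hf x. apply (ex_derive_continuous (fun x => RInt f a x)).
  exists (f x). apply is_derive_RIntR; auto.
Qed.

Lemma RInt_FTC f f' a b : (forall x, is_derive f x (f' x)) -> contR f' ->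
  RInt f' a b = f b - f a.
Proof.
  intros Hf Hc. apply is_RInt_unique. apply (is_RInt_derive f f').
  - intros; apply Hf.
  - intros; apply Hc.
Qed.

Lemma IVT_R f a b y : contR f -> a <= b -> f a <= y <= f b \/ f b <= y <= f a ->
  exists x, a <= x <= b /\ f x = y.
Proof.
  intros Hf Hab Hy.
  destruct (IVT_gen f a b y) as [x [Hx E]].
  - apply contR_continuity; auto.
  - unfold Rmin, Rmax; destruct (Rle_dec (f a) (f b)); lra.
  - exists x. rewrite Rmin_left, Rmax_right in Hx by lra. auto.
Qed.

Lemma RInt_posR f a b c : a < b -> contR f -> (forall x, a < x < b -> 0 <= f x) ->
  a < c < b -> 0 < f c -> 0 < RInt f a b.
Proof.
  intros Hab Hf H0 Hc Hp.
  assert (Hl : locally c (fun x => 0 < f x)).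
  { apply (Hf c (fun y => 0 < y)). apply (open_gt 0). exact Hp. }
  destruct Hl as [d Hd].
  set (e := Rmin (d / 2) (Rmin ((c - a) / 2) ((b - c) / 2))).
  assert (He : 0 < e /\ e < d /\ e < c - a /\ e < b - c).
  { assert (h := cond_pos d). unfold e, Rmin. repeat destruct Rle_dec; lra. }
  rewrite <- (RInt_ChaslesR f a (c - e) b), <- (RInt_ChaslesR f (c - e) (c + e) b) by auto.
  assert (0 <= RInt f a (c - e)) by (apply RInt_nonnegR; auto; [lra | intros; apply H0; lra]).
  assert (0 <= RInt f (c + e) b) by (apply RInt_nonnegR; auto; [lra | intros; apply H0; lra]).
  assert (0 < RInt f (c - e) (c + e)).
  { apply RInt_gt_0; [lra | | intros; apply Hf].
    intros x Hx. apply Hd. change (Rabs (x - c) < d). apply Rabs_def1; lra. }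
  lra.
Qed.

Lemma contR_RInt_param (f : R -> R -> R) a b :
  (forall x y, continuity_2d_pt f x y) -> (forall y, contR (fun x => f x y)) ->
  contR (fun y => RInt (fun x => f x y) a b).
Proof.
  intros H2 H1 t. apply filterlim_locally. intros eps.
  assert (h := Rabs_pos (b - a)). assert (h' := cond_pos eps).
  (* The added 1 keeps the denominator positive when a = b. *)
  assert (he : 0 < eps / (Rabs (b - a) + 1)) by (apply Rdiv_lt_0_compat; lra).
  destruct (uniform_continuity_2d_1d f (Rmin a b) (Rmax a b) t (fun x _ => H2 x t)
    (mkposreal _ he)) as [del Hd].
  exists del. intros s Hs. change (Rabs (s - t) < del) in Hs.
  change (Rabs (RInt (fun u => f u s) a b - RInt (fun u => f u t) a b) < eps).
  rewrite <- RInt_minusR by auto.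
  simpl in Hd. set (e := eps / (Rabs (b - a) + 1)) in *.
  assert (Hpt : forall u, Rmin a b <= u <= Rmax a b -> Rabs (f u s - f u t) <= e).
  { intros u Hu. apply Rabs_def2 in Hs. apply Rlt_le. assert (h1 := cond_pos del). apply Hd; try lra.
    rewrite Rminus_eq_0, Rabs_R0. apply cond_pos. }
  assert (Hb : Rabs (RInt (fun u => f u s - f u t) a b) <= Rabs (b - a) * e).
  { assert (Hc : contR (fun u => f u s - f u t)) by (apply contR_minus; apply H1).
    destruct (Rle_dec a b) as [hab|hab].
    - rewrite (Rabs_right (b - a)) by lra. rewrite Rmin_left, Rmax_right in Hpt by lra.
      apply RInt_absR; auto. intros; apply Hpt; lra.
    - rewrite (Rabs_left (b - a)) by lra. rewrite Rmin_right, Rmax_left in Hpt by lra.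
      rewrite <- (opp_RInt_swap (fun u => f u s - f u t)) by (apply ex_RInt_contR; auto).
      unfold opp; simpl. rewrite Rabs_Ropp.
      replace (- (b - a)) with (a - b) by ring.
      apply RInt_absR; auto; [lra | intros; apply Hpt; lra]. }
  eapply Rle_lt_trans; [exact Hb|].
  apply Rlt_le_trans with ((Rabs (b - a) + 1) * e); [nra|].
  unfold e. right. field. lra.
Qed.

(* As functions of b both sides have derivative [RInt (f b) c d]. *)
Lemma RInt_Fubini (f : R -> R -> R) a b c d :
  (forall x y, continuity_2d_pt f x y) ->
  (forall x, contR (f x)) -> (forall y, contR (fun x => f x y)) ->
  RInt (fun x => RInt (fun y => f x y) c d) a b = RInt (fun y => RInt (fun x => f x y) a b) c d.
Proof.
  intros H2 H1 H1'.
  assert (Hc : contR (fun x => RInt (f x) c d)).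
  { apply (contR_RInt_param (fun y x => f x y)); [|apply H1].
    intros x y e. destruct (H2 y x e) as [del Hd]. exists del. intros u v Hu Hv. apply Hd; auto. }
  set (G := fun x => RInt (fun y => RInt (fun u => f u y) a x) c d).
  assert (HG : forall x, is_derive G x (RInt (fun y => f x y) c d)).
  { intros x. unfold G.
    assert (E : forall x y, Derive (fun z => RInt (fun u => f u y) a z) x = f x y).
    { intros x0 y. apply is_derive_unique. apply (is_derive_RIntR (fun u => f u y)). apply H1'. }
    rewrite <- (RInt_extR (fun t => Derive (fun z => RInt (fun u => f u t) a z) x)) by (intros; apply E).
    apply (is_derive_RInt_param (fun z y => RInt (fun u => f u y) a z)).
    - exists (mkposreal 1 Rlt_0_1). intros y _ t _. exists (f y t).
      apply (is_derive_RIntR (fun u => f u t)). apply H1'.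
    - intros t _. apply continuity_2d_pt_ext with f; [intros; symmetry; apply E | apply H2].
    - exists (mkposreal 1 Rlt_0_1). intros y _. apply ex_RInt_contR.
      apply contR_RInt_param; auto. }
  transitivity (G b - G a); [exact (RInt_FTC G _ a b HG Hc)|]. unfold G.
  rewrite (RInt_extR (fun y => RInt (fun u => f u y) a a) (fun _ => 0))
    by (intros y; exact (RInt_point a (fun u => f u y))).
  rewrite RInt_constR. rewrite Rmult_0_r, Rminus_0_r. reflexivity.
Qed.

(** * Odd curves on the circle *)

Lemma sqr_eq_cases (x y : R) : x * x = y * y -> x = y \/ x = - y.
Proof. intros H. assert (E : (x - y) * (x + y) = 0) by lra. apply Rmult_integral in E. lra. Qed.

(* The angle at q of the triangle p, q, r is obtuse when q lies on the minor arc from p = (1,0)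
   to r. *)
Lemma obtuse_angle (c s c' s' : R) : c * c + s * s = 1 -> c' * c' + s' * s' = 1 ->
  c' <= c -> 0 <= s * s' -> 1 + c' <= c + (c * c' + s * s').
Proof.
  intros H H' Hc Hs.
  assert (Hc1 : -1 <= c <= 1) by nra. assert (Hc2 : -1 <= c' <= 1) by nra.
  (* Both sides are nonnegative, so their squares are compared; after cancelling common factors what
     remains is (1 - c) (1 + c') <= (1 + c) (1 - c'), that is c' <= c. *)
  assert ((1 - c) * (1 + c') <= s * s'); [|lra].
  assert (E : (s * s') * (s * s') = ((1 - c) * (1 + c)) * ((1 - c') * (1 + c'))).
  { replace ((1 - c) * (1 + c)) with (s * s) by lra.
    replace ((1 - c') * (1 + c')) with (s' * s') by lra. ring. }
  assert (0 <= (1 - c) * (1 + c')) by nra.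
  assert (((1 - c) * (1 + c')) * ((1 - c) * (1 + c')) <= (s * s') * (s * s')).
  { rewrite E. assert (0 <= (1 - c) * (1 + c') * ((1 + c) * (1 - c') - (1 - c) * (1 + c'))).
    { apply Rmult_le_pos; nra. }
    lra. }
  nra.
Qed.

(** A simple closed curve on the unit circle. The bound 2 PI in [oc_inj] expresses injectivity
    modulo the period, which antiperiodicity implies. No orientation is recorded, since dot products
    do not see it. *)
Record odd_curve (U V : R -> R) : Prop := {
  oc_contU : contR U;
  oc_contV : contR V;
  oc_unit : forall t, U t * U t + V t * V t = 1;
  oc_U : forall t, U (t + PI) = - U t;
  oc_V : forall t, V (t + PI) = - V t;
  oc_inj : forall s t, Rabs (s - t) < 2 * PI -> U s = U t -> V s = V t -> s = t }.

Definition dotp (U V : R -> R) s t := U s * U t + V s * V t.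

Lemma IVT_same_sign (f : R -> R) a b : contR f -> (forall x, a < x < b -> f x <> 0) ->
  forall x y, a < x < b -> a < y < b -> 0 < f x * f y.
Proof.
  intros Hf H0.
  assert (W : forall x y, x <= y -> a < x < b -> a < y < b -> 0 < f x * f y).
  { intros x y Hxy Hx Hy. destruct (Rlt_dec 0 (f x * f y)) as [h|h]; auto. exfalso.
    assert (h1 := H0 x Hx). assert (h2 := H0 y Hy).
    destruct (IVT_R f x y 0 Hf Hxy) as [z [Hz E]].
    - destruct (Rle_dec (f x) 0), (Rle_dec (f y) 0); try lra; exfalso; apply h; nra.
    - apply (H0 z); lra. }
  intros x y Hx Hy. destruct (Rle_dec x y).
  - apply W; auto.
  - rewrite Rmult_comm. apply W; auto. lra.
Qed.

(* Seen from the frame of p = g(t), the curve s |-> g(t+s) = (X s, Y s) stays on one side of the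
   real axis for 0 < s < PI, so that X is injective, hence decreasing from 1 to -1. *)
Lemma odd_curve_obtuse U V : odd_curve U V -> forall t u v, 0 <= u -> 0 <= v -> u + v <= PI ->
  1 + dotp U V t (t + u + v) <= dotp U V t (t + u) + dotp U V (t + u) (t + u + v).
Proof.
  intros [cU cV H1 HU HV Hinj] t u v Hu Hv Huv.
  assert (HPI := PI_RGT_0).
  set (X := fun s => U t * U (t + s) + V t * V (t + s)).
  set (Y := fun s => U t * V (t + s) - V t * U (t + s)).
  assert (cX : contR X) by (unfold X; contR).
  assert (cY : contR Y) by (unfold Y; contR).
  assert (ht := H1 t).
  assert (XY : forall s, X s * X s + Y s * Y s = 1).
  { intros s. unfold X, Y. assert (hs := H1 (t + s)).
    transitivity ((U t * U t + V t * V t) * (U (t + s) * U (t + s) + V (t + s) * V (t + s))); [ring|].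
    rewrite ht, hs. ring. }
  assert (eU : forall s, U (t + s) = U t * X s - V t * Y s).
  { intros s. unfold X, Y. transitivity ((U t * U t + V t * V t) * U (t + s)); [rewrite ht|]; ring. }
  assert (eV : forall s, V (t + s) = V t * X s + U t * Y s).
  { intros s. unfold X, Y. transitivity ((U t * U t + V t * V t) * V (t + s)); [rewrite ht|]; ring. }
  assert (inj : forall s s', 0 <= s <= PI -> 0 <= s' <= PI -> X s = X s' -> Y s = Y s' -> s = s').
  { intros s s' Hs Hs' EX EY.
    assert (t + s = t + s'); [|lra]. apply Hinj.
    - apply Rabs_def1; lra.
    - rewrite !eU, EX, EY. reflexivity.
    - rewrite !eV, EX, EY. reflexivity. }
  assert (X0 : X 0 = 1) by (unfold X; rewrite Rplus_0_r; exact ht).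
  assert (Y0 : Y 0 = 0) by (unfold Y; rewrite Rplus_0_r; ring).
  assert (X1 : X PI = -1) by (unfold X; rewrite HU, HV; lra).
  assert (Y1 : Y PI = 0) by (unfold Y; rewrite HU, HV; lra).
  (* On the real axis X is 1 or -1, and these points are already taken at 0 and PI. *)
  assert (Yn : forall s, 0 < s < PI -> Y s <> 0).
  { intros s Hs E. assert (h := XY s). rewrite E in h.
    destruct (sqr_eq_cases (X s) 1) as [e|e]; [lra| |].
    - assert (s = 0) by (apply inj; try lra). lra.
    - assert (s = PI) by (apply inj; try lra). lra. }
  assert (Ys := IVT_same_sign Y 0 PI cY Yn).
  assert (Xinj : forall s s', 0 <= s <= PI -> 0 <= s' <= PI -> X s = X s' -> s = s').
  { intros s s' Hs Hs' E.
    assert (h := XY s). assert (h' := XY s'). rewrite <- E in h'.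
    destruct (sqr_eq_cases (Y s) (Y s')) as [e|e]; [lra | apply inj; auto |].
    destruct (Req_dec (Y s) 0) as [z|z].
    - apply inj; auto. lra.
    - exfalso. assert (Y s' <> 0) by lra.
      assert (forall x, 0 <= x <= PI -> Y x <> 0 -> 0 < x < PI).
      { intros x Hx Hx'. split; apply Rnot_le_lt; intros hx; apply Hx'.
        - replace x with 0 by lra. exact Y0.
        - replace x with PI by lra. exact Y1. }
      assert (hh := Ys s s' ltac:(auto) ltac:(auto)). rewrite e in hh. nra. }
  (* If X rose from s to s', the value X s' would lie between X s and X 0 = 1 and be taken on
     [[0, s]] as well, against injectivity. *)
  assert (Xdec : forall s s', 0 <= s -> s <= s' -> s' <= PI -> X s' <= X s).
  { intros s s' h1 h2 h3. apply Rnot_lt_le. intros hx.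
    assert (X s' <= 1) by (assert (h := XY s'); nra).
    destruct (IVT_R X 0 s (X s') cX h1) as [z [Hz E]]; [rewrite X0; lra|].
    assert (z = s') by (apply Xinj; auto; lra).
    replace s with s' in hx by lra. lra. }
  assert (Hob := obtuse_angle (X u) (Y u) (X (u + v)) (Y (u + v)) (XY u) (XY (u + v))
    ltac:(apply Xdec; lra)).
  unfold dotp.
  replace (t + u + v) with (t + (u + v)) by ring.
  fold (X u). fold (X (u + v)).
  replace (U (t + u) * U (t + (u + v)) + V (t + u) * V (t + (u + v)))
    with (X u * X (u + v) + Y u * Y (u + v)).
  - apply Hob.
    destruct (Req_dec (Y u) 0) as [z|z]; [rewrite z; lra|].
    destruct (Req_dec (Y (u + v)) 0) as [z'|z']; [rewrite z'; lra|].
    apply Rlt_le, Ys.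
    + split; apply Rnot_le_lt; intros hx; apply z; [replace u with 0 by lra | replace u with PI by lra]; auto.
    + split; apply Rnot_le_lt; intros hx; apply z'; [replace (u + v) with 0 by lra | replace (u + v) with PI by lra]; auto.
  - rewrite !eU, !eV.
    transitivity ((U t * U t + V t * V t) * (X u * X (u + v) + Y u * Y (u + v))); [rewrite ht|]; ring.
Qed.

(** * The autocorrelation inequality *)

Lemma RInt_periodR f p u : contR f -> (forall t, f (t + p) = f t) ->
  RInt f u (u + p) = RInt f 0 p.
Proof.
  intros Hf Hp.
  rewrite <- (RInt_ChaslesR f u 0 (u + p)), <- (RInt_ChaslesR f 0 p (u + p)) by auto.
  replace (RInt f p (u + p)) with (RInt f 0 u).
  - assert (h := RInt_ChaslesR f u 0 u Hf). rewrite (RInt_point u f) in h.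
    change (RInt f u 0 + RInt f 0 u = 0) in h. lra.
  - rewrite <- (RInt_extR (fun x => f (x + p)) f) by auto.
    rewrite RInt_shiftR by auto. rewrite Rplus_0_l. reflexivity.
Qed.

Lemma c2d_comp f g x y : contR f -> continuity_2d_pt g x y ->
  continuity_2d_pt (fun x y => f (g x y)) x y.
Proof. intros Hf Hg. apply continuity_1d_2d_pt_comp; auto. apply contR_continuity; auto. Qed.

Ltac c2d_step :=
  match goal with
  | |- continuity_2d_pt (fun _ _ => ?c) _ _ => apply continuity_2d_pt_const
  | |- continuity_2d_pt (fun u _ => u) _ _ => apply continuity_2d_pt_id1
  | |- continuity_2d_pt (fun _ v => v) _ _ => apply continuity_2d_pt_id2
  | |- continuity_2d_pt (fun u v => @?f u v + @?g u v) _ _ => apply (continuity_2d_pt_plus f g)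
  | |- continuity_2d_pt (fun u v => @?f u v - @?g u v) _ _ => apply (continuity_2d_pt_minus f g)
  | |- continuity_2d_pt (fun u v => @?f u v * @?g u v) _ _ => apply (continuity_2d_pt_mult f g)
  | |- continuity_2d_pt (fun u v => - @?f u v) _ _ => apply (continuity_2d_pt_opp f)
  | |- continuity_2d_pt (fun u v => cos (@?g u v)) _ _ => apply (c2d_comp cos g); [exact contR_cos|]
  | |- continuity_2d_pt (fun u v => sin (@?g u v)) _ _ => apply (c2d_comp sin g); [exact contR_sin|]
  | H : contR ?f |- continuity_2d_pt (fun u v => ?f (@?g u v)) _ _ => apply (c2d_comp f g); [exact H|]
  end.
Ltac c2d := repeat c2d_step.

(** The function K of the overview. The integrand has period PI in t because both factors change
    sign. *)
Definition acorr (U V : R -> R) u := RInt (fun t => dotp U V t (t + u)) 0 PI.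

Section AutoCorrelation.
Variables (U V : R -> R).
Hypothesis HO : odd_curve U V.

Lemma cU : contR U. Proof. apply HO. Qed.
Lemma cV : contR V. Proof. apply HO. Qed.

Lemma dotp_cont f g : contR f -> contR g -> contR (fun t => dotp U V (f t) (g t)).
Proof. intros Hf Hg. unfold dotp. assert (h := cU). assert (h' := cV). contR. Qed.

Lemma dotp_period s t : dotp U V (s + PI) (t + PI) = dotp U V s t.
Proof. unfold dotp. rewrite !(oc_U U V HO), !(oc_V U V HO). ring. Qed.

Lemma acorr_cont : contR (acorr U V).
Proof.
  apply (contR_RInt_param (fun t u => dotp U V t (t + u))).
  - intros x y. unfold dotp. assert (h := cU). assert (h' := cV). c2d.
  - intros y. apply (dotp_cont (fun t => t) (fun t => t + y)); contR.
Qed.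

Lemma acorr_shift u v : RInt (fun t => dotp U V (t + u) (t + u + v)) 0 PI = acorr U V v.
Proof.
  assert (c : contR (fun t => dotp U V t (t + v))) by (apply dotp_cont; contR).
  rewrite (RInt_shiftR (fun t => dotp U V t (t + v))) by auto.
  rewrite Rplus_0_l, (Rplus_comm PI u). apply (RInt_periodR (fun t => dotp U V t (t + v))); auto.
  intros t. replace (t + PI + v) with (t + v + PI) by ring. apply dotp_period.
Qed.

Lemma acorr_superadditive u v : 0 <= u -> 0 <= v -> u + v <= PI ->
  PI + acorr U V (u + v) <= acorr U V u + acorr U V v.
Proof.
  intros Hu Hv Huv. assert (HPI := PI_RGT_0).
  rewrite <- (acorr_shift u v). unfold acorr.
  assert (c : forall w, contR (fun t => dotp U V t (t + w)))
    by (intros; apply (dotp_cont (fun t => t)); contR).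
  assert (c' : contR (fun t => dotp U V (t + u) (t + u + v))) by (apply dotp_cont; contR).
  rewrite <- RInt_plusR by auto.
  replace PI with (RInt (fun _ => 1) 0 PI) at 1 by (rewrite RInt_constR, Rmult_1_r; apply Rminus_0_r).
  rewrite <- RInt_plusR by (auto; contR).
  apply RInt_leR; try lra.
  - apply contR_plus; [contR|]. apply c.
  - apply contR_plus; auto.
  - intros t _. rewrite <- Rplus_assoc. apply odd_curve_obtuse; auto.
Qed.

(** A shift by u turns the pair (t, t + PI - u) into (t + u, t + PI), and the curve changes sign
    under a half turn. *)
Lemma acorr_reflect u : acorr U V (PI - u) = - acorr U V u.
Proof.
  rewrite <- (acorr_shift u (PI - u)). unfold acorr.
  rewrite <- RInt_oppR by (apply (dotp_cont (fun t => t)); contR).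
  apply RInt_extR. intros t. replace (t + u + (PI - u)) with (t + PI) by ring.
  unfold dotp. rewrite (oc_U U V HO), (oc_V U V HO). ring.
Qed.

Lemma acorr_half : acorr U V (PI / 2) = 0.
Proof. assert (h := acorr_reflect (PI / 2)). replace (PI - PI / 2) with (PI / 2) in h by field. lra. Qed.

(** The product of two antiperiodic functions has period PI, so the window of integration can be
    moved back to [[0, PI]]; the addition formula then separates t from the integration variable. *)
Lemma RInt_cos_factor f t : contR f -> (forall t, f (t + PI) = - f t) ->
  RInt (fun u => cos u * f (t + u)) 0 PI =
  cos t * RInt (fun s => cos s * f s) 0 PI + sin t * RInt (fun s => sin s * f s) 0 PI.
Proof.
  intros Hf Ha.
  transitivity (RInt (fun s => cos (s - t) * f s) t (t + PI)).
  - transitivity (RInt (fun u => cos (u + t - t) * f (u + t)) 0 PI).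
    + apply RInt_extR. intros u. f_equal; f_equal; ring.
    + rewrite (RInt_shiftR (fun s => cos (s - t) * f s)) by contR. f_equal; ring.
  - rewrite (RInt_periodR (fun s => cos (s - t) * f s)).
    + rewrite <- !RInt_scalR, <- RInt_plusR by contR. apply RInt_extR. intros s.
      rewrite cos_minus. ring.
    + contR.
    + intros s. rewrite Ha. replace (s + PI - t) with (s - t + PI) by ring. rewrite neg_cos. ring.
Qed.

(** A Wiener-Khinchin identity: after exchanging the integrals, the inner one is a combination of
    cos t and sin t whose coefficients are the same four moments that the outer integral
    produces. *)
Lemma acorr_Fourier :
  RInt (fun u => cos u * acorr U V u) 0 PI =
  RInt (fun s => cos s * U s) 0 PI ^ 2 + RInt (fun s => sin s * U s) 0 PI ^ 2 +
  RInt (fun s => cos s * V s) 0 PI ^ 2 + RInt (fun s => sin s * V s) 0 PI ^ 2.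
Proof.
  assert (cU' := cU). assert (cV' := cV).
  transitivity (RInt (fun u => RInt (fun t => cos u * dotp U V t (t + u)) 0 PI) 0 PI).
  { apply RInt_extR. intros u. rewrite RInt_scalR; [reflexivity|].
    apply (dotp_cont (fun t => t)); contR. }
  rewrite (RInt_Fubini (fun u t => cos u * dotp U V t (t + u))).
  2: { intros x y. unfold dotp. c2d. }
  2: { intros x. unfold dotp. contR. }
  2: { intros y. unfold dotp. contR. }
  set (A := RInt (fun s => cos s * U s) 0 PI). set (B := RInt (fun s => sin s * U s) 0 PI).
  set (A' := RInt (fun s => cos s * V s) 0 PI). set (B' := RInt (fun s => sin s * V s) 0 PI).
  transitivity (RInt (fun t => A * (cos t * U t) + B * (sin t * U t)
    + A' * (cos t * V t) + B' * (sin t * V t)) 0 PI).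
  - apply RInt_extR. intros t. unfold dotp.
    transitivity (RInt (fun u => U t * (cos u * U (t + u)) + V t * (cos u * V (t + u))) 0 PI).
    + apply RInt_extR. intros; Req; ring.
    + rewrite RInt_plusR, !RInt_scalR by contR.
      rewrite !RInt_cos_factor by (auto; apply HO).
      fold A B A' B'. Req; ring.
  - rewrite !RInt_plusR, !RInt_scalR by contR. fold A B A' B'. Req; ring.
Qed.

Lemma acorr_integral_le x : 0 <= x <= PI / 2 ->
  RInt (fun u => PI - acorr U V u - 2 * u) 0 x <= 0.
Proof.
  intros Hx. assert (HPI := PI_RGT_0). assert (cK := acorr_cont).
  set (M := fun u => PI - acorr U V u - 2 * u).
  assert (cM : contR M) by (unfold M; contR).
  assert (HM : forall u v, 0 <= u -> 0 <= v -> u + v <= PI -> M u + M v <= M (u + v)).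
  { intros u v hu hv huv. assert (h := acorr_superadditive u v hu hv huv). unfold M. lra. }
  assert (M2 : M (PI / 2) = 0) by (unfold M; rewrite acorr_half; lra).
  set (I := fun x => RInt M 0 x).
  assert (dI : forall x, is_derive I x (M x)) by (intros; apply is_derive_RIntR; auto).
  (* Superadditivity of M, applied to u and y - u, is integrated over u in [[0, y]]. *)
  assert (HI : forall x, 0 <= x <= PI -> 2 * I x <= x * M x).
  { intros y Hy.
    replace (2 * I y) with (RInt (fun u => M u + M (y - u)) 0 y).
    - replace (y * M y) with (RInt (fun _ => M y) 0 y) by (rewrite RInt_constR, Rminus_0_r; reflexivity).
      apply RInt_leR; try lra; contR.
      intros u Hu. replace (M y) with (M (u + (y - u))) by (f_equal; ring). apply HM; lra.
    - rewrite RInt_plusR, RInt_reflectR by contR. rewrite Rminus_0_r, Rminus_eq_0. unfold I. Req; ring. }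
  fold (I x).
  destruct (Req_dec x 0) as [->|hx].
  { right. apply (RInt_point 0 M). }
  destruct (Req_dec x (PI / 2)) as [->|hx'].
  { assert (h := HI (PI / 2) ltac:(lra)). rewrite M2 in h. lra. }
  (* By [HI] the derivative of I y / y^2 is nonnegative, so its value at x is at most that at PI /
     2, where M = 0 makes it nonpositive. *)
  destruct (MVT_gen (fun y => I y / y ^ 2) x (PI / 2) (fun y => (M y * y - 2 * I y) / y ^ 3)) as [c [Hc E]].
  - rewrite Rmin_left, Rmax_right by lra. intros y Hy.
    evar_last.
    + apply (is_derive_div I (fun y => y ^ 2) y (M y) (2 * y)).
      * apply dI.
      * auto_derive; auto; Req; ring.
      * apply pow_nonzero; lra.
    + simpl. Req; field. lra.
  - rewrite Rmin_left, Rmax_right by lra. intros y Hy.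
    apply continuity_pt_filterlim.
    apply (ex_derive_continuous (fun y => I y / y ^ 2)).
    eexists. apply (is_derive_div I (fun y => y ^ 2) y (M y) (2 * y)).
    + apply dI.
    + auto_derive; auto; Req; ring.
    + apply pow_nonzero; lra.
  - rewrite Rmin_left, Rmax_right in Hc by lra.
    assert (h2 := HI (PI / 2) ltac:(lra)). rewrite M2 in h2.
    assert (hc := HI c ltac:(lra)).
    assert (0 <= (M c * c - 2 * I c) / c ^ 3).
    { apply Rle_mult_inv_pos; [lra | apply pow_lt; lra]. }
    assert (hq : I (PI / 2) / (PI / 2) ^ 2 <= 0).
    { assert (0 < / (PI / 2) ^ 2) by (apply Rinv_0_lt_compat, pow_lt; lra). unfold Rdiv at 1. nra. }
    assert (hq' : I x / x ^ 2 <= 0) by nra.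
    apply Rnot_lt_le. intros hi.
    assert (0 < I x / x ^ 2) by (apply Rdiv_lt_0_compat; auto; apply pow_lt; lra). lra.
Qed.

Lemma acorr_cos_half : 2 <= RInt (fun u => cos u * acorr U V u) 0 (PI / 2).
Proof.
  assert (HPI := PI_RGT_0). assert (cK := acorr_cont).
  set (M := fun u => PI - acorr U V u - 2 * u).
  assert (cM : contR M) by (unfold M; contR).
  set (I := fun x => RInt M 0 x).
  assert (dI : forall x, is_derive I x (M x)) by (intros; apply is_derive_RIntR; auto).
  assert (cI : contR I) by (apply contR_RInt; auto).
  (* Integration by parts; the boundary terms vanish because cos (PI / 2) = 0 and I 0 = 0. *)
  assert (E1 : RInt (fun u => cos u * M u - sin u * I u) 0 (PI / 2) = 0).
  { rewrite (RInt_FTC (fun u => cos u * I u)).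
    - rewrite cos_PI2. unfold I at 2. rewrite (RInt_point 0 M). unfold zero; simpl. Req; ring.
    - intros x. evar_last.
      + apply (is_derive_mult cos I x (- sin x) (M x)); [apply is_derive_cos | apply dI | apply Rmult_comm].
      + unfold plus, mult; simpl. Req; ring.
    - contR. }
  rewrite RInt_minusR in E1 by contR.
  assert (E2 : RInt (fun u => sin u * I u) 0 (PI / 2) <= RInt (fun _ => 0) 0 (PI / 2)).
  { apply RInt_leR; try lra; contR. intros u Hu.
    assert (h := acorr_integral_le u ltac:(lra)). fold M in h. fold (I u) in h.
    assert (0 <= sin u) by (apply sin_ge_0; lra). nra. }
  rewrite RInt_constR in E2.
  (* The value for the degenerate two-point curve, from which the bound 2 comes. *)
  assert (E3 : RInt (fun u => cos u * (PI - 2 * u)) 0 (PI / 2) = 2).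
  { rewrite (RInt_FTC (fun u => sin u * (PI - 2 * u) - 2 * cos u)).
    - rewrite sin_PI2, cos_PI2, sin_0, cos_0. Req; field.
    - intros x. auto_derive; auto. Req; ring.
    - contR. }
  assert (E4 : RInt (fun u => cos u * acorr U V u) 0 (PI / 2) =
     RInt (fun u => cos u * (PI - 2 * u)) 0 (PI / 2) - RInt (fun u => cos u * M u) 0 (PI / 2)).
  { rewrite <- RInt_minusR by contR. apply RInt_extR. intros u. unfold M. Req; ring. }
  lra.
Qed.

(** Both the cosine and the autocorrelation change sign under u -> PI - u, so the two halves of
    [[0, PI]] contribute equally, at least 2 each. *)
Lemma odd_curve_Fourier_ge :
  4 <= RInt (fun s => cos s * U s) 0 PI ^ 2 + RInt (fun s => sin s * U s) 0 PI ^ 2 +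
  RInt (fun s => cos s * V s) 0 PI ^ 2 + RInt (fun s => sin s * V s) 0 PI ^ 2.
Proof.
  rewrite <- acorr_Fourier. assert (cK := acorr_cont).
  rewrite <- (RInt_ChaslesR _ 0 (PI / 2) PI) by contR.
  replace (RInt (fun u => cos u * acorr U V u) (PI / 2) PI)
    with (RInt (fun u => cos u * acorr U V u) 0 (PI / 2)).
  - assert (h := acorr_cos_half). lra.
  - transitivity (RInt (fun u => cos (PI - u) * acorr U V (PI - u)) 0 (PI / 2)).
    + apply RInt_extR. intros u. rewrite acorr_reflect.
      replace (cos (PI - u)) with (- cos u) by (rewrite cos_minus, cos_PI, sin_PI; ring).
      Req; ring.
    + rewrite (RInt_reflectR (fun u => cos u * acorr U V u)) by contR.
      f_equal; Req; field.
Qed.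
End AutoCorrelation.

(** * Complex-valued functions on the circle *)

Lemma cderiv_eps h z l : cderiv h z l <->
  forall eps, 0 < eps -> exists del, 0 < del /\ forall w, Cmod (w - z) < del ->
    Cmod (h w - h z - (w - z) * l) <= eps * Cmod (w - z).
Proof.
  split.
  - intros [_ H] eps Heps.
    destruct (H z ltac:(intros P HP; exact HP) (mkposreal eps Heps)) as [del Hd].
    exists del. split; [apply cond_pos|]. intros w Hw. exact (Hd w Hw).
  - intros H. split; [apply is_linear_scal_l|].
    intros x0 Hx0 eps.
    apply (is_filter_lim_locally_unique (V := AbsRing_NormedModule C_AbsRing) z x0) in Hx0. subst x0.
    destruct (H eps (cond_pos eps)) as [del [Hd HH]].
    exists (mkposreal del Hd). intros w Hw. exact (HH w Hw).
Qed.

Lemma cderiv_cont h z l : cderiv h z l ->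
  forall eps, 0 < eps -> exists del, 0 < del /\ forall w, Cmod (w - z) < del -> Cmod (h w - h z) < eps.
Proof.
  intros H eps Heps. rewrite cderiv_eps in H. destruct (H 1 Rlt_0_1) as [del [Hd HH]].
  assert (h0 := Cmod_ge_0 l).
  exists (Rmin del (eps / (Cmod l + 2))). split.
  { apply Rmin_pos; auto. apply Rdiv_lt_0_compat; lra. }
  intros w Hw.
  assert (hw1 := Rmin_l del (eps / (Cmod l + 2))). assert (hw2 := Rmin_r del (eps / (Cmod l + 2))).
  assert (hw := HH w ltac:(lra)).
  replace (h w - h z)%C with ((h w - h z - (w - z) * l) + (w - z) * l)%C by ring.
  eapply Rle_lt_trans; [apply Cmod_triangle|]. rewrite Cmod_mult.
  assert (h1 := Cmod_ge_0 (w - z)).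
  apply Rle_lt_trans with (Cmod (w - z) * (Cmod l + 1)); [lra|].
  apply Rle_lt_trans with (eps / (Cmod l + 2) * (Cmod l + 1)); [apply Rmult_le_compat_r; lra|].
  apply Rlt_le_trans with (eps / (Cmod l + 2) * (Cmod l + 2)).
  - apply Rmult_lt_compat_l; [apply Rdiv_lt_0_compat; lra | lra].
  - right. field. lra.
Qed.

Lemma Csub_triangle (x y z : C) : Cmod (x - z) <= Cmod (x - y) + Cmod (y - z).
Proof. replace (x - z)%C with ((x - y) + (y - z))%C by ring. apply Cmod_triangle. Qed.

Lemma Cmod_sub_sym (x y : C) : Cmod (x - y) = Cmod (y - x).
Proof. rewrite <- (Cmod_opp (x - y)). f_equal. ring. Qed.

Lemma Cmod_le_Re_Im (z : C) : Cmod z <= Rabs (Re z) + Rabs (Im z).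
Proof.
  unfold Cmod. assert (h1 := Rabs_pos (Re z)). assert (h2 := Rabs_pos (Im z)).
  rewrite <- (sqrt_pow2 (Rabs (Re z) + Rabs (Im z))) by lra.
  apply sqrt_le_1_alt. rewrite <- (pow2_abs (fst z)), <- (pow2_abs (snd z)).
  unfold Re, Im in *. nra.
Qed.

Lemma Rabs_Re_le (z : C) : Rabs (Re z) <= Cmod z.
Proof. eapply Rle_trans; [|apply Rmax_Cmod]. apply Rmax_l. Qed.

Lemma Rabs_Im_le (z : C) : Rabs (Im z) <= Cmod z.
Proof. eapply Rle_trans; [|apply Rmax_Cmod]. apply Rmax_r. Qed.

Lemma Cmod_sqr (z : C) : Cmod z * Cmod z = Re z * Re z + Im z * Im z.
Proof. assert (h := Cmod2_alt z). simpl in h. rewrite !Rmult_1_r in h. exact h. Qed.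

Lemma Re_Im_eq (z w : C) : Re z = Re w -> Im z = Im w -> z = w.
Proof. destruct z, w; simpl; intros -> ->; reflexivity. Qed.

Definition ccont (f : R -> C) : Prop := contR (fun t => Re (f t)) /\ contR (fun t => Im (f t)).

Definition CI (f : R -> C) : C :=
  (RInt (fun t => Re (f t)) 0 (2 * PI), RInt (fun t => Im (f t)) 0 (2 * PI)).

Definition cis (t : R) : C := (cos t, sin t).

Lemma ccont_const c : ccont (fun _ => c).
Proof. split; contR. Qed.

Lemma ccont_RtoC f : contR f -> ccont (fun t => RtoC (f t)).
Proof. intros H; split; simpl; contR. Qed.

Lemma ccont_plus f g : ccont f -> ccont g -> ccont (fun t => (f t + g t)%C).
Proof.
  intros [f1 f2] [g1 g2]; split; simpl; unfold Re, Im in *.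
  - apply (contR_plus (fun t => fst (f t)) (fun t => fst (g t))); auto.
  - apply (contR_plus (fun t => snd (f t)) (fun t => snd (g t))); auto.
Qed.

Lemma ccont_opp f : ccont f -> ccont (fun t => (- f t)%C).
Proof.
  intros [f1 f2]; split; simpl.
  - apply (contR_opp (fun t => fst (f t))); auto.
  - apply (contR_opp (fun t => snd (f t))); auto.
Qed.

Lemma ccont_minus f g : ccont f -> ccont g -> ccont (fun t => (f t - g t)%C).
Proof. intros Hf Hg. apply (ccont_plus f (fun t => (- g t)%C)); auto. apply ccont_opp; auto. Qed.

Lemma ccont_mult f g : ccont f -> ccont g -> ccont (fun t => (f t * g t)%C).
Proof.
  intros [f1 f2] [g1 g2]; split; simpl; unfold Re, Im in *.
  - apply (contR_minus (fun t => fst (f t) * fst (g t)) (fun t => snd (f t) * snd (g t)));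
    [apply (contR_mult (fun t => fst (f t)) (fun t => fst (g t))) |
     apply (contR_mult (fun t => snd (f t)) (fun t => snd (g t)))]; auto.
  - apply (contR_plus (fun t => fst (f t) * snd (g t)) (fun t => snd (f t) * fst (g t)));
    [apply (contR_mult (fun t => fst (f t)) (fun t => snd (g t))) |
     apply (contR_mult (fun t => snd (f t)) (fun t => fst (g t)))]; auto.
Qed.

Lemma ccont_conj f : ccont f -> ccont (fun t => Cconj (f t)).
Proof. intros [f1 f2]; split; simpl; auto. apply (contR_opp (fun t => snd (f t))); auto. Qed.

Lemma ccont_cis f : contR f -> ccont (fun t => cis (f t)).
Proof. intros Hf. split; simpl; contR. Qed.

Lemma ccont_ext f g : (forall t, f t = g t) -> ccont f -> ccont g.
Proof. intros E [f1 f2]. split; [eapply contR_ext; [|exact f1] | eapply contR_ext; [|exact f2]];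
  intros t; simpl; rewrite E; reflexivity. Qed.

Lemma ccont_Cmod_sqr f : ccont f -> contR (fun t => Cmod (f t) ^ 2).
Proof.
  intros [f1 f2]. apply (contR_ext (fun t => Re (f t) * Re (f t) + Im (f t) * Im (f t))).
  - intros t. rewrite Cmod2_alt. ring.
  - contR.
Qed.

Lemma Cinv_Cconj_Cmod (z : C) : z <> 0%C -> (/ z)%C = (Cconj z * RtoC (/ (Cmod z ^ 2)))%C.
Proof.
  intros Hz. assert (h := Cmod2_conj z).
  assert (0 < Cmod z ^ 2) by (apply pow_lt, Cmod_gt_0; auto).
  assert (Hc : Cconj z <> 0%C).
  { intros E. rewrite E, Cmult_0_r in h. apply RtoC_inj in h. lra. }
  rewrite RtoC_inv by lra. rewrite h. field. auto.
Qed.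

Lemma ccont_inv f : ccont f -> (forall t, f t <> 0%C) -> ccont (fun t => (/ f t)%C).
Proof.
  intros Hf H0. apply (ccont_ext (fun t => (Cconj (f t) * RtoC (/ (Cmod (f t) ^ 2)))%C)).
  - intros t. rewrite Cinv_Cconj_Cmod; auto.
  - apply (ccont_mult (fun t => Cconj (f t)) (fun t => RtoC (/ (Cmod (f t) ^ 2)))).
    + apply ccont_conj; auto.
    + apply (ccont_RtoC (fun t => / Cmod (f t) ^ 2)).
      apply (contR_inv (fun t => Cmod (f t) ^ 2)).
      * apply ccont_Cmod_sqr; auto.
      * intros t. apply pow_nonzero. intros E. apply (H0 t). apply Cmod_eq_0. exact E.
Qed.

Lemma ccont_pow f n : ccont f -> ccont (fun t => (f t ^ n)%C).
Proof.
  intros Hf. induction n as [|n IH]; simpl.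
  - apply ccont_const.
  - apply (ccont_mult f (fun t => (f t ^ n)%C)); auto.
Qed.

Ltac ccont_step :=
  match goal with
  | H : ccont ?f |- ccont ?f => exact H
  | H : ccont ?f |- ccont (fun x => ?f x) => exact H
  | |- ccont (fun _ => ?c) => exact (ccont_const c)
  | |- ccont (fun x => (@?f x + @?g x)%C) => apply (ccont_plus f g)
  | |- ccont (fun x => (@?f x - @?g x)%C) => apply (ccont_minus f g)
  | |- ccont (fun x => (@?f x * @?g x)%C) => apply (ccont_mult f g)
  | |- ccont (fun x => (- @?f x)%C) => apply (ccont_opp f)
  | |- ccont (fun x => Cconj (@?f x)) => apply (ccont_conj f)
  | |- ccont (fun x => (@?f x ^ ?n)%C) => apply (ccont_pow f n)
  | |- ccont cis => apply (ccont_cis (fun t => t) contR_id)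
  | |- ccont (fun x => cis (@?f x)) => apply (ccont_cis f)
  | |- ccont (fun x => RtoC (@?f x)) => apply (ccont_RtoC f)
  end.
Ltac ccont := repeat ccont_step; contR.

Lemma CI_ext f g : (forall t, f t = g t) -> CI f = CI g.
Proof. intros E. unfold CI. f_equal; apply RInt_extR; intros t; rewrite E; reflexivity. Qed.

Lemma CI_plus f g : ccont f -> ccont g -> CI (fun t => (f t + g t)%C) = (CI f + CI g)%C.
Proof.
  intros [f1 f2] [g1 g2]. unfold CI, Cplus; simpl. f_equal.
  - apply (RInt_plusR (fun t => Re (f t)) (fun t => Re (g t))); auto.
  - apply (RInt_plusR (fun t => Im (f t)) (fun t => Im (g t))); auto.
Qed.

Lemma CI_minus f g : ccont f -> ccont g -> CI (fun t => (f t - g t)%C) = (CI f - CI g)%C.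
Proof.
  intros [f1 f2] [g1 g2]. unfold CI, Cminus, Cplus, Copp; simpl. f_equal.
  - apply (RInt_minusR (fun t => Re (f t)) (fun t => Re (g t))); auto.
  - apply (RInt_minusR (fun t => Im (f t)) (fun t => Im (g t))); auto.
Qed.

Lemma CI_scal c f : ccont f -> CI (fun t => (c * f t)%C) = (c * CI f)%C.
Proof.
  intros [f1 f2]. unfold CI, Cmult; simpl. f_equal.
  - rewrite (RInt_minusR (fun t => fst c * Re (f t)) (fun t => snd c * Im (f t))) by contR.
    rewrite !RInt_scalR by auto. reflexivity.
  - rewrite (RInt_plusR (fun t => fst c * Im (f t)) (fun t => snd c * Re (f t))) by contR.
    rewrite !RInt_scalR by auto. reflexivity.
Qed.

Lemma CI_conj f : ccont f -> CI (fun t => Cconj (f t)) = Cconj (CI f).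
Proof.
  intros [f1 f2]. unfold CI, Cconj; simpl. f_equal.
  apply (RInt_oppR (fun t => Im (f t))); auto.
Qed.

Lemma CI_const c : CI (fun _ => c) = (2 * PI * c)%C.
Proof.
  unfold CI. rewrite !RInt_constR. unfold Cmult, RtoC; destruct c; simpl. f_equal; ring.
Qed.

(** The factor is 4 PI and not 2 PI because the real and imaginary parts are bounded separately;
    only the linear dependence on M matters below. *)
Lemma CI_bound f M : ccont f -> (forall t, Cmod (f t) <= M) -> Cmod (CI f) <= 4 * PI * M.
Proof.
  intros [f1 f2] H. assert (HPI := PI_RGT_0).
  eapply Rle_trans; [apply Cmod_le_Re_Im|].
  unfold CI; simpl.
  assert (h1 : Rabs (RInt (fun t => Re (f t)) 0 (2 * PI)) <= (2 * PI - 0) * M).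
  { apply RInt_absR; auto; [lra|]. intros. eapply Rle_trans; [apply Rabs_Re_le | apply H]. }
  assert (h2 : Rabs (RInt (fun t => Im (f t)) 0 (2 * PI)) <= (2 * PI - 0) * M).
  { apply RInt_absR; auto; [lra|]. intros. eapply Rle_trans; [apply Rabs_Im_le | apply H]. }
  lra.
Qed.

Lemma Cconj_RtoC (x : R) : Cconj (RtoC x) = RtoC x.
Proof. apply Re_Im_eq; simpl; ring. Qed.

Lemma cis_plus s t : cis (s + t) = (cis s * cis t)%C.
Proof. unfold cis, Cmult; simpl. rewrite cos_plus, sin_plus. f_equal; ring. Qed.

Lemma cis_0 : cis 0 = 1%C.
Proof. unfold cis. rewrite cos_0, sin_0. reflexivity. Qed.

Lemma cis_opp t : cis (- t) = Cconj (cis t).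
Proof. unfold cis, Cconj; simpl. rewrite cos_neg, sin_neg. reflexivity. Qed.

Lemma Cmod_cis t : Cmod (cis t) = 1.
Proof.
  unfold cis, Cmod; simpl. assert (h := sin2_cos2 t). unfold Rsqr in h.
  transitivity (sqrt 1); [f_equal; lra | apply sqrt_1].
Qed.

Lemma cis_INR n t : (cis t ^ n)%C = cis (INR n * t).
Proof.
  induction n as [|n IH].
  - simpl. rewrite Rmult_0_l, cis_0. reflexivity.
  - rewrite Cpow_S, IH, <- cis_plus, S_INR. f_equal. ring.
Qed.

Lemma cis_surj (z : C) : Cmod z = 1 -> exists t, 0 <= t < 2 * PI /\ z = cis t.
Proof.
  intros H. destruct z as [x y]. assert (HPI := PI_RGT_0).
  assert (E : x * x + y * y = 1) by (assert (h := Cmod_sqr (x, y)); rewrite H in h; simpl in h; lra).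
  assert (Hx : -1 <= x <= 1) by nra.
  assert (b := acos_bound x). assert (c := cos_acos x Hx). assert (s := sin_acos x Hx).
  assert (e : sqrt (1 - x²) = Rabs y).
  { rewrite <- sqrt_Rsqr_abs. f_equal. unfold Rsqr. lra. }
  destruct (Rle_dec 0 y) as [h|h].
  - exists (acos x). split; [lra|]. unfold cis. rewrite c, s, e, Rabs_right by lra. reflexivity.
  - exists (2 * PI - acos x). split.
    + destruct (Req_dec (acos x) 0) as [z|z]; [exfalso|lra]. rewrite z, sin_0, e, Rabs_left in s by lra. lra.
    + unfold cis. replace (2 * PI - acos x) with (- acos x + 2 * INR 1 * PI) by (simpl; ring).
      rewrite cos_period, sin_period, cos_neg, sin_neg, c, s, e, Rabs_left by lra. f_equal. ring.
Qed.

Lemma polar (z : C) : 0 < Cmod z -> exists t, Re z = Cmod z * cos t /\ Im z = Cmod z * sin t.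
Proof.
  intros Hz. assert (E := Cmod_sqr z). set (r := Cmod z) in *. destruct z as [x y]; simpl in *.
  destruct (cis_surj (x / r, y / r)) as [t [_ Et]].
  { assert (e : Cmod (x / r, y / r) * Cmod (x / r, y / r) = 1).
    { rewrite Cmod_sqr; simpl. field_simplify_eq; lra. }
    assert (k := Cmod_ge_0 (x / r, y / r)). nra. }
  exists t. assert (e1 := f_equal fst Et). assert (e2 := f_equal snd Et). simpl in e1, e2.
  rewrite <- e1, <- e2. split; field; lra.
Qed.

Lemma CI_cis (k : Z) : k <> 0%Z -> CI (fun t => cis (IZR k * t)) = 0%C.
Proof.
  intros Hk. assert (IZR k <> 0) by (apply not_0_IZR; auto).
  assert (p : forall t, cos (t + 2 * PI * IZR k) = cos t /\ sin (t + 2 * PI * IZR k) = sin t).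
  { intros t. destruct (Z_le_gt_dec 0 k) as [h|h].
    - rewrite <- (Z2Nat.id k h), <- INR_IZR_INZ.
      replace (2 * PI * INR (Z.to_nat k)) with (2 * INR (Z.to_nat k) * PI) by ring.
      split; [apply cos_period | apply sin_period].
    - replace k with (- Z.of_nat (Z.to_nat (- k)))%Z by lia.
      rewrite opp_IZR, <- INR_IZR_INZ. set (n := Z.to_nat (- k)).
      split.
      + rewrite <- (cos_period _ n). f_equal. ring.
      + rewrite <- (sin_period _ n). f_equal. ring. }
  unfold CI; simpl. change (RtoC 0) with (0, 0). f_equal.
  - rewrite (RInt_FTC (fun t => sin (IZR k * t) / IZR k)).
    + replace (IZR k * (2 * PI)) with (0 + 2 * PI * IZR k) by ring.
      destruct (p 0) as [_ ->]. rewrite Rmult_0_r. apply Rminus_eq_0.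
    + intros x. auto_derive; auto. field; auto.
    + contR.
  - rewrite (RInt_FTC (fun t => - cos (IZR k * t) / IZR k)).
    + replace (IZR k * (2 * PI)) with (0 + 2 * PI * IZR k) by ring.
      destruct (p 0) as [-> _]. rewrite Rmult_0_r. apply Rminus_eq_0.
    + intros x. auto_derive; auto. field; auto.
    + contR.
Qed.

(** * Fourier coefficients of power series *)

(** Partial sums through degree n, in plain complex arithmetic so that [ring] and [simpl] apply. *)
Fixpoint psum (a : nat -> C) (z : C) (n : nat) : C :=
  match n with
  | O => a O
  | S m => (psum a z m + z ^ S m * a (S m))%C
  end.

Lemma pow_n_Cpow (z : C) n : pow_n (K := C_AbsRing) z n = (z ^ n)%C.
Proof. induction n as [|n IH]; [reflexivity|]. simpl. rewrite IH. reflexivity. Qed.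

Lemma psum_sum_n a z n :
  sum_n (G := C_NormedModule) (fun k => scal (K := C_AbsRing) (V := C_NormedModule) (pow_n (K := C_AbsRing) z k) (a k)) n
  = psum a z n.
Proof.
  induction n as [|n IH].
  - rewrite sum_O. apply Cmult_1_l.
  - rewrite sum_Sn, IH, pow_n_Cpow. reflexivity.
Qed.

Lemma pseries_eps a z l : is_pseries (K := C_AbsRing) (V := C_NormedModule) a z l <->
  forall eps, 0 < eps -> exists N, forall n, (N <= n)%nat -> Cmod (psum a z n - l) < eps.
Proof.
  unfold is_pseries, is_series. split.
  - intros H eps Heps.
    assert (K := proj1 (filterlim_locally_ball_norm (K := C_AbsRing) (U := C_NormedModule) (F := eventually) _ l) H (mkposreal eps Heps)).
    destruct K as [N HN]. exists N. intros n Hn. rewrite <- psum_sum_n. exact (HN n Hn).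
  - intros H. apply (filterlim_locally_ball_norm (K := C_AbsRing) (U := C_NormedModule)).
    intros eps. destruct (H eps (cond_pos eps)) as [N HN]. exists N. intros n Hn.
    rewrite psum_sum_n. exact (HN n Hn).
Qed.

Lemma geom_small K q eps : 0 <= q < 1 -> 0 < eps -> exists N, forall n, (N <= n)%nat -> K * q ^ n < eps.
Proof.
  intros Hq He.
  assert (h := Rabs_pos K).
  destruct (pow_lt_1_zero q ltac:(rewrite Rabs_right; lra) (eps / (Rabs K + 1))) as [N HN].
  { apply Rdiv_lt_0_compat; lra. }
  exists N. intros n Hn. specialize (HN n Hn).
  assert (0 <= q ^ n) by (apply pow_le; lra). rewrite Rabs_right in HN by lra.
  apply Rle_lt_trans with (Rabs K * q ^ n).
  - apply Rmult_le_compat_r; auto. apply Rle_abs.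
  - apply Rle_lt_trans with (Rabs K * (eps / (Rabs K + 1))); [nra|].
    apply Rlt_le_trans with ((Rabs K + 1) * (eps / (Rabs K + 1))).
    + assert (0 < eps / (Rabs K + 1)) by (apply Rdiv_lt_0_compat; lra). nra.
    + right; field; lra.
Qed.

Lemma psum_tail a z l C q : 0 <= q < 1 -> 0 <= C -> (forall k, Cmod (z ^ k * a k) <= C * q ^ k) ->
  is_pseries (K := C_AbsRing) (V := C_NormedModule) a z l ->
  forall n, Cmod (psum a z n - l) <= C / (1 - q) * q ^ n.
Proof.
  intros Hq HC Hb Hl n. rewrite pseries_eps in Hl.
  (* Keeping the subtracted term q^(n + m) is what lets the induction on m close. *)
  assert (Hm : forall m, Cmod (psum a z (n + m) - psum a z n) <= C / (1 - q) * (q ^ n - q ^ (n + m))).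
  { induction m as [|m IH].
    - rewrite Nat.add_0_r. unfold Cminus. rewrite Cplus_opp_r, Cmod_0, Rminus_eq_0. lra.
    - rewrite Nat.add_succ_r. simpl psum.
      replace (psum a z (n + m) + z * z ^ (n + m) * a (S (n + m)) - psum a z n)%C
        with ((psum a z (n + m) - psum a z n) + z ^ S (n + m) * a (S (n + m)))%C by (simpl; ring).
      eapply Rle_trans; [apply Cmod_triangle|].
      assert (h := Hb (S (n + m))). simpl in h |- *.
      apply Rle_trans with (C / (1 - q) * (q ^ n - q ^ (n + m)) + C * (q * q ^ (n + m))); [lra|].
      assert (0 <= q ^ (n + m)) by (apply pow_le; lra).
      replace (C * (q * q ^ (n + m))) with (C / (1 - q) * ((1 - q) * q * q ^ (n + m))) by (field; lra).
      rewrite <- Rmult_plus_distr_l.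
      apply Rmult_le_compat_l; [apply Rle_mult_inv_pos; lra|].
      assert (0 <= (1 - q) * (1 - q) * q ^ (n + m)) by (apply Rmult_le_pos; nra). nra. }
  apply le_epsilon. intros eps He.
  destruct (Hl eps He) as [N HN].
  assert (h := HN (n + N)%nat ltac:(lia)).
  replace (psum a z n - l)%C with ((psum a z n - psum a z (n + N)) + (psum a z (n + N) - l))%C by ring.
  eapply Rle_trans; [apply Cmod_triangle|].
  assert (h2 := Hm N). rewrite Cmod_sub_sym in h2.
  assert (0 <= q ^ (n + N)) by (apply pow_le; lra).
  assert (0 <= C / (1 - q)) by (apply Rle_mult_inv_pos; lra).
  nra.
Qed.

(** Abel's lemma: the terms are bounded at a point p between r and 1, so for |z| <= r they decay
    like (r / p)^k. *)
Lemma pseries_unif a h r : power_series_on_D a h -> 0 <= r < 1 ->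
  exists K q, 0 <= q < 1 /\ forall z, Cmod z <= r -> forall n, Cmod (psum a z n - h z) <= K * q ^ n.
Proof.
  intros Ha Hr. set (p := (r + 1) / 2).
  assert (Hp : 0 < p < 1 /\ r < p) by (unfold p; lra).
  assert (Hd : inD (RtoC p)) by (unfold inD; rewrite Cmod_R, Rabs_right; lra).
  assert (Hs := Ha _ Hd).
  destruct (filterlim_bounded (K := C_AbsRing) (V := C_NormedModule) _ (ex_intro _ _ Hs)) as [M HM].
  assert (HM' : forall n, Cmod (psum a (RtoC p) n) <= M).
  { intros n. rewrite <- psum_sum_n. exact (HM n). }
  assert (HM0 : 0 <= M) by (eapply Rle_trans; [apply Cmod_ge_0 | apply (HM' O)]).
  assert (Ht : forall k, Cmod (RtoC p ^ k * a k) <= 2 * M).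
  { intros [|k].
    - assert (h0 := HM' O). simpl in *. rewrite Cmult_1_l. lra.
    - replace (RtoC p ^ S k * a (S k))%C with (psum a (RtoC p) (S k) - psum a (RtoC p) k)%C by (simpl; ring).
      unfold Cminus. eapply Rle_trans; [apply Cmod_triangle|]. rewrite Cmod_opp.
      assert (h1 := HM' k). assert (h2 := HM' (S k)). lra. }
  set (q := r / p).
  assert (Hq : 0 <= q < 1).
  { unfold q. split; [apply Rle_mult_inv_pos; lra|].
    apply Rmult_lt_reg_r with p; [lra|]. unfold Rdiv. rewrite Rmult_assoc, Rinv_l by lra. lra. }
  exists (2 * M / (1 - q)), q. split; auto.
  intros z Hz n. apply psum_tail; auto; [lra| |].
  - intros k. assert (h0 := Ht k). rewrite Cmod_mult, Cmod_pow in *. rewrite Cmod_R, Rabs_right in h0 by lra.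
    assert (hz := Cmod_ge_0 z). assert (hak := Cmod_ge_0 (a k)).
    apply Rle_trans with (r ^ k * Cmod (a k)).
    + apply Rmult_le_compat_r; auto. apply pow_incr; lra.
    + replace (r ^ k) with (q ^ k * p ^ k) by (rewrite <- Rpow_mult_distr; f_equal; unfold q; field; lra).
      assert (0 <= q ^ k) by (apply pow_le; lra). nra.
  - apply Ha. unfold inD. lra.
Qed.

Lemma psum_ccont a r n : ccont (fun t => psum a (RtoC r * cis t)%C n).
Proof.
  induction n as [|n IH]; simpl; [apply ccont_const|].
  apply (ccont_plus (fun t => psum a (RtoC r * cis t)%C n)); auto.
  apply (ccont_mult (fun t => (r * cis t * (r * cis t) ^ n)%C)); ccont.
Qed.

Lemma CI_term r a k m : (Z.of_nat k + m <> 0)%Z ->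
  CI (fun t => ((RtoC r * cis t) ^ k * a * cis (IZR m * t))%C) = 0%C.
Proof.
  intros Hk.
  rewrite (CI_ext _ (fun t => (r ^ k * a * cis (IZR (Z.of_nat k + m) * t))%C)).
  - rewrite CI_scal by ccont. rewrite CI_cis by auto. ring.
  - intros t. rewrite Cpow_mult_l, cis_INR, plus_IZR, Rmult_plus_distr_r, cis_plus, INR_IZR_INZ.
    ring.
Qed.

Lemma CI_psum_succ a r n m :
  CI (fun t => (psum a (RtoC r * cis t) (S n) * cis (IZR m * t))%C) =
  (CI (fun t => psum a (RtoC r * cis t) n * cis (IZR m * t)) +
   CI (fun t => (RtoC r * cis t) ^ S n * a (S n) * cis (IZR m * t)))%C.
Proof.
  assert (h := psum_ccont a r n).
  rewrite <- CI_plus by ccont. apply CI_ext. intros t. simpl. ring.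
Qed.

Lemma CI_psum_pos a r n : CI (fun t => (psum a (RtoC r * cis t) n * cis (IZR 1 * t))%C) = 0%C.
Proof.
  induction n as [|n IH].
  - simpl. rewrite CI_scal by ccont. rewrite CI_cis by lia. ring.
  - rewrite CI_psum_succ, IH, CI_term by lia. ring.
Qed.

(** The term of degree 1 is the only one of frequency 0; the upper degree [S n] guarantees that it
    is present. *)
Lemma CI_psum_neg a r n :
  CI (fun t => (psum a (RtoC r * cis t) (S n) * cis (IZR (-1) * t))%C) = (2 * PI * r * a 1%nat)%C.
Proof.
  induction n as [|n IH].
  - rewrite CI_psum_succ. simpl psum. rewrite CI_scal by ccont. rewrite CI_cis by lia.
    rewrite (CI_ext _ (fun t => (r * a 1%nat)%C)).
    + rewrite CI_const. ring.
    + intros t. replace (IZR (-1) * t) with (- t) by ring.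
      transitivity (r * a 1%nat * (cis t * cis (- t)))%C; [simpl; ring|].
      rewrite <- cis_plus, Rplus_opp_r, cis_0. ring.
  - rewrite CI_psum_succ, IH, CI_term by lia. ring.
Qed.

Lemma Cmod_small_eq (x y : C) : (forall eps, 0 < eps -> Cmod (x - y) <= eps) -> x = y.
Proof.
  intros H. assert (E : (x - y)%C = 0%C).
  { apply Cmod_eq_0. apply Rle_antisym; [|apply Cmod_ge_0].
    apply le_epsilon. intros e He. rewrite Rplus_0_l. auto. }
  replace x with ((x - y) + y)%C by ring. rewrite E. ring.
Qed.

Definition differentiable_on_D (h : C -> C) := forall z, inD z -> exists l, cderiv h z l.

Lemma contR_eps f : (forall x eps, 0 < eps -> exists del, 0 < del /\ forall y, Rabs (y - x) < del ->
  Rabs (f y - f x) < eps) -> contR f.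
Proof.
  intros H x. apply filterlim_locally. intros eps.
  destruct (H x eps (cond_pos eps)) as [del [Hd HH]].
  exists (mkposreal del Hd). intros y Hy. exact (HH y Hy).
Qed.

Lemma contR_eps_inv f : contR f -> forall x eps, 0 < eps -> exists del, 0 < del /\
  forall y, Rabs (y - x) < del -> Rabs (f y - f x) < eps.
Proof.
  intros H x eps He. destruct (proj1 (filterlim_locally f (f x)) (H x) (mkposreal eps He)) as [d Hd].
  exists d. split; [apply cond_pos|]. intros y Hy. exact (Hd y Hy).
Qed.

Lemma ccont_eps f : (forall x eps, 0 < eps -> exists del, 0 < del /\ forall y, Rabs (y - x) < del ->
  Cmod (f y - f x) < eps) <-> ccont f.
Proof.
  split.
  - intros H. split; apply contR_eps; intros x eps He; destruct (H x eps He) as [del [Hd HH]];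
      exists del; split; auto; intros y Hy; eapply Rle_lt_trans; [|apply (HH y Hy)| |apply (HH y Hy)].
    + apply (Rabs_Re_le (f y - f x)).
    + apply (Rabs_Im_le (f y - f x)).
  - intros [f1 f2] x eps He.
    destruct (contR_eps_inv _ f1 x (eps / 2)) as [d1 [h1 H1]]; [lra|].
    destruct (contR_eps_inv _ f2 x (eps / 2)) as [d2 [h2 H2]]; [lra|].
    exists (Rmin d1 d2). split; [apply Rmin_pos; auto|]. intros y Hy.
    assert (k1 := H1 y (Rlt_le_trans _ _ _ Hy (Rmin_l _ _))).
    assert (k2 := H2 y (Rlt_le_trans _ _ _ Hy (Rmin_r _ _))).
    eapply Rle_lt_trans; [apply Cmod_le_Re_Im|]. simpl. unfold Re, Im, Rminus in *. lra.
Qed.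

Lemma ccont_along (f : C -> C) (g : R -> C) (A : C -> Prop) : ccont g -> (forall t, A (g t)) ->
  (forall z, A z -> cont_within A f z) -> ccont (fun t => f (g t)).
Proof.
  intros Hg HA Hf. apply ccont_eps. intros x eps He.
  destruct (Hf _ (HA x) eps He) as [d [hd H]].
  destruct (proj2 (ccont_eps g) Hg x d hd) as [d' [hd' H']].
  exists d'. split; auto.
Qed.

Lemma inD_circle r t : 0 <= r < 1 -> inD (RtoC r * cis t)%C.
Proof. intros Hr. unfold inD. rewrite Cmod_mult, Cmod_cis, Cmod_R, Rabs_right; lra. Qed.

Lemma holo_circle_ccont h r : differentiable_on_D h -> 0 <= r < 1 ->
  ccont (fun t => h (RtoC r * cis t)%C).
Proof.
  intros Hh Hr. apply (ccont_along h (fun t => (RtoC r * cis t)%C) inD).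
  - ccont.
  - intros t. apply inD_circle; auto.
  - intros z Hz eps He. destruct (Hh z Hz) as [l Hl].
    destruct (cderiv_cont h z l Hl eps He) as [d [hd H]]. exists d. split; auto.
Qed.

(** Uniform geometric convergence on the circle of radius r carries the coefficient formulas from
    the partial sums to h. *)
Lemma holo_Fourier a h r : power_series_on_D a h -> differentiable_on_D h -> 0 <= r < 1 ->
  CI (fun t => (h (RtoC r * cis t) * cis (IZR (-1) * t))%C) = (2 * PI * r * a 1%nat)%C /\
  CI (fun t => (h (RtoC r * cis t) * cis (IZR 1 * t))%C) = 0%C.
Proof.
  intros Ha Hh Hr. assert (hc := holo_circle_ccont h r Hh Hr).
  destruct (pseries_unif a h r Ha Hr) as [K [q [Hq HK]]].
  assert (B : forall m n,
    Cmod (CI (fun t => (psum a (RtoC r * cis t) n * cis (IZR m * t))%C) -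
          CI (fun t => (h (RtoC r * cis t) * cis (IZR m * t))%C)) <= 4 * PI * (K * q ^ n)).
  { intros m n. assert (hp := psum_ccont a r n). rewrite <- CI_minus by ccont.
    apply CI_bound; [ccont|]. intros t.
    replace (psum a (r * cis t) n * cis (IZR m * t) - h (r * cis t) * cis (IZR m * t))%C
      with ((psum a (r * cis t) n - h (r * cis t)) * cis (IZR m * t))%C by ring.
    rewrite Cmod_mult, Cmod_cis, Rmult_1_r. apply HK.
    rewrite Cmod_mult, Cmod_cis, Cmod_R, Rabs_right; lra. }
  assert (HPI := PI_RGT_0).
  split; symmetry; apply Cmod_small_eq; intros eps He;
    destruct (geom_small (4 * PI * K) q eps Hq He) as [N HN].
  - rewrite <- (CI_psum_neg a r N). eapply Rle_trans; [apply B|].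
    rewrite <- Rmult_assoc. apply Rlt_le, HN. lia.
  - rewrite <- (CI_psum_pos a r N). eapply Rle_trans; [apply B|].
    rewrite <- Rmult_assoc. apply Rlt_le, HN. lia.
Qed.

(** * The lower bound *)

(** The form in which compactness of the closed disk is used for uniform continuity, for maxima and
    for inverses: a finite subcover enters only through its least radius e. *)
Lemma Dbar_compact (d : C -> R) : (forall u, inDbar u -> 0 < d u) ->
  exists e, 0 < e /\ forall z, inDbar z -> exists u, inDbar u /\ Cmod (z - u) < d u /\ e <= d u.
Proof.
  intros Hd.
  (* The gauge is halved because the two coordinate bounds add up to a bound on the modulus. At a
     centre outside the disk it is so small that no point of the disk is within reach. *)
  set (d2 := fun x y => if Rle_dec (Cmod (x, y)) 1 then d (x, y) / 2 else (Cmod (x, y) - 1) / 2).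
  assert (Hp : forall x y, 0 < d2 x y).
  { intros x y. unfold d2. destruct Rle_dec as [h|h]; [|lra]. assert (k := Hd (x, y) h). lra. }
  destruct (compactness_value_2d (-1) 1 (-1) 1 (fun x y => mkposreal _ (Hp x y))) as [e He].
  exists e. split; [apply cond_pos|]. intros [x y] Hz. unfold inDbar in Hz.
  assert (hx := Rabs_Re_le (x, y)). assert (hy := Rabs_Im_le (x, y)). simpl in hx, hy.
  destruct (NNPP _ (He x y ltac:(apply Rabs_le_between; lra) ltac:(apply Rabs_le_between; lra)))
    as [u [v [_ [_ [H1 [H2 H3]]]]]].
  simpl in H1, H2, H3.
  assert (Hm : Cmod ((x, y) - (u, v)) <= Rabs (x - u) + Rabs (y - v))
    by exact (Cmod_le_Re_Im ((x, y) - (u, v))).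
  exists (u, v). unfold d2 in *. destruct (Rle_dec (Cmod (u, v)) 1) as [h|h].
  - assert (k := Hd (u, v) h). split; [exact h|]. split; lra.
  - exfalso. assert (k := Cmod_triangle ((u, v) - (x, y)) (x, y)). rewrite Cmod_sub_sym in k.
    assert (e0 : forall p q : C, (p - q + q)%C = p) by (intros; ring).
    rewrite e0 in k. lra.
Qed.

Lemma Dbar_uniform F : (forall z, inDbar z -> cont_within inDbar F z) ->
  forall eps, 0 < eps -> exists del, 0 < del /\ forall z w, inDbar z -> inDbar w ->
    Cmod (w - z) < del -> Cmod (F w - F z) < eps.
Proof.
  intros HF eps He.
  (* The hypothesis on z sits inside the existential so that choice yields a total function. *)
  assert (H : forall z, exists d, inDbar z -> 0 < d /\ forall w, inDbar w -> Cmod (w - z) < d ->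
    Cmod (F w - F z) < eps / 2).
  { intros z. destruct (classic (inDbar z)) as [h|h].
    - destruct (HF z h (eps / 2)) as [d Hd]; [lra|]. exists d. auto.
    - exists 1. tauto. }
  set (d := fun z => proj1_sig (constructive_indefinite_description _ (H z))).
  assert (Hd : forall z, inDbar z -> 0 < d z /\ forall w, inDbar w -> Cmod (w - z) < d z ->
    Cmod (F w - F z) < eps / 2).
  { intros z. unfold d. destruct constructive_indefinite_description. simpl. auto. }
  (* With half the radius, any w within e of z still lies in the full ball around the centre chosen
     for z. *)
  destruct (Dbar_compact (fun z => d z / 2)) as [e [he HH]].
  { intros u Hu. assert (k := proj1 (Hd u Hu)). lra. }
  exists e. split; auto. intros z w Hz Hw Hzw.
  destruct (HH z Hz) as [u [Hu [H1 H2]]]. destruct (Hd u Hu) as [h0 h1].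
  assert (k1 := h1 z Hz ltac:(lra)).
  assert (k2 := h1 w Hw ltac:(assert (k := Csub_triangle w z u); lra)).
  assert (k := Csub_triangle (F w) (F u) (F z)). rewrite (Cmod_sub_sym (F u)) in k. lra.
Qed.

Lemma cis_inj s t : Rabs (s - t) < 2 * PI -> cis s = cis t -> s = t.
Proof.
  intros H E. assert (HPI := PI_RGT_0). apply Rabs_def2 in H.
  assert (Ec : cos s = cos t) by (exact (f_equal fst E)).
  assert (Es : sin s = sin t) by (exact (f_equal snd E)).
  assert (h : cos (2 * ((s - t) / 2)) = 1).
  { replace (2 * ((s - t) / 2)) with (s - t) by field. rewrite cos_minus, Ec, Es.
    assert (k := sin2_cos2 t). unfold Rsqr in k. lra. }
  rewrite cos_2a_sin in h.
  assert (z : sin ((s - t) / 2) = 0) by nra.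
  destruct (Rtotal_order s t) as [l|[l|l]]; auto; exfalso.
  - assert (k : 0 < sin (- ((s - t) / 2))) by (apply sin_gt_0; lra). rewrite sin_neg in k. lra.
  - assert (k : 0 < sin ((s - t) / 2)) by (apply sin_gt_0; lra). lra.
Qed.

Lemma cis_PI t : cis (t + PI) = (- cis t)%C.
Proof. unfold cis, Copp; simpl. rewrite neg_cos, neg_sin. reflexivity. Qed.

Lemma boundary_odd_curve f F : bij_onto inD inD f -> homeo_Dbar F ->
  (forall z, inD z -> F z = f z) -> (forall z, onT z -> F (- z)%C = (- F z)%C) ->
  odd_curve (fun t => Re (F (cis t))) (fun t => Im (F (cis t))).
Proof.
  intros [_ [_ fsurj]] [[Fin [Finj _]] [Fcont _]] Ff Fodd.
  assert (HD : forall t, inDbar (cis t)) by (intros t; unfold inDbar; rewrite Cmod_cis; lra).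
  assert (HT : forall t, onT (cis t)) by (intros t; apply Cmod_cis).
  assert (Hc : ccont (fun t => F (cis t))).
  { apply (ccont_along F cis inDbar); auto. ccont. }
  destruct Hc as [c1 c2].
  split; auto.
  - intros t. rewrite <- Cmod_sqr.
    assert (Cmod (F (cis t)) = 1); [|nra].
    (* A boundary value inside the open disk would also be taken at an interior point, because f is
       onto; this contradicts the injectivity of F. *)
    destruct (Rle_lt_or_eq_dec _ _ (Fin _ (HD t))) as [h|h]; auto. exfalso.
    destruct (fsurj _ h) as [z [Hz E]]. rewrite <- Ff in E by auto.
    apply Finj in E; auto.
    + subst z. unfold inD in Hz. rewrite Cmod_cis in Hz. lra.
    + unfold inDbar. unfold inD in Hz. lra.
  - intros t. rewrite cis_PI, Fodd by auto. reflexivity.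
  - intros t. rewrite cis_PI, Fodd by auto. reflexivity.
  - intros s t H E1 E2. apply cis_inj; auto. apply Finj; auto. apply Re_Im_eq; auto.
Qed.

(** The power series live on circles of radius r < 1 only; uniform continuity of F on the closed
    disk lets r tend to 1. *)
Lemma boundary_Fourier a b h g F : power_series_on_D a h -> power_series_on_D b g ->
  differentiable_on_D h -> differentiable_on_D g ->
  (forall z, inDbar z -> cont_within inDbar F z) ->
  (forall z, inD z -> F z = (h z + Cconj (g z))%C) ->
  CI (fun t => (F (cis t) * cis (IZR (-1) * t))%C) = (2 * PI * a 1%nat)%C /\
  CI (fun t => (F (cis t) * cis (IZR 1 * t))%C) = (2 * PI * Cconj (b 1%nat))%C.
Proof.
  intros Ha Hb Dh Dg Fcont Ff. assert (HPI := PI_RGT_0).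
  assert (HD : forall t, inDbar (cis t)) by (intros t; unfold inDbar; rewrite Cmod_cis; lra).
  assert (Hc : ccont (fun t => F (cis t))).
  { apply (ccont_along F cis inDbar); auto. ccont. }
  assert (Hr : forall r, 0 <= r < 1 ->
    ccont (fun t => F (RtoC r * cis t)%C) /\
    CI (fun t => (F (RtoC r * cis t) * cis (IZR (-1) * t))%C) = (2 * PI * r * a 1%nat)%C /\
    CI (fun t => (F (RtoC r * cis t) * cis (IZR 1 * t))%C) = (2 * PI * r * Cconj (b 1%nat))%C).
  { intros r Hr.
    assert (ch := holo_circle_ccont h r Dh Hr). assert (cg := holo_circle_ccont g r Dg Hr).
    destruct (holo_Fourier a h r Ha Dh Hr) as [h1 h2].
    destruct (holo_Fourier b g r Hb Dg Hr) as [g1 g2].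
    assert (E : forall t, F (RtoC r * cis t)%C = (h (RtoC r * cis t) + Cconj (g (RtoC r * cis t)))%C).
    { intros t. apply Ff, inD_circle; auto. }
    assert (co : forall t, cis (IZR (-1) * t) = Cconj (cis (IZR 1 * t))).
    { intros t. rewrite <- cis_opp. f_equal. ring. }
    assert (co' : forall t, cis (IZR 1 * t) = Cconj (cis (IZR (-1) * t))).
    { intros t. rewrite <- cis_opp. f_equal. ring. }
    split; [|split].
    - apply (ccont_ext (fun t => (h (RtoC r * cis t) + Cconj (g (RtoC r * cis t)))%C)); [auto|]. ccont.
    - rewrite (CI_ext _ (fun t => (h (RtoC r * cis t) * cis (IZR (-1) * t)
        + Cconj (g (RtoC r * cis t) * cis (IZR 1 * t)))%C)).
      + rewrite CI_plus, CI_conj, h1, g2 by ccont. apply Re_Im_eq; simpl; ring.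
      + intros t. rewrite E, co, Cmult_conj. ring.
    - rewrite (CI_ext _ (fun t => (h (RtoC r * cis t) * cis (IZR 1 * t)
        + Cconj (g (RtoC r * cis t) * cis (IZR (-1) * t)))%C)).
      + rewrite CI_plus, CI_conj, h2, g1 by ccont. apply Re_Im_eq; simpl; ring.
      + intros t. rewrite E, co', Cmult_conj. ring. }
  assert (L : forall m c, (forall r, 0 <= r < 1 ->
     CI (fun t => (F (RtoC r * cis t) * cis (IZR m * t))%C) = (2 * PI * r * c)%C) ->
     CI (fun t => (F (cis t) * cis (IZR m * t))%C) = (2 * PI * c)%C).
  { intros m c Hm. apply Cmod_small_eq. intros eps He.
    assert (hc := Cmod_ge_0 c).
    assert (0 < 8 * PI * (Cmod c + 1)) by nra.
    (* The radius will be 1 - k with k <= e. Replacing F on the unit circle costs 4 PI (eps / (8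
       PI)) = eps / 2, and replacing r by 1 on the right costs 2 PI k |c|, at most eps / 4. *)
    set (e := Rmin (1 / 2) (eps / (8 * PI * (Cmod c + 1)))).
    destruct (Dbar_uniform F Fcont (eps / (8 * PI))) as [d [hd HH]]; [apply Rdiv_lt_0_compat; lra|].
    set (k := Rmin (d / 2) e).
    assert (hk : 0 < k /\ k < d /\ k < 1 /\ k <= eps / (8 * PI * (Cmod c + 1))).
    { assert (0 < eps / (8 * PI * (Cmod c + 1))) by (apply Rdiv_lt_0_compat; lra).
      unfold k, e, Rmin; repeat destruct Rle_dec; lra. }
    destruct (Hr (1 - k) ltac:(lra)) as [cr _].
    assert (E := Hm (1 - k) ltac:(lra)).
    assert (B : Cmod (CI (fun t => (F (cis t) * cis (IZR m * t))%C) - 2 * PI * RtoC (1 - k) * c) <=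
      4 * PI * (eps / (8 * PI))).
    { rewrite <- E, <- CI_minus by ccont. apply CI_bound; [ccont|]. intros t.
      replace (F (cis t) * cis (IZR m * t) - F (RtoC (1 - k) * cis t) * cis (IZR m * t))%C
        with ((F (cis t) - F (RtoC (1 - k) * cis t)) * cis (IZR m * t))%C by ring.
      rewrite Cmod_mult, Cmod_cis, Rmult_1_r. apply Rlt_le, HH; auto.
      - assert (i := inD_circle (1 - k) t ltac:(lra)). unfold inD in i; unfold inDbar; lra.
      - replace (cis t - RtoC (1 - k) * cis t)%C with (RtoC k * cis t)%C
          by (rewrite RtoC_minus; ring).
        rewrite Cmod_mult, Cmod_cis, Cmod_R, Rabs_right; lra. }
    replace (4 * PI * (eps / (8 * PI))) with (eps / 2) in B by (field; lra).
    replace (CI (fun t => (F (cis t) * cis (IZR m * t))%C) - 2 * PI * c)%C with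
      ((CI (fun t => (F (cis t) * cis (IZR m * t))%C) - 2 * PI * RtoC (1 - k) * c) -
       RtoC (2 * PI * k) * c)%C by (rewrite RtoC_minus, !RtoC_mult; ring).
    unfold Cminus at 1. eapply Rle_trans; [apply Cmod_triangle|].
    rewrite Cmod_opp, Cmod_mult, Cmod_R, Rabs_right by nra.
    assert (2 * PI * k * Cmod c <= eps / 2); [|lra].
    apply Rle_trans with (2 * PI * (eps / (8 * PI * (Cmod c + 1))) * (Cmod c + 1)).
    - apply Rmult_le_compat; try nra.
    - replace (2 * PI * (eps / (8 * PI * (Cmod c + 1))) * (Cmod c + 1)) with (eps / 4) by (field; split; lra). lra. }
  split; apply L; intros r hr; destruct (Hr r hr) as [_ [K1 K2]]; [exact K1 | exact K2].
Qed.

(** The parallelogram law, as |Ci B| = |B|. *)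
Lemma Cmod_pair_sum (A B : C) :
  Cmod (A - Ci * B) ^ 2 + Cmod (A + Ci * B) ^ 2 = 2 * (Cmod A ^ 2 + Cmod B ^ 2).
Proof. rewrite !Cmod2_alt. destruct A, B; simpl. ring. Qed.

(* [2 pi a1 = A - i B] and [2 pi conj b1 = A + i B] for the cosine and sine integrals A, B. *)
Lemma coeff_sum_CI (F : R -> C) a1 b1 : ccont F ->
  CI (fun t => (F t * cis (IZR (-1) * t))%C) = (2 * PI * a1)%C ->
  CI (fun t => (F t * cis (IZR 1 * t))%C) = (2 * PI * Cconj b1)%C ->
  Cmod a1 ^ 2 + Cmod b1 ^ 2 =
  (Cmod (CI (fun t => (RtoC (cos t) * F t)%C)) ^ 2 + Cmod (CI (fun t => (RtoC (sin t) * F t)%C)) ^ 2)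
  / (2 * PI ^ 2).
Proof.
  intros HF H1 H2. assert (HPI := PI_RGT_0).
  set (A := CI (fun t => (RtoC (cos t) * F t)%C)). set (B := CI (fun t => (RtoC (sin t) * F t)%C)).
  assert (E1 : (2 * PI * a1 = A - Ci * B)%C).
  { rewrite <- H1. unfold A, B. rewrite <- CI_scal, <- CI_minus by ccont. apply CI_ext. intros t.
    replace (IZR (-1) * t) with (- t) by ring. unfold cis. rewrite cos_neg, sin_neg.
    apply Re_Im_eq; simpl; ring. }
  assert (E2 : (2 * PI * Cconj b1 = A + Ci * B)%C).
  { rewrite <- H2. unfold A, B. rewrite <- CI_scal, <- CI_plus by ccont. apply CI_ext. intros t.
    rewrite Rmult_1_l. unfold cis. apply Re_Im_eq; simpl; ring. }
  assert (E := Cmod_pair_sum A B). rewrite <- E1, <- E2, !Cmod_mult, Cmod_conj, !Cmod_R in E.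
  rewrite (Rabs_right 2), (Rabs_right PI) in E by lra.
  field_simplify; [|lra]. field_simplify_eq; [|lra]. nra.
Qed.

Lemma half_period_double f : contR f -> (forall t, f (t + PI) = f t) ->
  RInt f 0 (2 * PI) = 2 * RInt f 0 PI.
Proof.
  intros Hf Hp. rewrite <- (RInt_ChaslesR f 0 PI (2 * PI)) by auto.
  replace (2 * PI) with (PI + PI) by ring. rewrite (RInt_periodR f PI PI) by auto. Req; ring.
Qed.

(** Full-period moments are twice the half-period ones, so the bound 4 on the sum of squares becomes
    16, and 16 / (2 PI^2) = 8 / PI^2. *)
Lemma admissible_ge a b : admissible a b ->
  Cmod (a 1%nat) ^ 2 + Cmod (b 1%nat) ^ 2 >= 8 / PI ^ 2.
Proof.
  intros [h [g [Ha [Hb [_ [Hbij [HJ [F [HF [HFf Hodd]]]]]]]]]].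
  assert (HPI := PI_RGT_0).
  assert (Dh : differentiable_on_D h) by (intros z Hz; destruct (HJ z Hz) as [l [_ [H _]]]; eauto).
  assert (Dg : differentiable_on_D g) by (intros z Hz; destruct (HJ z Hz) as [_ [l [_ [H _]]]]; eauto).
  assert (Fcont := proj1 (proj2 HF)).
  assert (HO := boundary_odd_curve _ F Hbij HF HFf Hodd).
  destruct (boundary_Fourier a b h g F Ha Hb Dh Dg Fcont HFf) as [E1 E2].
  destruct HO as [cU cV H1 HU HV Hi] eqn:EO. clear EO.
  assert (Hge := odd_curve_Fourier_ge _ _ HO).
  assert (cF : ccont (fun t => F (cis t))) by (split; auto).
  rewrite (coeff_sum_CI (fun t => F (cis t)) _ _ cF E1 E2).
  rewrite !Cmod2_alt. unfold CI; simpl Re; simpl Im.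
  assert (X : forall f q, contR f -> contR q -> (forall t, f (t + PI) = - f t) -> (forall t, q (t + PI) = - q t) ->
    RInt (fun t => q t * f t) 0 (2 * PI) = 2 * RInt (fun t => q t * f t) 0 PI).
  { intros f q cf cq Hf Hq. apply half_period_double; [contR|]. intros t. rewrite Hf, Hq. ring. }
  rewrite (RInt_extR (fun t => cos t * fst (F (cis t)) - 0 * snd (F (cis t))) (fun t => cos t * Re (F (cis t))))
    by (intros; unfold Re; ring).
  rewrite (RInt_extR (fun t => cos t * snd (F (cis t)) + 0 * fst (F (cis t))) (fun t => cos t * Im (F (cis t))))
    by (intros; unfold Im; ring).
  rewrite (RInt_extR (fun t => sin t * fst (F (cis t)) - 0 * snd (F (cis t))) (fun t => sin t * Re (F (cis t))))
    by (intros; unfold Re; ring).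
  rewrite (RInt_extR (fun t => sin t * snd (F (cis t)) + 0 * fst (F (cis t))) (fun t => sin t * Im (F (cis t))))
    by (intros; unfold Im; ring).
  rewrite (X _ cos cU contR_cos HU neg_cos), (X _ sin cU contR_sin HU neg_sin),
    (X _ cos cV contR_cos HV neg_cos), (X _ sin cV contR_sin HV neg_sin).
  apply Rle_ge. unfold Rdiv. apply Rmult_le_reg_r with (2 * PI ^ 2); [nra|].
  rewrite Rmult_assoc, (Rmult_assoc _ (/ (2 * PI ^ 2))). rewrite (Rinv_l (2 * PI ^ 2)) by nra.
  replace (8 * (/ PI ^ 2 * (2 * PI ^ 2))) with 16 by (field; lra). nra.
Qed.

(** * Lifts of odd circle homeomorphisms *)

Record odd_lift (phi : R -> R) : Prop := {
  ol_cont : contR phi;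
  ol_incr : forall s t, s < t -> phi s < phi t;
  ol_half : forall t, phi (t + PI) = phi t + PI }.

Lemma odd_lift_period phi t : odd_lift phi -> phi (t + 2 * PI) = phi t + 2 * PI.
Proof.
  intros H. replace (t + 2 * PI) with (t + PI + PI) by ring. rewrite !(ol_half phi H). ring.
Qed.

(* [sin ((t - s) / 2)] vanishes exactly when s and t define the same point of the circle, so this
   says that phi preserves the cyclic order. *)
Lemma odd_lift_cyclic phi s t : odd_lift phi -> sin ((t - s) / 2) <> 0 ->
  0 < sin ((t - s) / 2) * sin ((phi t - phi s) / 2).
Proof.
  intros H. assert (HPI := PI_RGT_0).
  (* Induction on the number of full turns from s to t: removing one turn changes the sign of both
     sines and leaves their product alone. *)
  assert (W : forall n s t, s <= t < s + 2 * PI * (INR n + 1) -> sin ((t - s) / 2) <> 0 ->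
     0 < sin ((t - s) / 2) * sin ((phi t - phi s) / 2)).
  { clear s t. induction n as [|n IH]; intros s t Hst Hn.
    - simpl in Hst. rewrite Rplus_0_l, Rmult_1_r in Hst.
      assert (s <> t).
      { intros ->. apply Hn. replace ((t - t) / 2) with 0 by field. apply sin_0. }
      assert (h1 := ol_incr phi H s t ltac:(lra)).
      assert (h2 := ol_incr phi H t (s + 2 * PI) ltac:(lra)).
      rewrite odd_lift_period in h2 by auto.
      apply Rmult_lt_0_compat; apply sin_gt_0; lra.
    - destruct (Rlt_dec t (s + 2 * PI * (INR n + 1))) as [h|h]; [apply IH; auto; lra|].
      assert (h0 := pos_INR n).
      assert (ep : phi t = phi (t - 2 * PI) + 2 * PI).
      { rewrite <- odd_lift_period by auto. f_equal. ring. }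
      assert (e1 : sin ((t - s) / 2) = - sin ((t - 2 * PI - s) / 2)).
      { rewrite <- neg_sin. f_equal. field. }
      assert (e2 : sin ((phi t - phi s) / 2) = - sin ((phi (t - 2 * PI) - phi s) / 2)).
      { rewrite <- neg_sin, ep. f_equal. field. }
      rewrite e1, e2. rewrite e1 in Hn. rewrite Rmult_opp_opp.
      apply IH; [|intros z; apply Hn; rewrite z; ring].
      rewrite S_INR in Hst. split; [|lra].
      assert (0 <= 2 * PI * INR n) by nra. lra. }
  assert (W' : forall s t, s <= t -> sin ((t - s) / 2) <> 0 ->
     0 < sin ((t - s) / 2) * sin ((phi t - phi s) / 2)).
  { intros s' t' Hst Hn.
    assert (h0 : 0 <= (t' - s') / (2 * PI)) by (apply Rle_mult_inv_pos; lra).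
    destruct (nfloor_ex _ h0) as [n [_ Hn2]].
    apply (W n); auto. split; auto.
    apply Rmult_lt_compat_l with (r := 2 * PI) in Hn2; [|lra].
    replace (2 * PI * ((t' - s') / (2 * PI))) with (t' - s') in Hn2 by (field; lra). lra. }
  intros Hn. destruct (Rle_dec s t) as [h|h]; [apply W'; auto|].
  replace ((t - s) / 2) with (- ((s - t) / 2)) in * by field.
  replace ((phi t - phi s) / 2) with (- ((phi s - phi t) / 2)) by field.
  rewrite sin_neg in *. rewrite sin_neg, Rmult_opp_opp. apply W'; lra.
Qed.

Lemma cos_minus_cos a b : cos a - cos b = - 2 * (sin ((a + b) / 2) * sin ((a - b) / 2)).
Proof. rewrite form2. ring. Qed.

(* A weight [tau * w] of total mass 0, where tau changes sign at the ends t1, t2 of an arc, cannot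
   annihilate [cis o phi]: the chord through the images of t1 and t2 separates the two arcs, so the
   affine function vanishing on that chord has the sign of tau. *)
Lemma chord_separation phi w p q c : odd_lift phi -> contR w -> (forall t, 0 < w t) ->
  (p <> 0 \/ q <> 0 \/ c <> 0) ->
  RInt (fun t => (p * cos t + q * sin t + c) * w t) 0 (2 * PI) = 0 ->
  RInt (fun t => cos (phi t) * ((p * cos t + q * sin t + c) * w t)) 0 (2 * PI) = 0 ->
  RInt (fun t => sin (phi t) * ((p * cos t + q * sin t + c) * w t)) 0 (2 * PI) = 0 -> False.
Proof.
  intros H Hw Hpos Hpqc I0 I1 I2. assert (HPI := PI_RGT_0).
  assert (cphi := ol_cont phi H).
  set (tau := fun t => p * cos t + q * sin t + c) in *.
  assert (ctau : contR tau) by (unfold tau; contR).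
  change (RInt (fun t => tau t * w t) 0 (2 * PI) = 0) in I0.
  change (RInt (fun t => cos (phi t) * (tau t * w t)) 0 (2 * PI) = 0) in I1.
  change (RInt (fun t => sin (phi t) * (tau t * w t)) 0 (2 * PI) = 0) in I2.
  assert (Hx : exists x, 0 < x < 2 * PI /\ tau x <> 0).
  { apply NNPP. intros N.
    assert (E : forall x, 0 < x < 2 * PI -> tau x = 0).
    { intros x hx. apply NNPP. intros h. apply N. eauto. }
    assert (e1 := E (PI / 2) ltac:(lra)). assert (e2 := E PI ltac:(lra)).
    assert (e3 := E (3 * (PI / 2)) ltac:(lra)). unfold tau in e1, e2, e3.
    rewrite cos_PI2, sin_PI2 in e1. rewrite cos_PI, sin_PI in e2. rewrite cos_3PI2, sin_3PI2 in e3.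
    lra. }
  destruct Hx as [x [Hx Hxn]].
  set (r := Cmod (p, q)).
  assert (Er : r * r = p * p + q * q) by (unfold r; rewrite Cmod_sqr; reflexivity).
  assert (Hr0 : 0 <= r) by apply Cmod_ge_0.
  assert (CS : forall t, - r <= p * cos t + q * sin t <= r).
  { intros t. apply Rabs_le_between. rewrite <- (Rabs_right r) by lra. apply Rsqr_le_abs_0.
    unfold Rsqr. rewrite Er. assert (k := sin2_cos2 t). unfold Rsqr in k.
    replace (p * p + q * q) with ((p * p + q * q) * (sin t * sin t + cos t * cos t)) by (rewrite k; ring).
    assert (0 <= (p * sin t - q * cos t) * (p * sin t - q * cos t)) by apply Rle_0_sqr. nra. }
  (* Otherwise tau would have a strict constant sign, and [tau * w] could not have total mass 0. *)
  assert (Hc : - r <= c <= r).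
  { split; apply Rnot_lt_le; intros hc.
    - assert (0 < RInt (fun t => - (tau t * w t)) 0 (2 * PI)).
      { apply (RInt_posR _ _ _ x); [lra | contR | | auto |].
        - intros t _. assert (k := CS t). assert (k' := Hpos t). unfold tau. nra.
        - assert (k := CS x). assert (k' := Hpos x). unfold tau. nra. }
      rewrite (RInt_oppR (fun t => tau t * w t)) in H0 by contR. lra.
    - assert (0 < RInt (fun t => tau t * w t) 0 (2 * PI)); [|lra].
      apply (RInt_posR _ _ _ x); [lra | contR | | auto |].
      + intros t _. assert (k := CS t). assert (k' := Hpos t). unfold tau. nra.
      + assert (k := CS x). assert (k' := Hpos x). unfold tau. nra. }
  assert (Hr : 0 < r).
  { destruct Hr0 as [h|h]; auto. exfalso. rewrite <- h in *.
    assert (p = 0) by nra. assert (q = 0) by nra. assert (c = 0) by lra. tauto. }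
  destruct (polar (p, q) Hr) as [th [Ep Eq]]. simpl in Ep, Eq. fold r in Ep, Eq.
  set (d := acos (- c / r)).
  assert (Hd : cos d = - c / r).
  { apply cos_acos. split.
    - apply Rmult_le_reg_r with r; [lra|]. unfold Rdiv. rewrite Rmult_assoc, Rinv_l; lra.
    - apply Rmult_le_reg_r with r; [lra|]. unfold Rdiv. rewrite Rmult_assoc, Rinv_l; lra. }
  set (t1 := th - d). set (t2 := th + d).
  (* The zeros of tau are now explicit. If |c| = r they define the same point of the circle, and the
     chord below becomes a tangent. *)
  assert (Etau : forall t, tau t = - 2 * r * (sin ((t - t1) / 2) * sin ((t - t2) / 2))).
  { intros t. transitivity (r * (cos (t - th) - cos d)).
    - rewrite Hd, cos_minus. unfold tau. rewrite Ep, Eq. field. lra.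
    - rewrite cos_minus_cos. unfold t1, t2.
      replace (t - (th - d)) with (t - th + d) by ring.
      replace (t - (th + d)) with (t - th - d) by ring. ring. }
  (* Mid-angle and half-width of the image arc: l is the affine function X cos m + Y sin m - cos dd,
     zero on the chord, evaluated at the image point. *)
  set (m := (phi t1 + phi t2) / 2). set (dd := (phi t2 - phi t1) / 2).
  set (l := fun t => cos m * cos (phi t) + sin m * sin (phi t) - cos dd).
  assert (El : forall t, l t = - 2 * (sin ((phi t - phi t1) / 2) * sin ((phi t - phi t2) / 2))).
  { intros t. transitivity (cos (phi t - m) - cos dd).
    - unfold l. rewrite cos_minus. ring.
    - rewrite cos_minus_cos. unfold m, dd. do 3 f_equal; field. }
  assert (Hprod : forall t, tau t <> 0 -> 0 < l t * tau t).
  { intros t Ht. rewrite Etau in Ht.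
    assert (n1 : sin ((t - t1) / 2) <> 0) by (intros z; apply Ht; rewrite z; ring).
    assert (n2 : sin ((t - t2) / 2) <> 0) by (intros z; apply Ht; rewrite z; ring).
    assert (k1 := odd_lift_cyclic phi t1 t H n1). assert (k2 := odd_lift_cyclic phi t2 t H n2).
    rewrite El, Etau.
    replace (_ * _) with (4 * r * ((sin ((t - t1) / 2) * sin ((phi t - phi t1) / 2)) *
      (sin ((t - t2) / 2) * sin ((phi t - phi t2) / 2)))) by ring.
    apply Rmult_lt_0_compat; [lra|]. apply Rmult_lt_0_compat; auto. }
  assert (P : 0 < RInt (fun t => l t * tau t * w t) 0 (2 * PI)).
  { apply (RInt_posR _ _ _ x); [lra | unfold l; contR | | auto |].
    - intros t _. apply Rmult_le_pos; [|apply Rlt_le, Hpos].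
      destruct (Req_dec (tau t) 0) as [z|z]; [rewrite z; lra | apply Rlt_le, Hprod; auto].
    - apply Rmult_lt_0_compat; auto. }
  rewrite (RInt_extR _ (fun t => cos m * (cos (phi t) * (tau t * w t)) +
     sin m * (sin (phi t) * (tau t * w t)) - cos dd * (tau t * w t))) in P
    by (intros; unfold l; ring).
  rewrite RInt_minusR, RInt_plusR, !RInt_scalR in P by contR.
  rewrite I0, I1, I2 in P. lra.
Qed.

(** * Cauchy transforms *)

Definition ker (z : C) (t : R) : C := (/ (1 - z * cis (- t)))%C.
(** The Cauchy integral of G written in the angle: it is the power series whose coefficients are the
    Fourier coefficients of G of nonnegative index. *)
Definition CT (G : R -> C) (z : C) : C := (RtoC (/ (2 * PI)) * CI (fun t => G t * ker z t))%C.
Definition CTd (G : R -> C) (z : C) : C :=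
  (RtoC (/ (2 * PI)) * CI (fun t => G t * (cis (- t) * (ker z t * ker z t))))%C.
Definition CTcoef (G : R -> C) (n : nat) : C :=
  (RtoC (/ (2 * PI)) * CI (fun t => G t * cis (- t) ^ n))%C.

Lemma ker_den_ge z t : 1 - Cmod z <= Cmod (1 - z * cis (- t)).
Proof.
  assert (h := Cmod_triangle (1 - z * cis (- t)) (z * cis (- t))).
  replace (1 - z * cis (- t) + z * cis (- t))%C with (RtoC 1) in h by ring.
  rewrite Cmod_1, Cmod_mult, Cmod_cis in h. lra.
Qed.

Lemma ker_den_neq z t : inD z -> (1 - z * cis (- t))%C <> 0%C.
Proof.
  intros Hz E. assert (h := ker_den_ge z t). rewrite E, Cmod_0 in h. unfold inD in Hz. lra.
Qed.

Lemma ker_ccont z : inD z -> ccont (ker z).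
Proof.
  intros Hz. apply (ccont_inv (fun t => (1 - z * cis (- t))%C)).
  - ccont.
  - intros t. apply ker_den_neq; auto.
Qed.

Lemma ker_le z t r : Cmod z <= r -> r < 1 -> Cmod (ker z t) <= / (1 - r).
Proof.
  intros Hz Hr. unfold ker. rewrite Cmod_inv by (apply ker_den_neq; unfold inD; lra).
  apply Rinv_le_contravar; [lra|]. assert (h := ker_den_ge z t). lra.
Qed.

Lemma ker_geom_tail z t n : inD z ->
  (psum (fun k => cis (- t) ^ k) z n - ker z t = - ((z * cis (- t)) ^ S n * ker z t))%C.
Proof.
  intros Hz. assert (h := ker_den_neq z t Hz). unfold ker.
  induction n as [|n IH].
  - simpl. field. exact h.
  - simpl psum.
    replace (psum (fun k : nat => (cis (- t) ^ k)%C) z n + z * z ^ n * (cis (- t) * cis (- t) ^ n) -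
      / (1 - z * cis (- t)))%C with ((psum (fun k : nat => (cis (- t) ^ k)%C) z n - / (1 - z * cis (- t)))
      + z * z ^ n * (cis (- t) * cis (- t) ^ n))%C by ring.
    rewrite IH. rewrite !Cpow_mult_l. simpl. field. exact h.
Qed.

Section CauchyTransform.
Variable G : R -> C.
Hypothesis cG : ccont G.
Hypothesis bG : forall t, Cmod (G t) <= 1.

Lemma CT_psum z n :
  psum (CTcoef G) z n = (RtoC (/ (2 * PI)) * CI (fun t => G t * psum (fun k => cis (- t) ^ k) z n))%C /\
  ccont (fun t => psum (fun k => (cis (- t) ^ k)%C) z n).
Proof.
  assert (hc := cG).
  induction n as [|n [IH c]].
  - split; [reflexivity | simpl; ccont].
  - assert (c' : ccont (fun t => (psum (fun k => cis (- t) ^ k) z n + z ^ S n * cis (- t) ^ S n)%C)).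
    { apply (ccont_plus (fun t => psum (fun k => (cis (- t) ^ k)%C) z n)); auto. ccont. }
    split; [|exact c'].
    simpl psum. rewrite IH. unfold CTcoef.
    transitivity (RtoC (/ (2 * PI)) * (CI (fun t => G t * psum (fun k => cis (- t) ^ k) z n)
      + z ^ S n * CI (fun t => G t * cis (- t) ^ S n)))%C; [simpl; ring|].
    f_equal. rewrite <- CI_scal by ccont. rewrite <- CI_plus by ccont.
    apply CI_ext. intros t. simpl. ring.
Qed.

Lemma CI_G_bound f M : ccont f -> (forall t, Cmod (f t) <= M) ->
  Cmod (RtoC (/ (2 * PI)) * CI (fun t => G t * f t))%C <= 2 * M.
Proof.
  intros cf H. assert (HPI := PI_RGT_0). assert (hc := cG).
  rewrite Cmod_mult, Cmod_R, Rabs_right by (left; apply Rinv_0_lt_compat; lra).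
  apply Rle_trans with (/ (2 * PI) * (4 * PI * M)).
  - apply Rmult_le_compat_l; [left; apply Rinv_0_lt_compat; lra|].
    apply CI_bound; [ccont|]. intros t. rewrite Cmod_mult.
    rewrite <- (Rmult_1_l M). apply Rmult_le_compat; auto; apply Cmod_ge_0.
  - right. field. lra.
Qed.

Lemma CT_pseries : power_series_on_D (CTcoef G) (CT G).
Proof.
  intros z Hz. apply pseries_eps. intros eps He. assert (hc := cG).
  assert (hk := ker_ccont z Hz). unfold inD in Hz. assert (hz := Cmod_ge_0 z).
  destruct (geom_small (2 * / (1 - Cmod z)) (Cmod z) eps ltac:(lra) He) as [N HN].
  exists N. intros n Hn. destruct (CT_psum z n) as [E c]. rewrite E. unfold CT.
  replace (RtoC (/ (2 * PI)) * CI (fun t => G t * psum (fun k => cis (- t) ^ k) z n) -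
     RtoC (/ (2 * PI)) * CI (fun t => G t * ker z t))%C with
    (RtoC (/ (2 * PI)) * (CI (fun t => G t * psum (fun k => cis (- t) ^ k) z n) -
     CI (fun t => G t * ker z t)))%C by ring.
  rewrite <- CI_minus by ccont.
  rewrite (CI_ext _ (fun t => (G t * (psum (fun k => cis (- t) ^ k) z n - ker z t))%C)) by (intros; ring).
  eapply Rle_lt_trans; [apply (CI_G_bound _ (/ (1 - Cmod z) * Cmod z ^ n))|].
  - ccont.
  - intros t. rewrite ker_geom_tail by auto. rewrite Cmod_opp, Cmod_mult, Cmod_pow, Cmod_mult, Cmod_cis, Rmult_1_r.
    assert (h := ker_le z t (Cmod z) (Rle_refl _) Hz). assert (h' := Cmod_ge_0 (ker z t)).
    assert (h2 : 0 <= Cmod z ^ n) by (apply pow_le; auto).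
    simpl. rewrite Rmult_comm. apply Rmult_le_compat; auto; nra.
  - rewrite <- Rmult_assoc. apply HN; auto.
Qed.

Lemma CT_derive z : inD z -> cderiv (CT G) z (CTd G z).
Proof.
  intros Hz. apply cderiv_eps. intros eps He. assert (hc := cG).
  unfold inD in Hz. assert (hz := Cmod_ge_0 z).
  set (r := (1 + Cmod z) / 2). assert (Hr : Cmod z < r < 1) by (unfold r; lra).
  set (M := / (1 - r) * / (1 - r) * / (1 - r)).
  assert (HM : 0 < M) by (unfold M; repeat apply Rmult_lt_0_compat; apply Rinv_0_lt_compat; lra).
  exists (Rmin (r - Cmod z) (eps / (2 * M))). split.
  { apply Rmin_pos; [lra | apply Rdiv_lt_0_compat; lra]. }
  intros w Hw.
  assert (hw1 := Rmin_l (r - Cmod z) (eps / (2 * M))).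
  assert (hw2 := Rmin_r (r - Cmod z) (eps / (2 * M))).
  assert (Hwr : Cmod w <= r).
  { replace w with ((w - z) + z)%C by ring. eapply Rle_trans; [apply Cmod_triangle|]. lra. }
  assert (kz := ker_ccont z Hz). assert (kw := ker_ccont w ltac:(unfold inD; lra)).
  unfold CT, CTd.
  replace (RtoC (/ (2 * PI)) * CI (fun t => G t * ker w t) - RtoC (/ (2 * PI)) * CI (fun t => G t * ker z t)
    - (w - z) * (RtoC (/ (2 * PI)) * CI (fun t => G t * (cis (- t) * (ker z t * ker z t)))))%C with
    (RtoC (/ (2 * PI)) * (CI (fun t => G t * ker w t) - CI (fun t => G t * ker z t)
    - (w - z) * CI (fun t => G t * (cis (- t) * (ker z t * ker z t)))))%C by ring.
  rewrite <- CI_scal by ccont. rewrite <- !CI_minus by ccont.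
  (* The first-order Taylor remainder of the kernel in closed form; the factor (w - z)^2 makes it
     small. *)
  rewrite (CI_ext _ (fun t => (G t * ((w - z) * (w - z) * (cis (- t) * cis (- t)
     * (ker w t * ker z t * ker z t))))%C)).
  - apply Rle_trans with (2 * (Cmod (w - z) * Cmod (w - z) * M)).
    + apply CI_G_bound; [ccont|]. intros t. rewrite !Cmod_mult, !Cmod_cis.
      assert (h1 := ker_le w t r Hwr ltac:(lra)). assert (h2 := ker_le z t r ltac:(lra) ltac:(lra)).
      assert (k1 := Cmod_ge_0 (ker w t)). assert (k2 := Cmod_ge_0 (ker z t)).
      rewrite !Rmult_1_l.
      assert (p := Cmod_ge_0 (w - z)).
      apply Rmult_le_compat_l; [nra|]. unfold M.
      apply Rmult_le_compat; auto; [nra|]. apply Rmult_le_compat; auto.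
    + assert (p := Cmod_ge_0 (w - z)).
      assert (k : Cmod (w - z) * (2 * M) <= eps).
      { apply Rle_trans with (eps / (2 * M) * (2 * M)); [apply Rmult_le_compat_r; lra|].
        right; field; lra. }
      nra.
  - intros t. unfold ker.
    assert (h1 := ker_den_neq z t Hz). assert (h2 := ker_den_neq w t ltac:(unfold inD; lra)).
    field. split; auto.
Qed.

(** Used for the continuity of the Jacobian along radii. *)
Lemma CTd_Lipschitz z w r : Cmod z <= r -> Cmod w <= r -> r < 1 ->
  Cmod (CTd G w - CTd G z) <= 4 * (/ (1 - r)) ^ 3 * Cmod (w - z).
Proof.
  intros Hz Hw Hr. assert (hc := cG).
  assert (Dz : inD z) by (unfold inD; lra). assert (Dw : inD w) by (unfold inD; lra).
  assert (kz := ker_ccont z Dz). assert (kw := ker_ccont w Dw).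
  unfold CTd.
  replace (RtoC (/ (2 * PI)) * CI (fun t => G t * (cis (- t) * (ker w t * ker w t)))
    - RtoC (/ (2 * PI)) * CI (fun t => G t * (cis (- t) * (ker z t * ker z t))))%C with
    (RtoC (/ (2 * PI)) * (CI (fun t => G t * (cis (- t) * (ker w t * ker w t)))
    - CI (fun t => G t * (cis (- t) * (ker z t * ker z t)))))%C by ring.
  rewrite <- !CI_minus by ccont.
  rewrite (CI_ext _ (fun t => (G t * (cis (- t) * cis (- t) * ((w - z) * (ker w t * ker z t) * (ker w t + ker z t))))%C)).
  - replace (4 * (/ (1 - r)) ^ 3 * Cmod (w - z)) with
     (2 * (Cmod (w - z) * (/ (1 - r) * / (1 - r)) * (/ (1 - r) + / (1 - r)))) by ring.
    apply CI_G_bound; [ccont|]. intros t. rewrite !Cmod_mult, !Cmod_cis, !Rmult_1_l.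
    assert (h1 := ker_le w t r Hw Hr). assert (h2 := ker_le z t r Hz Hr).
    assert (k1 := Cmod_ge_0 (ker w t)). assert (k2 := Cmod_ge_0 (ker z t)).
    assert (p := Cmod_ge_0 (w - z)).
    apply Rmult_le_compat; [apply Rmult_le_pos; nra | apply Cmod_ge_0 | |].
    + apply Rmult_le_compat_l; auto. apply Rmult_le_compat; auto.
    + eapply Rle_trans; [apply Cmod_triangle|]. lra.
  - intros t. unfold ker.
    assert (h1 := ker_den_neq z t Dz). assert (h2 := ker_den_neq w t Dw).
    field. split; auto.
Qed.

End CauchyTransform.

Lemma pseries_unique_eventually a z l m : is_pseries (K := C_AbsRing) (V := C_NormedModule) a z l ->
  (forall n, psum a z (S n) = m) -> l = m.
Proof.
  intros Hl Hm. rewrite pseries_eps in Hl. apply Cmod_small_eq. intros eps He.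
  destruct (Hl eps He) as [N HN]. assert (h := HN (S N) ltac:(lia)). rewrite Hm in h.
  rewrite Cmod_sub_sym. lra.
Qed.

Lemma psum_unit (k : nat) (z : C) n (a : nat -> C) : (k <= 1)%nat -> (forall j, j <> k -> a j = 0%C) -> a k = 1%C ->
  psum a z (S n) = (z ^ k)%C.
Proof.
  intros Hk H0 H1. induction n as [|n IH].
  - destruct k as [|[|k]]; [| |lia]; simpl.
    + rewrite H1, H0 by lia. ring.
    + rewrite H1, H0 by lia. ring.
  - change (psum a z (S (S n))) with (psum a z (S n) + z ^ S (S n) * a (S (S n)))%C.
    rewrite IH, H0 by lia. ring.
Qed.

Lemma CTcoef_cis (m n : Z) : CTcoef (fun t => cis (IZR m * t)) (Z.to_nat n) =
  if Z.eqb m (Z.of_nat (Z.to_nat n)) then 1%C else 0%C.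
Proof.
  assert (HPI := PI_RGT_0). unfold CTcoef.
  rewrite (CI_ext _ (fun t => cis (IZR (m - Z.of_nat (Z.to_nat n)) * t))).
  - destruct (Z.eqb_spec m (Z.of_nat (Z.to_nat n))) as [e|e].
    + rewrite (CI_ext _ (fun t => 1%C)).
      * rewrite CI_const. rewrite RtoC_inv by lra. rewrite RtoC_mult. field.
        intros e0; apply RtoC_inj in e0; lra.
      * intros t. rewrite <- e, Z.sub_diag, Rmult_0_l, cis_0. reflexivity.
    + rewrite CI_cis by lia. ring.
  - intros t. rewrite cis_INR, <- cis_plus, minus_IZR, INR_IZR_INZ. f_equal. ring.
Qed.

(** For m = -1, 0, 1 this yields the mass and the first moments of the Poisson kernel. With m <= 1,
    every partial sum of degree at least 1 already equals the limit. *)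
Lemma CT_cis (m : Z) z : inD z -> (m <= 1)%Z ->
  CT (fun t => cis (IZR m * t)) z = if Z.leb 0 m then (z ^ Z.to_nat m)%C else 0%C.
Proof.
  intros Hz Hm.
  assert (P := CT_pseries (fun t => cis (IZR m * t)) ltac:(ccont)
    (fun t => Req_le _ _ (Cmod_cis (IZR m * t))) z Hz).
  apply (pseries_unique_eventually _ _ _ _ P). intros n.
  assert (E : forall j, CTcoef (fun t => cis (IZR m * t)) j = if Z.eqb m (Z.of_nat j) then 1%C else 0%C).
  { intros j. rewrite <- (Nat2Z.id j) at 1. rewrite CTcoef_cis, Nat2Z.id. reflexivity. }
  destruct (Z.leb_spec 0 m) as [h|h].
  - apply psum_unit; [lia | |].
    + intros j Hj. rewrite E. destruct (Z.eqb_spec m (Z.of_nat j)); [lia | reflexivity].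
    + rewrite E, Z2Nat.id, Z.eqb_refl by lia. reflexivity.
  - assert (Z0 : forall j, CTcoef (fun t => cis (IZR m * t)) j = 0%C).
    { intros j. rewrite E. destruct (Z.eqb_spec m (Z.of_nat j)); [lia | reflexivity]. }
    induction n as [|n IH].
    + simpl. rewrite !Z0. ring.
    + change (psum (CTcoef (fun t => cis (IZR m * t))) z (S (S n))) with
       (psum (CTcoef (fun t => cis (IZR m * t))) z (S n) +
        z ^ S (S n) * CTcoef (fun t => cis (IZR m * t)) (S (S n)))%C.
      rewrite IH, Z0. ring.
Qed.

(** * Poisson extension *)

(** Both summands contain the mean of G, so this is the Poisson integral plus that mean. For the odd
    boundary values used below the mean is 0. *)
Definition HE (G : R -> C) (z : C) : C := (CT G z + Cconj (CT (fun t => Cconj (G t)) z))%C.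

(** |cis t - z|^2 in expanded form. Its degree 1 in cos t and sin t is what makes differences of
    Poisson kernels accessible to [chord_separation]. *)
Definition pden (z : C) (t : R) : R := 1 + Cmod z ^ 2 - 2 * (Re z * cos t + Im z * sin t).
Definition poisson (z : C) (t : R) : R := (1 - Cmod z ^ 2) * / pden z t.

Lemma pden_Cmod z t : pden z t = Cmod (1 - z * cis (- t)) ^ 2.
Proof.
  rewrite Cmod2_alt. unfold pden, cis. rewrite cos_neg, sin_neg, Cmod2_alt. destruct z as [x y]; simpl.
  assert (h := sin2_cos2 t). unfold Rsqr in h.
  replace (x * (x * 1) + y * (y * 1)) with ((x * x + y * y) * (sin t * sin t + cos t * cos t))
    by (rewrite h; ring). ring.
Qed.

Lemma pden_pos z t : inD z -> 0 < pden z t.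
Proof. intros Hz. rewrite pden_Cmod. apply pow_lt, Cmod_gt_0, ker_den_neq; auto. Qed.

Lemma pden_contR z : contR (pden z).
Proof. unfold pden. contR. Qed.

Lemma poisson_contR z : inD z -> contR (poisson z).
Proof.
  intros Hz. apply (contR_mult (fun _ => 1 - Cmod z ^ 2)); [contR|].
  apply contR_inv; [apply pden_contR|]. intros t. assert (h := pden_pos z t Hz). lra.
Qed.

Lemma inD_sqr z : inD z -> 0 <= Cmod z ^ 2 < 1.
Proof. unfold inD. intros H. assert (h := Cmod_ge_0 z). nra. Qed.

Lemma poisson_pos z t : inD z -> 0 < poisson z t.
Proof.
  intros Hz. apply Rmult_lt_0_compat; [|apply Rinv_0_lt_compat, pden_pos; auto].
  assert (h := inD_sqr z Hz). lra.
Qed.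

Lemma ker_pden z t : inD z -> ker z t = (Cconj (1 - z * cis (- t)) * RtoC (/ pden z t))%C.
Proof. intros Hz. unfold ker. rewrite Cinv_Cconj_Cmod by (apply ker_den_neq; auto). rewrite pden_Cmod. reflexivity. Qed.

Lemma poisson_ker z t : inD z -> 2 * Re (ker z t) = poisson z t + 1.
Proof.
  intros Hz. rewrite ker_pden by auto. unfold poisson. assert (h := pden_pos z t Hz).
  assert (E : Re (Cconj (1 - z * cis (- t)) * RtoC (/ pden z t))%C =
    (1 - (Re z * cos t + Im z * sin t)) * / pden z t).
  { unfold cis. rewrite cos_neg, sin_neg. set (i := / pden z t). simpl. unfold Re, Im. ring. }
  rewrite E. field_simplify_eq; [|lra]. unfold pden. ring.
Qed.

Lemma HE_poisson G z : ccont G -> inD z ->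
  HE G z = (RtoC (/ (2 * PI)) * (CI (fun t => G t * RtoC (poisson z t)) + CI G))%C.
Proof.
  intros cG Hz. assert (hk := ker_ccont z Hz). assert (hp := poisson_contR z Hz).
  unfold HE, CT. rewrite Cmult_conj.
  rewrite Cconj_RtoC, <- CI_conj, <- Cmult_plus_distr_l, <- !CI_plus by ccont. f_equal. apply CI_ext. intros t.
  rewrite Cmult_conj, Cconj_conj.
  transitivity (G t * (ker z t + Cconj (ker z t)))%C; [ring|].
  replace (ker z t + Cconj (ker z t))%C with (RtoC (poisson z t + 1)).
  - rewrite RtoC_plus. ring.
  - rewrite <- poisson_ker by auto. apply Re_Im_eq; simpl; unfold Re, Im; ring.
Qed.

Lemma Cconj_cis_int m t : Cconj (cis (IZR m * t)) = cis (IZR (- m) * t).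
Proof. rewrite <- cis_opp, opp_IZR. f_equal. ring. Qed.

Lemma CT_ext G G' z : (forall t, G t = G' t) -> CT G z = CT G' z.
Proof. intros E. unfold CT. f_equal. apply CI_ext. intros t. rewrite E. reflexivity. Qed.

Lemma RtoC_inv_mult (x : R) (A B : C) : x <> 0 -> A = (RtoC (/ x) * B)%C -> B = (RtoC x * A)%C.
Proof.
  intros Hx ->. rewrite Cmult_assoc, <- RtoC_mult, Rinv_r by auto. symmetry. apply Cmult_1_l.
Qed.

Lemma poisson_mass z : inD z -> RInt (poisson z) 0 (2 * PI) = 2 * PI.
Proof.
  intros Hz. assert (HPI := PI_RGT_0). assert (hp := poisson_contR z Hz).
  (* The value is 2 because [HE] counts the mean twice. *)
  assert (E : HE (fun t => cis (IZR 0 * t)) z = 2%C).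
  { unfold HE. rewrite (CT_ext _ _ z (Cconj_cis_int 0)), !CT_cis by (auto; lia).
    simpl. apply Re_Im_eq; simpl; ring. }
  rewrite HE_poisson in E by (solve [exact Hz | ccont]). symmetry in E. apply RtoC_inv_mult in E; [|lra].
  apply (f_equal Re) in E.
  rewrite (CI_ext (fun t => cis (IZR 0 * t)) (fun _ => 1%C)) in E
    by (intros; rewrite Rmult_0_l, cis_0; reflexivity).
  rewrite CI_const in E. simpl in E.
  rewrite (RInt_extR _ (poisson z)) in E by (intros; rewrite Rmult_0_l, cos_0; unfold Re, Im; ring).
  lra.
Qed.

Lemma poisson_moments z : inD z ->
  RInt (fun t => cos t * poisson z t) 0 (2 * PI) = 2 * PI * Re z /\
  RInt (fun t => sin t * poisson z t) 0 (2 * PI) = 2 * PI * Im z.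
Proof.
  intros Hz. assert (HPI := PI_RGT_0). assert (hp := poisson_contR z Hz).
  assert (E : HE (fun t => cis (IZR 1 * t)) z = z).
  { unfold HE. rewrite (CT_ext _ _ z (Cconj_cis_int 1)), !CT_cis by (auto; lia).
    simpl. apply Re_Im_eq; simpl; unfold Re, Im; ring. }
  rewrite HE_poisson in E by (solve [exact Hz | ccont]). symmetry in E. apply RtoC_inv_mult in E; [|lra].
  rewrite CI_cis in E by lia. rewrite Cplus_0_r in E.
  assert (E1 := f_equal Re E). assert (E2 := f_equal Im E). clear E. unfold CI in E1, E2.
  simpl in E1, E2. unfold Re, Im. split.
  - rewrite (RInt_extR _ (fun t => cos (1 * t) * poisson z t - sin (1 * t) * 0))
      by (intros; rewrite !Rmult_1_l; ring). (etransitivity; [exact E1|]); Req; ring.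
  - rewrite (RInt_extR _ (fun t => cos (1 * t) * 0 + sin (1 * t) * poisson z t))
      by (intros; rewrite !Rmult_1_l; ring). (etransitivity; [exact E2|]); Req; ring.
Qed.

Section HarmonicExtension.
Variable phi : R -> R.
Hypothesis Hphi : odd_lift phi.

Definition bd (t : R) : C := cis (phi t).
Definition bdc (t : R) : C := Cconj (bd t).

Lemma cphi : contR phi.
Proof. apply Hphi. Qed.

Lemma bd_ccont : ccont bd.
Proof. assert (h := cphi). unfold bd. ccont. Qed.

Lemma bdc_ccont : ccont bdc.
Proof. apply (ccont_conj bd), bd_ccont. Qed.

Lemma Cmod_bd t : Cmod (bd t) <= 1.
Proof. unfold bd. rewrite Cmod_cis. lra. Qed.

Lemma Cmod_bdc t : Cmod (bdc t) <= 1.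
Proof. unfold bdc. rewrite Cmod_conj. apply Cmod_bd. Qed.

Lemma RInt_antiperiodic f : contR f -> (forall t, f (t + PI) = - f t) -> RInt f 0 (2 * PI) = 0.
Proof.
  intros Hf Ha. rewrite <- (RInt_ChaslesR f 0 PI (2 * PI)) by auto.
  replace (RInt f PI (2 * PI)) with (RInt (fun t => f (t + PI)) 0 PI).
  - rewrite (RInt_extR _ _ _ _ Ha), RInt_oppR by auto. Req; ring.
  - rewrite RInt_shiftR by auto. f_equal; ring.
Qed.

Lemma CI_bd : CI bd = 0%C.
Proof.
  assert (h := cphi). apply Re_Im_eq; simpl; apply RInt_antiperiodic; contR;
  intros t; rewrite (ol_half phi Hphi); [apply neg_cos | apply neg_sin].
Qed.

Lemma HE_bd z : inD z ->
  RInt (fun t => cos (phi t) * poisson z t) 0 (2 * PI) = 2 * PI * Re (HE bd z) /\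
  RInt (fun t => sin (phi t) * poisson z t) 0 (2 * PI) = 2 * PI * Im (HE bd z).
Proof.
  intros Hz. assert (HPI := PI_RGT_0). assert (h := cphi).
  assert (E := HE_poisson bd z bd_ccont Hz). rewrite CI_bd, Cplus_0_r in E.
  revert E. generalize (HE bd z). intros w E.
  apply RtoC_inv_mult in E; [|lra].
  assert (E1 := f_equal Re E). assert (E2 := f_equal Im E). clear E. unfold CI in E1, E2.
  simpl in E1, E2. split.
  - rewrite (RInt_extR _ (fun t => cos (phi t) * poisson z t - sin (phi t) * 0)) by (intros; ring).
    (etransitivity; [exact E1|]); unfold Re, Im; Req; ring.
  - rewrite (RInt_extR _ (fun t => cos (phi t) * 0 + sin (phi t) * poisson z t)) by (intros; ring).
    (etransitivity; [exact E2|]); unfold Re, Im; Req; ring.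
Qed.

Lemma HE_bd_inj z1 z2 : inD z1 -> inD z2 -> HE bd z1 = HE bd z2 -> z1 = z2.
Proof.
  intros H1 H2 E. apply NNPP. intros Hne. assert (h := cphi).
  assert (c1 := poisson_contR z1 H1). assert (c2 := poisson_contR z2 H2).
  assert (d1 := pden_contR z1). assert (d2 := pden_contR z2).
  assert (r1 := inD_sqr z1 H1). assert (r2 := inD_sqr z2 H2).
  set (s1 := Cmod z1 ^ 2) in *. set (s2 := Cmod z2 ^ 2) in *.
  (* The coefficients of (1 - s1) [pden z2] - (1 - s2) [pden z1], the numerator of the difference of
     the two Poisson kernels. *)
  set (p := 2 * ((1 - s2) * Re z1 - (1 - s1) * Re z2)).
  set (q := 2 * ((1 - s2) * Im z1 - (1 - s1) * Im z2)).
  set (c := 2 * (s2 - s1)).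
  set (w := fun t => / (pden z1 t * pden z2 t)).
  assert (Hw : forall t, 0 < w t).
  { intros t. apply Rinv_0_lt_compat, Rmult_lt_0_compat; apply pden_pos; auto. }
  assert (Ew : forall t, poisson z1 t - poisson z2 t = (p * cos t + q * sin t + c) * w t).
  { intros t. unfold w, poisson. assert (k1 := pden_pos z1 t H1). assert (k2 := pden_pos z2 t H2).
    fold s1 s2. field_simplify_eq; [|split; lra]. unfold pden, p, q, c. fold s1 s2. ring. }
  assert (cw : contR w).
  { apply contR_inv; [contR|]. intros t. assert (k1 := pden_pos z1 t H1). assert (k2 := pden_pos z2 t H2). nra. }
  apply (chord_separation phi w p q c Hphi cw Hw).
  - apply NNPP. intros N. apply Hne.
    assert (p = 0 /\ q = 0 /\ c = 0) as [ep [eq ec]] by (repeat split; apply NNPP; tauto).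
    unfold c in ec. assert (e : s2 = s1) by lra. unfold p, q in *. rewrite e in *.
    apply Re_Im_eq; nra.
  - rewrite (RInt_extR _ (fun t => poisson z1 t - poisson z2 t)) by (intros; rewrite Ew; reflexivity).
    rewrite RInt_minusR, !poisson_mass by auto. apply Rminus_eq_0.
  - rewrite (RInt_extR _ (fun t => cos (phi t) * poisson z1 t - cos (phi t) * poisson z2 t))
      by (intros; rewrite <- Ew; ring).
    rewrite RInt_minusR by contR. destruct (HE_bd z1 H1) as [-> _]. destruct (HE_bd z2 H2) as [-> _].
    rewrite E. apply Rminus_eq_0.
  - rewrite (RInt_extR _ (fun t => sin (phi t) * poisson z1 t - sin (phi t) * poisson z2 t))
      by (intros; rewrite <- Ew; ring).
    rewrite RInt_minusR by contR. destruct (HE_bd z1 H1) as [_ ->]. destruct (HE_bd z2 H2) as [_ ->].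
    rewrite E. apply Rminus_eq_0.
Qed.

Lemma pden_le z t : inD z -> pden z t <= 4.
Proof.
  intros Hz. rewrite pden_Cmod. unfold inD in Hz.
  assert (h := Cmod_triangle 1 (- (z * cis (- t)))). rewrite Cmod_opp, Cmod_mult, Cmod_cis, Cmod_1 in h.
  fold (1 - z * cis (- t))%C in h. assert (h' := Cmod_ge_0 (1 - z * cis (- t))). nra.
Qed.

(** In the direction th of the value, 1 - |HE| is the Poisson average of 1 - cos (phi - th). The
    Poisson kernel is at least m > 0, and oddness makes the cosine average to 0, so 1 - |HE| >=
    m. *)
Lemma HE_bd_inD z : inD z -> inD (HE bd z).
Proof.
  intros Hz. unfold inD. assert (HPI := PI_RGT_0). assert (h := cphi).
  assert (cp := poisson_contR z Hz).
  destruct (Req_dec (Cmod (HE bd z)) 0) as [e|e]; [lra|].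
  assert (hp : 0 < Cmod (HE bd z)) by (assert (k := Cmod_ge_0 (HE bd z)); lra).
  destruct (polar (HE bd z) hp) as [th [Ec Es]].
  set (r := Cmod (HE bd z)) in *.
  destruct (HE_bd z Hz) as [I1 I2]. rewrite Ec in I1. rewrite Es in I2.
  assert (Hs := inD_sqr z Hz). set (m := (1 - Cmod z ^ 2) / 4).
  assert (L : RInt (fun t => m * (1 - cos (phi t - th))) 0 (2 * PI) <=
     RInt (fun t => (1 - cos (phi t - th)) * poisson z t) 0 (2 * PI)).
  { apply RInt_leR; [lra | contR | contR |]. intros t _.
    assert (k := COS_bound (phi t - th)). rewrite Rmult_comm. apply Rmult_le_compat_l; [lra|].
    unfold m, poisson, Rdiv. apply Rmult_le_compat_l; [lra|].
    apply Rinv_le_contravar; [apply pden_pos; auto | apply pden_le; auto]. }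
  rewrite RInt_scalR, RInt_minusR, RInt_constR in L by contR.
  rewrite (RInt_antiperiodic (fun t => cos (phi t - th))) in L.
  - rewrite (RInt_extR _ (fun t => poisson z t - (cos th * (cos (phi t) * poisson z t) +
        sin th * (sin (phi t) * poisson z t)))) in L by (intros; rewrite cos_minus; ring).
    rewrite RInt_minusR, RInt_plusR, !RInt_scalR, poisson_mass, I1, I2 in L by (auto; contR).
    assert (k := sin2_cos2 th). unfold Rsqr in k.
    replace (cos th * (2 * PI * (r * cos th)) + sin th * (2 * PI * (r * sin th))) with
      (2 * PI * r * (sin th * sin th + cos th * cos th)) in L by ring.
    rewrite k in L. assert (0 < m) by (unfold m; lra). nra.
  - contR.
  - intros t. rewrite (ol_half phi Hphi). replace (phi t + PI - th) with (phi t - th + PI) by ring.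
    apply neg_cos.
Qed.
End HarmonicExtension.

(** * The Jacobian of the extension *)

Lemma cderiv_locally_const h c z l : inD z -> (forall w, inD w -> h w = c) -> cderiv h z l -> l = 0%C.
Proof.
  unfold inD. intros Hz Hc Hl. apply Cmod_small_eq. intros eps He.
  destruct (proj1 (cderiv_eps h z l) Hl eps He) as [d [hd H]].
  set (s := Rmin d (1 - Cmod z) / 2).
  assert (hs : 0 < s /\ s < d /\ s < 1 - Cmod z) by (unfold s, Rmin; destruct Rle_dec; lra).
  assert (Es : (z + RtoC s - z)%C = RtoC s) by ring.
  assert (ms : Cmod (RtoC s) = s) by (rewrite Cmod_R, Rabs_right; lra).
  assert (k := H (z + RtoC s)%C). rewrite Es, ms in k. specialize (k ltac:(lra)).
  rewrite (Hc z), (Hc (z + RtoC s)%C) in k; auto.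
  - replace (c - c - s * l)%C with (- (s * l))%C in k by ring.
    rewrite Cmod_opp, Cmod_mult, ms in k.
    replace (l - 0)%C with l by ring.
    apply Rmult_le_reg_l with s; lra.
  - assert (t := Cmod_triangle z (RtoC s)). rewrite ms in t. lra.
Qed.

Lemma CTd_one z : inD z -> CTd (fun _ => 1%C) z = 0%C.
Proof.
  intros Hz. apply (cderiv_locally_const (CT (fun _ => 1%C)) 1 z); auto.
  - intros w Hw. rewrite (CT_ext _ (fun t => cis (IZR 0 * t))).
    + rewrite CT_cis by (auto; lia). reflexivity.
    + intros t. rewrite Rmult_0_l, cis_0. reflexivity.
  - apply CT_derive; auto; [ccont|]. intros t. rewrite Cmod_1. lra.
Qed.

(** The derivative of the Poisson kernel at z in the direction v, since [poisson z t] = 2 Re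
    ([ker z t]) - 1. *)
Definition dker (v z : C) (t : R) : R := 2 * Re (v * (cis (- t) * (ker z t * ker z t))).

Lemma dker_ccont v z : inD z -> ccont (fun t => (v * (cis (- t) * (ker z t * ker z t)))%C).
Proof. intros Hz. assert (h := ker_ccont z Hz). ccont. Qed.

Lemma dker_contR v z : inD z -> contR (dker v z).
Proof. intros Hz. destruct (dker_ccont v z Hz) as [h _]. unfold dker. contR. Qed.

Lemma dker_mass v z : inD z -> RInt (dker v z) 0 (2 * PI) = 0.
Proof.
  intros Hz. assert (HPI := PI_RGT_0). assert (c := dker_ccont v z Hz).
  assert (E := CTd_one z Hz). unfold CTd in E. symmetry in E. apply RtoC_inv_mult in E; [|lra].
  rewrite Cmult_0_r in E.
  unfold dker. rewrite RInt_scalR by apply c.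
  assert (k : CI (fun t => (v * (cis (- t) * (ker z t * ker z t)))%C) = 0%C).
  { rewrite CI_scal.
    - rewrite (CI_ext _ (fun t => (1 * (cis (- t) * (ker z t * ker z t)))%C)) by (intros; ring).
      rewrite E. ring.
    - assert (h := ker_ccont z Hz). ccont. }
  apply (f_equal Re) in k. simpl in k. unfold Re in *. simpl. rewrite k. Req; ring.
Qed.

(** With d = cis (-t), of modulus 1, the numerator v d (1 - conj z conj d)^2 collapses to v d - 2 v
    conj z + u conj d, of degree 1. *)
Lemma dker_trig v z t : inD z -> let u := (v * (Cconj z * Cconj z))%C in
  dker v z t = (2 * (Re v + Re u) * cos t + 2 * (Im v - Im u) * sin t + - 4 * (Re v * Re z + Im v * Im z))
    * (/ pden z t * / pden z t).
Proof.
  intros Hz u. unfold dker. rewrite !ker_pden by auto.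
  assert (e : (cis (- t) * Cconj (cis (- t)) = 1)%C).
  { rewrite <- cis_opp, <- cis_plus, Rplus_opp_r. apply cis_0. }
  replace (v * (cis (- t) * (Cconj (1 - z * cis (- t)) * RtoC (/ pden z t) *
    (Cconj (1 - z * cis (- t)) * RtoC (/ pden z t)))))%C with
    ((v * cis (- t) - 2 * v * Cconj z + u * Cconj (cis (- t))) * RtoC (/ pden z t * / pden z t))%C.
  - set (w := / pden z t * / pden z t). unfold cis. rewrite cos_neg, sin_neg.
    clearbody w u. destruct u as [u1 u2], v as [v1 v2], z as [x y]. simpl. ring.
  - rewrite RtoC_mult, !Cminus_conj, Cmult_conj, Cconj_RtoC. unfold u.
    set (c := Cconj (cis (- t))) in *. set (d := cis (- t)) in *.
    transitivity ((v * d - 2 * v * Cconj z * (d * c) + v * (Cconj z * Cconj z) * c * (d * c)) * (RtoC (/ pden z t) * RtoC (/ pden z t)))%C.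
    + rewrite e. ring.
    + ring.
Qed.

Section HarmonicJacobian.
Variable phi : R -> R.
Hypothesis Hphi : odd_lift phi.

(** The real differential of the extension at z, applied to v. *)
Definition HEd (z v : C) : C := (CTd (bd phi) z * v + Cconj (CTd (bdc phi) z * v))%C.

Lemma HEd_integral z v : inD z ->
  RInt (fun t => cos (phi t) * dker v z t) 0 (2 * PI) = 2 * PI * Re (HEd z v) /\
  RInt (fun t => sin (phi t) * dker v z t) 0 (2 * PI) = 2 * PI * Im (HEd z v).
Proof.
  intros Hz. assert (HPI := PI_RGT_0).
  assert (cb := bd_ccont phi Hphi). assert (cb' := bdc_ccont phi Hphi).
  assert (ck := ker_ccont z Hz). assert (cd := dker_contR v z Hz).
  assert (E : HEd z v = (RtoC (/ (2 * PI)) * CI (fun t => bd phi t * RtoC (dker v z t)))%C).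
  { unfold HEd, CTd. rewrite !Cmult_conj, Cconj_RtoC.
    rewrite <- CI_conj by ccont.
    transitivity (RtoC (/ (2 * PI)) * (v * CI (fun t => bd phi t * (cis (- t) * (ker z t * ker z t)))
      + Cconj v * CI (fun t => Cconj (bdc phi t * (cis (- t) * (ker z t * ker z t))))))%C; [ring|].
    f_equal. rewrite <- !CI_scal, <- CI_plus by ccont. apply CI_ext. intros t.
    unfold bdc. rewrite !Cmult_conj, Cconj_conj.
    transitivity (bd phi t * ((v * (cis (- t) * (ker z t * ker z t)))
      + Cconj (v * (cis (- t) * (ker z t * ker z t)))))%C; [rewrite !Cmult_conj; ring|].
    f_equal. unfold dker. apply Re_Im_eq; simpl; unfold Re, Im; ring. }
  apply RtoC_inv_mult in E; [|lra].
  revert E. generalize (HEd z v). intros w E.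
  assert (E1 := f_equal Re E). assert (E2 := f_equal Im E). clear E. unfold CI in E1, E2.
  simpl in E1, E2. split.
  - rewrite (RInt_extR _ (fun t => cos (phi t) * dker v z t - sin (phi t) * 0)) by (intros; ring).
    (etransitivity; [exact E1|]); unfold Re, Im; Req; ring.
  - rewrite (RInt_extR _ (fun t => cos (phi t) * 0 + sin (phi t) * dker v z t)) by (intros; ring).
    (etransitivity; [exact E2|]); unfold Re, Im; Req; ring.
Qed.

Lemma HEd_neq_0 (z v : C) : inD z -> v <> 0%C -> HEd z v <> 0%C.
Proof.
  intros Hz Hv E. destruct (HEd_integral z v Hz) as [I1 I2]. rewrite E in I1, I2. simpl in I1, I2.
  rewrite Rmult_0_r in I1, I2.
  assert (cp := pden_contR z).
  set (u := (v * (Cconj z * Cconj z))%C).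
  assert (T := fun t => dker_trig v z t Hz). cbv zeta in T. fold u in T.
  apply (chord_separation phi (fun t => / pden z t * / pden z t)
    (2 * (Re v + Re u)) (2 * (Im v - Im u)) (- 4 * (Re v * Re z + Im v * Im z)) Hphi).
  - assert (ci : contR (fun t => / pden z t)).
    { apply contR_inv; auto. intros t. assert (k := pden_pos z t Hz). lra. }
    contR.
  - intros t. assert (k := Rinv_0_lt_compat _ (pden_pos z t Hz)). nra.
  (* If all three coefficients vanish then u = - conj v, so |u| = |v|; but |u| = |v| |z|^2 is
     smaller. *)
  - apply NNPP. intros N.
    assert (e1 : Re u = - Re v) by (apply NNPP; intros n; apply N; left; lra).
    assert (e2 : Im u = Im v) by (apply NNPP; intros n; apply N; right; left; lra).
    assert (e3 : Cmod u ^ 2 = Cmod v ^ 2) by (rewrite !Cmod2_alt, e1, e2; ring).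
    unfold u in e3. rewrite !Cmod_mult, Cmod_conj in e3.
    apply (proj1 (Cmod_gt_0 v)) in Hv. assert (k := inD_sqr z Hz).
    assert (Cmod v ^ 2 * (Cmod z ^ 2 * Cmod z ^ 2) < Cmod v ^ 2 * 1).
    { apply Rmult_lt_compat_l; [apply pow_lt; auto | nra]. }
    nra.
  - etransitivity; [|exact (dker_mass v z Hz)]. apply RInt_extR. intros t. symmetry. apply T.
  - etransitivity; [|exact I1]. apply RInt_extR. intros t. rewrite T. reflexivity.
  - etransitivity; [|exact I2]. apply RInt_extR. intros t. rewrite T. reflexivity.
Qed.

Definition HJ (z : C) : R := Cmod (CTd (bd phi) z) ^ 2 - Cmod (CTd (bdc phi) z) ^ 2.

(** The argument of [HEd] is the adjugate of the differential applied to m. It serves to show that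
    the Jacobian is not 0 and, for surjectivity, to move the image in a prescribed direction m. *)
Lemma HEd_adjugate z m :
  HEd z (Cconj (CTd (bd phi) z) * m - Cconj (CTd (bdc phi) z * m))%C = (RtoC (HJ z) * m)%C.
Proof.
  unfold HEd, HJ. rewrite RtoC_minus, !Cmod2_conj, !Cmult_conj, !Cminus_conj, !Cmult_conj, !Cconj_conj.
  ring.
Qed.
Lemma HJ_neq_0 z : inD z -> HJ z <> 0.
Proof.
  intros Hz E.
  set (a := CTd (bd phi) z) in *. set (b := CTd (bdc phi) z) in *.
  (* With zero determinant the adjugate maps into the kernel, which is trivial; so the adjugate is
     0, and with it the differential. *)
  assert (K : forall m, (Cconj a * m - Cconj (b * m))%C = 0%C).
  { intros m. apply NNPP. intros N. apply (HEd_neq_0 z _ Hz N).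
    unfold a, b. rewrite HEd_adjugate, E. ring. }
  assert (k1 := K 1%C). assert (k2 := K Ci).
  assert (a0 : a = 0%C).
  { assert (r1 := f_equal Re k1). assert (i1 := f_equal Im k1).
    assert (r2 := f_equal Re k2). assert (i2 := f_equal Im k2).
    clear - r1 i1 r2 i2. destruct a as [a1 a2], b as [b1 b2]. simpl in *.
    apply Re_Im_eq; simpl; lra. }
  assert (b0 : b = 0%C).
  { unfold HJ in E. fold a b in E. rewrite a0, Cmod_0 in E. apply Cmod_eq_0.
    assert (k := Cmod_ge_0 b). nra. }
  apply (HEd_neq_0 z 1%C Hz).
  - intros e. apply RtoC_inj in e. lra.
  - unfold HEd. fold a b. rewrite a0, b0. apply Re_Im_eq; simpl; ring.
Qed.

(** The parameter sin s keeps the path on a segment inside the disk for every real s, so that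
    [IVT_R], which asks for continuity on the whole line, applies. *)
Lemma CTd_path_ccont G z : ccont G -> (forall t, Cmod (G t) <= 1) -> inD z ->
  ccont (fun s => CTd G (RtoC (sin s) * z)%C).
Proof.
  intros cG bG Hz. apply ccont_eps. intros x eps He. unfold inD in Hz.
  assert (hz := Cmod_ge_0 z).
  set (M := 4 * (/ (1 - Cmod z)) ^ 3).
  assert (HM : 0 <= M).
  { unfold M. assert (0 < / (1 - Cmod z)) by (apply Rinv_0_lt_compat; lra).
    assert (k := pow_le (/ (1 - Cmod z)) 3). lra. }
  destruct (contR_eps_inv sin contR_sin x (eps / (M + 1))) as [d [hd H]].
  { apply Rdiv_lt_0_compat; lra. }
  exists d. split; auto. intros y Hy. specialize (H y Hy).
  assert (B : forall s, Cmod (RtoC (sin s) * z) <= Cmod z).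
  { intros s. rewrite Cmod_mult, Cmod_R. assert (k := SIN_bound s).
    assert (Rabs (sin s) <= 1) by (apply Rabs_le; lra). nra. }
  eapply Rle_lt_trans; [apply (CTd_Lipschitz G cG bG _ _ (Cmod z)); auto|]. fold M.
  replace (RtoC (sin y) * z - RtoC (sin x) * z)%C with (RtoC (sin y - sin x) * z)%C
    by (rewrite RtoC_minus; ring).
  rewrite Cmod_mult, Cmod_R. assert (k := Rabs_pos (sin y - sin x)).
  apply Rle_lt_trans with (M * (eps / (M + 1))).
  - apply Rmult_le_compat_l; auto. nra.
  - apply Rlt_le_trans with ((M + 1) * (eps / (M + 1))).
    + apply Rmult_lt_compat_r; [apply Rdiv_lt_0_compat; lra | lra].
    + right; field; lra.
Qed.

(** The Jacobian is continuous and never 0 on the radius from 0 to z, so the sign at 0 decides. *)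
Lemma HJ_pos z : 0 <= HJ 0%C -> inD z -> 0 < HJ z.
Proof.
  intros H0 Hz. assert (HPI := PI_RGT_0).
  assert (D : forall s, inD (RtoC (sin s) * z)%C).
  { intros s. unfold inD in *. rewrite Cmod_mult, Cmod_R. assert (k := SIN_bound s).
    assert (Rabs (sin s) <= 1) by (apply Rabs_le; lra). assert (k' := Cmod_ge_0 z). nra. }
  assert (c : contR (fun s => HJ (RtoC (sin s) * z)%C)).
  { unfold HJ. apply (contR_minus (fun s => Cmod (CTd (bd phi) (RtoC (sin s) * z)%C) ^ 2)).
    - apply ccont_Cmod_sqr. apply CTd_path_ccont; auto; [apply bd_ccont; auto | apply Cmod_bd].
    - apply ccont_Cmod_sqr. apply CTd_path_ccont; auto; [apply bdc_ccont; auto | apply Cmod_bdc]. }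
  apply Rnot_le_lt. intros N.
  destruct (IVT_R (fun s => HJ (RtoC (sin s) * z)%C) 0 (PI / 2) 0 c) as [s [_ E]]; [lra| |].
  - right. rewrite sin_0, sin_PI2, Cmult_0_l, Cmult_1_l. auto.
  - apply (HJ_neq_0 _ (D s) E).
Qed.

(** At 0 the kernel is 1, and the Jacobian is a positive multiple of the determinant of the matrix
    of first moments of the boundary map. *)
Lemma HJ_0 : let I q := RInt q 0 (2 * PI) in
  0 <= I (fun t => cos t * cos (phi t)) * I (fun t => sin t * sin (phi t)) -
       I (fun t => cos t * sin (phi t)) * I (fun t => sin t * cos (phi t)) ->
  0 <= HJ 0%C.
Proof.
  intros I H. assert (HPI := PI_RGT_0). assert (c := cphi phi Hphi).
  assert (k0 : forall t, (cis (- t) * (ker 0 t * ker 0 t))%C = cis (- t)).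
  { intros t. unfold ker. rewrite Cmult_0_l. field. }
  unfold HJ, CTd.
  rewrite (CI_ext _ (fun t => (bd phi t * cis (- t))%C)) by (intros; rewrite k0; reflexivity).
  rewrite (CI_ext (fun t => (bdc phi t * (cis (- t) * (ker 0 t * ker 0 t)))%C) (fun t => Cconj (bd phi t * cis t)%C))
    by (intros; rewrite k0, cis_opp; unfold bdc; rewrite Cmult_conj; reflexivity).
  assert (cb := bd_ccont phi Hphi).
  rewrite CI_conj by ccont. rewrite !Cmod_mult, Cmod_conj, !Rpow_mult_distr, !Cmod_R, <- Rmult_minus_distr_l.
  apply Rmult_le_pos; [apply pow2_ge_0|].
  rewrite !Cmod2_alt. unfold CI, bd, cis; simpl Re; simpl Im.
  rewrite (RInt_extR (fun t => cos (phi t) * cos (- t) - sin (phi t) * sin (- t))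
    (fun t => cos t * cos (phi t) + sin t * sin (phi t))) by (intros; rewrite cos_neg, sin_neg; ring).
  rewrite (RInt_extR (fun t => cos (phi t) * sin (- t) + sin (phi t) * cos (- t))
    (fun t => cos t * sin (phi t) - sin t * cos (phi t))) by (intros; rewrite cos_neg, sin_neg; ring).
  rewrite (RInt_extR (fun t => cos (phi t) * cos t - sin (phi t) * sin t)
    (fun t => cos t * cos (phi t) - sin t * sin (phi t))) by (intros; ring).
  rewrite (RInt_extR (fun t => cos (phi t) * sin t + sin (phi t) * cos t)
    (fun t => cos t * sin (phi t) + sin t * cos (phi t))) by (intros; ring).
  rewrite !RInt_plusR, !RInt_minusR by contR. fold (I (fun t => cos t * cos (phi t)))
   (I (fun t => sin t * sin (phi t))) (I (fun t => cos t * sin (phi t))) (I (fun t => sin t * cos (phi t))).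
  nra.
Qed.

Lemma HE_derive z : inD z -> forall eps, 0 < eps -> exists del, 0 < del /\
  forall w, Cmod (w - z) < del ->
    Cmod (HE (bd phi) w - HE (bd phi) z - HEd z (w - z)) <= eps * Cmod (w - z).
Proof.
  intros Hz eps He.
  assert (d1 := CT_derive (bd phi) (bd_ccont phi Hphi) (Cmod_bd phi) z Hz).
  assert (d2 := CT_derive (bdc phi) (bdc_ccont phi Hphi) (Cmod_bdc phi) z Hz).
  destruct (proj1 (cderiv_eps _ _ _) d1 (eps / 2)) as [e1 [h1 H1]]; [lra|].
  destruct (proj1 (cderiv_eps _ _ _) d2 (eps / 2)) as [e2 [h2 H2]]; [lra|].
  exists (Rmin e1 e2). split; [apply Rmin_pos; auto|]. intros w Hw.
  assert (k1 := H1 w (Rlt_le_trans _ _ _ Hw (Rmin_l _ _))).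
  assert (k2 := H2 w (Rlt_le_trans _ _ _ Hw (Rmin_r _ _))).
  unfold HE, HEd. change (fun t => Cconj (bd phi t)) with (bdc phi).
  match goal with |- Cmod ?x <= _ => replace x with
    ((CT (bd phi) w - CT (bd phi) z - (w - z) * CTd (bd phi) z) +
     Cconj (CT (bdc phi) w - CT (bdc phi) z - (w - z) * CTd (bdc phi) z))%C end.
  - eapply Rle_trans; [apply Cmod_triangle|]. rewrite Cmod_conj. lra.
  - rewrite !Cminus_conj, !Cmult_conj, !Cminus_conj. ring.
Qed.

Lemma HE_cont z : inD z -> forall eps, 0 < eps -> exists del, 0 < del /\
  forall w, Cmod (w - z) < del -> Cmod (HE (bd phi) w - HE (bd phi) z) < eps.
Proof.
  intros Hz eps He.
  assert (d1 := CT_derive (bd phi) (bd_ccont phi Hphi) (Cmod_bd phi) z Hz).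
  assert (d2 := CT_derive (bdc phi) (bdc_ccont phi Hphi) (Cmod_bdc phi) z Hz).
  destruct (cderiv_cont _ _ _ d1 (eps / 2)) as [e1 [h1 H1]]; [lra|].
  destruct (cderiv_cont _ _ _ d2 (eps / 2)) as [e2 [h2 H2]]; [lra|].
  exists (Rmin e1 e2). split; [apply Rmin_pos; auto|]. intros w Hw.
  assert (k1 := H1 w (Rlt_le_trans _ _ _ Hw (Rmin_l _ _))).
  assert (k2 := H2 w (Rlt_le_trans _ _ _ Hw (Rmin_r _ _))).
  unfold HE. change (fun t => Cconj (bd phi t)) with (bdc phi).
  match goal with |- Cmod ?x < _ => replace x with
    ((CT (bd phi) w - CT (bd phi) z) + Cconj (CT (bdc phi) w - CT (bdc phi) z))%C end.
  - eapply Rle_lt_trans; [apply Cmod_triangle|]. rewrite Cmod_conj. lra.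
  - rewrite !Cminus_conj. ring.
Qed.
End HarmonicJacobian.

(** * The extension is a homeomorphism of the closed disk *)

Lemma inDbar_0 : inDbar 0%C.
Proof. unfold inDbar. rewrite Cmod_0. lra. Qed.

Lemma Dbar_max (N : C -> R) M : (forall z, inDbar z -> N z <= M) ->
  (forall z, inDbar z -> forall eps, 0 < eps -> exists del, 0 < del /\ forall w, inDbar w ->
    Cmod (w - z) < del -> Rabs (N w - N z) < eps) ->
  exists z, inDbar z /\ forall w, inDbar w -> N w <= N z.
Proof.
  intros Hb Hc.
  destruct (completeness (fun y => exists z, inDbar z /\ y = N z)) as [s [Hs1 Hs2]].
  - exists M. intros y [z [Hz ->]]. auto.
  - exists (N 0%C). exists 0%C. split; auto. apply inDbar_0.
  - apply NNPP. intros Hn.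
    assert (Hlt : forall z, inDbar z -> N z < s).
    { intros z Hz. assert (k : N z <= s) by (apply Hs1; eauto). destruct k as [k|k]; auto.
      exfalso. apply Hn. exists z. split; auto. intros w Hw. rewrite k. apply Hs1. eauto. }
    (* The radius is also kept below half the gap s - N z, so that the common lower bound e of the
       radii becomes a gap below the supremum. *)
    assert (H : forall z, exists d, inDbar z -> 0 < d /\ d <= (s - N z) / 2 /\ forall w, inDbar w -> Cmod (w - z) < d ->
      N w < N z + (s - N z) / 2).
    { intros z. destruct (classic (inDbar z)) as [hz|hz]; [|exists 0; tauto].
      assert (k := Hlt z hz).
      destruct (Hc z hz ((s - N z) / 2)) as [d [hd Hd]]; [lra|].
      exists (Rmin d ((s - N z) / 2)). intros _. split; [apply Rmin_pos; lra|]. split; [apply Rmin_r|].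
      intros w Hw Hwz. assert (k2 := Hd w Hw (Rlt_le_trans _ _ _ Hwz (Rmin_l _ _))).
      apply Rabs_def2 in k2. lra. }
    set (d := fun z => proj1_sig (constructive_indefinite_description _ (H z))).
    assert (Hd : forall z, inDbar z -> 0 < d z /\ d z <= (s - N z) / 2 /\ forall w, inDbar w -> Cmod (w - z) < d z ->
      N w < N z + (s - N z) / 2).
    { intros z. unfold d. destruct constructive_indefinite_description. simpl. auto. }
    destruct (Dbar_compact d) as [e [he HH]]; [apply Hd|].
    assert (k : s <= s - e); [|lra].
    apply Hs2. intros y [z [Hz ->]].
    destruct (HH z Hz) as [u [Hu [H1 H2]]]. destruct (Hd u Hu) as [_ [H3 H4]].
    assert (k := H4 z Hz H1). lra.
Qed.

(* The inverse is continuous at [F z0] because, by compactness, F keeps a positive distance to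
   [F z0] off any neighbourhood of z0. *)
Lemma homeo_of_bij F : bij_onto inDbar inDbar F ->
  (forall z, inDbar z -> cont_within inDbar F z) -> homeo_Dbar F.
Proof.
  intros HF Hc. split; [exact HF|]. split; [exact Hc|].
  destruct HF as [Hin [Hinj Hsurj]].
  assert (Hs : forall w, exists z, inDbar w -> inDbar z /\ F z = w).
  { intros w. destruct (classic (inDbar w)) as [h|h].
    - destruct (Hsurj w h) as [z Hz]. eauto.
    - exists 0%C. tauto. }
  set (G := fun w => proj1_sig (constructive_indefinite_description _ (Hs w))).
  assert (HG : forall w, inDbar w -> inDbar (G w) /\ F (G w) = w).
  { intros w. unfold G. destruct constructive_indefinite_description. simpl. auto. }
  exists G. split; [|split].
  - intros z Hz. apply Hinj; auto; apply HG; auto.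
  - intros w Hw. apply HG; auto.
  - intros w0 Hw0 eps He. destruct (HG w0 Hw0) as [Hz0 Ez0]. set (z0 := G w0) in *.
    (* Near each centre u either all points are close to z0 or all images stay away from w0; one
       number d serves as radius and as distance. *)
    assert (H : forall u, exists d, inDbar u -> 0 < d /\ forall z, inDbar z -> Cmod (z - u) < d ->
       Cmod (z - z0) < eps \/ d <= Cmod (F z - w0)).
    { intros u. destruct (classic (inDbar u)) as [hu|hu]; [|exists 0; tauto].
      destruct (Rlt_dec (Cmod (u - z0)) (eps / 2)) as [h|h].
      - exists (eps / 2). intros _. split; [lra|]. intros z Hz Hzu. left.
        assert (k := Csub_triangle z u z0). lra.
      - assert (hp : 0 < Cmod (F u - w0)).
        { apply Cmod_gt_0. intros e. apply h. assert (u = z0).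
          { apply Hinj; auto. rewrite Ez0. replace (F u) with ((F u - w0) + w0)%C by ring.
            rewrite e. ring. }
          subst u. unfold Cminus. rewrite Cplus_opp_r, Cmod_0. lra. }
        destruct (Hc u hu (Cmod (F u - w0) / 2)) as [d [hd Hd]]; [lra|].
        exists (Rmin d (Cmod (F u - w0) / 2)). intros _. split; [apply Rmin_pos; lra|].
        intros z Hz Hzu. right.
        assert (k := Hd z Hz (Rlt_le_trans _ _ _ Hzu (Rmin_l _ _))).
        assert (k2 := Csub_triangle (F u) (F z) w0). rewrite (Cmod_sub_sym (F u) (F z)) in k2.
        assert (k3 := Rmin_r d (Cmod (F u - w0) / 2)). lra. }
    set (d := fun u => proj1_sig (constructive_indefinite_description _ (H u))).
    assert (Hd : forall u, inDbar u -> 0 < d u /\ forall z, inDbar z -> Cmod (z - u) < d u ->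
       Cmod (z - z0) < eps \/ d u <= Cmod (F z - w0)).
    { intros z. unfold d. destruct constructive_indefinite_description. simpl. auto. }
    destruct (Dbar_compact d) as [e [he HH]]; [apply Hd|].
    exists e. split; auto. intros w Hw Hww.
    destruct (HG w Hw) as [Hz Ez]. destruct (HH (G w) Hz) as [u [Hu [H1 H2]]].
    destruct (proj2 (Hd u Hu) (G w) Hz H1) as [k|k]; auto. rewrite Ez in k. lra.
Qed.

Section Extension.
Variables (phi : R -> R) (B : C -> C).
Hypothesis Hphi : odd_lift phi.
Hypothesis HB : forall t, B (cis t) = bd phi t.
Hypothesis cB : forall z, onT z -> cont_within onT B z.
Hypothesis HJ0 : 0 <= HJ phi 0%C.

(** The boundary values come from B, a function of the point and not of its angle, so that their
    continuity on the circle can be assumed directly. *)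
Definition HExt (z : C) : C := if Rlt_dec (Cmod z) 1 then HE (bd phi) z else B z.

Lemma HExt_inD z : inD z -> HExt z = HE (bd phi) z.
Proof. intros Hz. unfold HExt, inD in *. destruct Rlt_dec; tauto. Qed.

Lemma HExt_onT z : onT z -> HExt z = B z.
Proof. intros Hz. unfold HExt, onT in *. destruct Rlt_dec; [lra | reflexivity]. Qed.

Lemma HExt_cis t : HExt (cis t) = bd phi t.
Proof. rewrite HExt_onT; [apply HB | apply Cmod_cis]. Qed.

Lemma inDbar_cases z : inDbar z -> inD z \/ exists t, 0 <= t < 2 * PI /\ z = cis t.
Proof.
  intros [h|h]; [left; exact h | right]. destruct (cis_surj z h) as [t Ht]. eauto.
Qed.

Lemma Cmod_cis_sub t z : Cmod z = 1 -> Cmod (cis t - z) ^ 2 = 2 - 2 * (cos t * Re z + sin t * Im z).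
Proof.
  intros Hz. assert (k := Cmod_sqr z). rewrite Hz in k. rewrite Cmod2_alt. simpl.
  assert (h := sin2_cos2 t). unfold Rsqr in h. unfold Re, Im in *. nra.
Qed.

(* Korovkin's argument: the oscillation of f at z0 is at most [eps + M |cis t - z0|^2], and the
   Poisson integral of [|cis t - z0|^2] is explicit. *)
Lemma poisson_boundary f z0 c eps del z : contR f -> (forall t, Rabs (f t) <= 1) -> Rabs c <= 1 ->
  0 < del -> Cmod z0 = 1 -> inD z -> (forall t, Cmod (cis t - z0) < del -> Rabs (f t - c) <= eps) ->
  Rabs (RInt (fun t => f t * poisson z t) 0 (2 * PI) - 2 * PI * c) <=
  2 * PI * (eps + 4 / del ^ 2 * Cmod (z - z0)).
Proof.
  intros cf bf bc Hd Hz0 Hz H. assert (HPI := PI_RGT_0). assert (cp := poisson_contR z Hz).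
  assert (hd2 : 0 < del ^ 2) by (apply pow_lt; auto).
  (* As |f t - c| <= 2, this constant lets the quadratic term dominate wherever |cis t - z0| >=
     del. *)
  set (M := 2 / del ^ 2). assert (HM : 0 < M) by (apply Rdiv_lt_0_compat; lra).
  assert (He : 0 <= eps \/ forall t, del <= Cmod (cis t - z0)).
  { destruct (Rle_dec 0 eps) as [h|h]; auto. right. intros t. apply Rnot_lt_le. intros k.
    assert (k1 := H t k). assert (k2 := Rabs_pos (f t - c)). lra. }
  assert (He0 : 0 <= eps).
  { destruct He as [h|h]; auto. exfalso. destruct (cis_surj z0 Hz0) as [t [_ E]].
    assert (k := h t). rewrite <- E in k. unfold Cminus in k. rewrite Cplus_opp_r, Cmod_0 in k. lra. }
  assert (W : forall t, Rabs (f t - c) <= eps + M * (2 - 2 * (cos t * Re z0 + sin t * Im z0))).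
  { intros t. rewrite <- Cmod_cis_sub by auto. assert (k := pow2_ge_0 (Cmod (cis t - z0))).
    destruct (Rlt_dec (Cmod (cis t - z0)) del) as [h|h].
    - assert (k1 := H t h). nra.
    - assert (k1 : Rabs (f t - c) <= 2).
      { assert (k2 := bf t). apply Rabs_le_between in k2. apply Rabs_le_between in bc. apply Rabs_le; lra. }
      assert (k2 : del ^ 2 <= Cmod (cis t - z0) ^ 2) by (apply pow_incr; lra).
      assert (2 <= M * Cmod (cis t - z0) ^ 2); [|lra].
      replace 2 with (M * del ^ 2) at 1 by (unfold M; field; lra). nra. }
  assert (E : RInt (fun t => f t * poisson z t) 0 (2 * PI) - 2 * PI * c =
    RInt (fun t => (f t - c) * poisson z t) 0 (2 * PI)).
  { rewrite (RInt_extR (fun t => (f t - c) * poisson z t) (fun t => f t * poisson z t - c * poisson z t))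
      by (intros; ring).
    rewrite RInt_minusR, RInt_scalR, poisson_mass by (auto; contR). Req; ring. }
  rewrite E.
  destruct (poisson_moments z Hz) as [m1 m2].
  assert (I : RInt (fun t => (eps + M * (2 - 2 * (cos t * Re z0 + sin t * Im z0))) * poisson z t) 0 (2 * PI) =
    2 * PI * (eps + M * (2 - 2 * (Re z * Re z0 + Im z * Im z0)))).
  { rewrite (RInt_extR _ (fun t => (eps + 2 * M) * poisson z t - (2 * M * Re z0) * (cos t * poisson z t)
       - (2 * M * Im z0) * (sin t * poisson z t))) by (intros; ring).
    rewrite !RInt_minusR, !RInt_scalR, poisson_mass, m1, m2 by (auto; contR). Req; ring. }
  (* 2 - 2 Re (z conj z0) = 2 Re ((z0 - z) conj z0), at most 2 |z - z0|. *)
  assert (L : 2 * PI * (eps + M * (2 - 2 * (Re z * Re z0 + Im z * Im z0))) <= 2 * PI * (eps + 4 / del ^ 2 * Cmod (z - z0))).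
  { apply Rmult_le_compat_l; [lra|]. apply Rplus_le_compat_l.
    replace (4 / del ^ 2) with (M * 2) by (unfold M; field; lra). rewrite Rmult_assoc.
    apply Rmult_le_compat_l; [lra|].
    assert (k := Cmod_sqr z0). rewrite Hz0 in k.
    assert (k2 := Rabs_Re_le ((z0 - z) * Cconj z0)). rewrite Cmod_mult, Cmod_conj, Hz0, Rmult_1_r, Cmod_sub_sym in k2.
    apply Rabs_le_between in k2. simpl in k2. unfold Re, Im in *. lra. }
  eapply Rle_trans; [|exact L]. rewrite <- I.
  apply Rabs_le. split.
  - rewrite <- RInt_oppR by contR. apply RInt_leR; [lra | contR | contR |]. intros t _.
    assert (k := W t). apply Rabs_le_between in k. assert (kp := poisson_pos z t Hz). nra.
  - apply RInt_leR; [lra | contR | contR |]. intros t _.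
    assert (k := W t). apply Rabs_le_between in k. assert (kp := poisson_pos z t Hz). nra.
Qed.

Lemma HExt_cont z : inDbar z -> cont_within inDbar HExt z.
Proof.
  intros Hz eps He. assert (HPI := PI_RGT_0). assert (c := cphi phi Hphi).
  destruct (inDbar_cases z Hz) as [h|[t0 [_ E0]]].
  - destruct (HE_cont phi Hphi z h eps He) as [d [hd Hd]].
    exists (Rmin d (1 - Cmod z)). unfold inD in h. split; [apply Rmin_pos; lra|].
    intros w _ Hw. assert (k1 := Rmin_l d (1 - Cmod z)). assert (k2 := Rmin_r d (1 - Cmod z)).
    rewrite !HExt_inD; auto; [apply Hd; lra|].
    unfold inD. assert (k := Cmod_triangle (w - z) z). replace (w - z + z)%C with w in k by ring. lra.
  - assert (HzT : onT z) by (rewrite E0; apply Cmod_cis).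
    destruct (cB z HzT (eps / 4)) as [d [hd Hd]]; [lra|].
    assert (hd2 : 0 < d ^ 2) by (apply pow_lt; auto).
    (* The Korovkin term is then below (4 / d^2) (eps d^2 / 32) = eps / 8, so each coordinate errs
       by less than 3 eps / 8. *)
    exists (Rmin d (eps * d ^ 2 / 32)). split; [apply Rmin_pos; [|apply Rdiv_lt_0_compat]; nra|].
    intros w Hw Hwz. assert (k1 := Rlt_le_trans _ _ _ Hwz (Rmin_l _ _)).
    assert (k2 := Rlt_le_trans _ _ _ Hwz (Rmin_r _ _)).
    rewrite (HExt_onT z HzT).
    destruct Hw as [hw|hw].
    + rewrite HExt_inD by exact hw. rewrite E0, HB.
      assert (B0 : forall t, Cmod (cis t - z) < d -> Cmod (bd phi t - bd phi t0) <= eps / 4).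
      { intros t Ht. rewrite <- !HB, <- E0. apply Rlt_le, Hd; auto. apply Cmod_cis. }
      assert (P1 := poisson_boundary (fun t => cos (phi t)) z (cos (phi t0)) (eps / 4) d w
        ltac:(contR) ltac:(intros; apply Rabs_le, COS_bound) ltac:(apply Rabs_le, COS_bound) hd HzT hw).
      assert (P2 := poisson_boundary (fun t => sin (phi t)) z (sin (phi t0)) (eps / 4) d w
        ltac:(contR) ltac:(intros; apply Rabs_le, SIN_bound) ltac:(apply Rabs_le, SIN_bound) hd HzT hw).
      destruct (HE_bd phi Hphi w hw) as [I1 I2]. cbv beta in P1, P2. rewrite I1 in P1. rewrite I2 in P2. clear I1 I2.
      specialize (P1 ltac:(intros t Ht; eapply Rle_trans; [apply (Rabs_Re_le (bd phi t - bd phi t0)) | auto])).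
      specialize (P2 ltac:(intros t Ht; eapply Rle_trans; [apply (Rabs_Im_le (bd phi t - bd phi t0)) | auto])).
      rewrite <- Rmult_minus_distr_l, Rabs_mult, (Rabs_right (2 * PI)) in P1, P2 by lra.
      apply Rmult_le_reg_l in P1; [|lra]. apply Rmult_le_reg_l in P2; [|lra].
      assert (k3 : 4 / d ^ 2 * Cmod (w - z) < eps / 8).
      { apply Rlt_le_trans with (4 / d ^ 2 * (eps * d ^ 2 / 32)).
        - apply Rmult_lt_compat_l; auto. apply Rdiv_lt_0_compat; lra.
        - right. field. lra. }
      eapply Rle_lt_trans; [apply Cmod_le_Re_Im|].
      revert P1 P2. unfold bd. generalize (HE (fun t => cis (phi t)) w). intros v P1 P2.
      simpl. unfold Re, Im, Rminus in *. lra.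
    + rewrite HExt_onT by exact hw. apply Rlt_trans with (eps / 4); [|lra]. apply Hd; auto.
Qed.

Lemma HExt_inDbar z : inDbar z -> inDbar (HExt z).
Proof.
  intros Hz. destruct (inDbar_cases z Hz) as [h|[t [_ ->]]].
  - rewrite HExt_inD by auto. apply Rlt_le. apply HE_bd_inD; auto.
  - rewrite HExt_cis. apply Cmod_bd.
Qed.

(* The denominator is [|p - w|^2 + (1 - |p|^2)], so this is a decreasing function of the
   hyperbolic distance from p to w; it vanishes on the circle and w is its only critical point in
   the disk. *)
Definition pseudohyp (w p : C) : R :=
  (1 - (Re p * Re p + Im p * Im p)) * / (1 + Cmod w ^ 2 - 2 * (Re p * Re w + Im p * Im w)).

Lemma pseudohyp_den w p : inD w -> inDbar p ->
  (1 - Cmod w) ^ 2 <= 1 + Cmod w ^ 2 - 2 * (Re p * Re w + Im p * Im w).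
Proof.
  unfold inD, inDbar. intros Hw Hp.
  assert (k := Rabs_Re_le (p * Cconj w)). rewrite Cmod_mult, Cmod_conj in k.
  apply Rabs_le_between in k. simpl in k. unfold Re, Im in *.
  assert (h := Cmod_ge_0 w). assert (h' := Cmod_ge_0 p). nra.
Qed.

Lemma pseudohyp_cont w z : inD w -> inDbar z -> forall eps, 0 < eps -> exists del, 0 < del /\
  forall u, inDbar u -> Cmod (u - z) < del ->
    Rabs (pseudohyp w (HExt u) - pseudohyp w (HExt z)) < eps.
Proof.
  intros Hw Hz eps He.
  assert (D := pseudohyp_den w (HExt z) Hw (HExt_inDbar z Hz)).
  assert (hw : 0 < (1 - Cmod w) ^ 2) by (apply pow_lt; unfold inD in Hw; lra).
  set (W := 1 + Cmod w ^ 2) in *.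
  assert (C2 : continuity_2d_pt (fun x y => (1 - (x * x + y * y)) * / (W - 2 * (x * Re w + y * Im w)))
    (Re (HExt z)) (Im (HExt z))).
  { apply continuity_2d_pt_mult; [c2d|]. apply continuity_2d_pt_inv; [c2d|]. lra. }
  destruct (C2 (mkposreal eps He)) as [d Hd].
  destruct (HExt_cont z Hz d (cond_pos d)) as [e [he HH]].
  exists e. split; auto. intros u Hu Huz. specialize (HH u Hu Huz).
  apply Hd.
  - eapply Rle_lt_trans; [apply (Rabs_Re_le (HExt u - HExt z)) | exact HH].
  - eapply Rle_lt_trans; [apply (Rabs_Im_le (HExt u - HExt z)) | exact HH].
Qed.

(** At a maximum of [pseudohyp w] along the extension, the invertible differential allows a move in
    any direction, so the gradient at the image p vanishes. This forces p = lam w, and the equality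
    at the maximum then leaves only lam = 1. *)
Lemma HE_bd_onto w : inD w -> exists z, inD z /\ HE (bd phi) z = w.
Proof.
  intros Hw. assert (Hw' : 0 < (1 - Cmod w) ^ 2) by (apply pow_lt; unfold inD in Hw; lra).
  assert (Dn : forall z, inDbar z -> 0 < 1 + Cmod w ^ 2 - 2 * (Re (HExt z) * Re w + Im (HExt z) * Im w)).
  { intros z Hz. assert (k := pseudohyp_den w (HExt z) Hw (HExt_inDbar z Hz)). lra. }
  destruct (Dbar_max (fun z => pseudohyp w (HExt z)) (/ (1 - Cmod w) ^ 2)) as [z [Hz Hmax]].
  - intros z Hz. unfold pseudohyp.
    assert (k := Rinv_le_contravar _ _ Hw' (pseudohyp_den w (HExt z) Hw (HExt_inDbar z Hz))).
    assert (k2 := Rinv_0_lt_compat _ (Dn z Hz)).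
    assert (0 <= Re (HExt z) * Re (HExt z) + Im (HExt z) * Im (HExt z)) by nra. nra.
  - intros z Hz. apply pseudohyp_cont; auto.
  - set (lam := pseudohyp w (HExt z)) in *.
    (* With the maximal value lam frozen, maximality becomes an inequality that is quadratic in the
       image of u, with equality at z. *)
    assert (Hq : forall u, inDbar u -> 1 - (Re (HExt u) * Re (HExt u) + Im (HExt u) * Im (HExt u)) <=
       lam * (1 + Cmod w ^ 2 - 2 * (Re (HExt u) * Re w + Im (HExt u) * Im w))).
    { intros u Hu. assert (k := Hmax u Hu). unfold pseudohyp in k. assert (k2 := Dn u Hu).
      apply Rmult_le_compat_r with (r := 1 + Cmod w ^ 2 - 2 * (Re (HExt u) * Re w + Im (HExt u) * Im w)) in k; [|lra].
      rewrite Rmult_assoc, Rinv_l, Rmult_1_r in k by lra. exact k. }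
    assert (Heq : 1 - (Re (HExt z) * Re (HExt z) + Im (HExt z) * Im (HExt z)) =
       lam * (1 + Cmod w ^ 2 - 2 * (Re (HExt z) * Re w + Im (HExt z) * Im w))).
    { unfold lam, pseudohyp. assert (k2 := Dn z Hz). rewrite Rmult_assoc, Rinv_l, Rmult_1_r by lra. reflexivity. }
    (* The centre of the disk already gives a positive value; hence the maximum is not on the
       circle, where [pseudohyp] is 0. *)
    assert (Hlam : 0 < lam).
    { assert (k := Hmax 0%C inDbar_0). eapply Rlt_le_trans; [|exact k].
      unfold pseudohyp. assert (i0 : inD 0%C) by (unfold inD; rewrite Cmod_0; lra).
      apply Rmult_lt_0_compat.
      - rewrite HExt_inD by auto. assert (k2 := inD_sqr _ (HE_bd_inD phi Hphi 0%C i0)).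
        rewrite Cmod2_alt in k2. lra.
      - apply Rinv_0_lt_compat, (Dn 0%C inDbar_0). }
    assert (HzD : inD z).
    { destruct (inDbar_cases z Hz) as [h|[t [_ E]]]; auto. exfalso.
      assert (k := Dn z Hz). subst z. rewrite HExt_cis in *.
      assert (k2 := Cmod_sqr (bd phi t)). unfold bd in k2. rewrite Cmod_cis in k2.
      fold (bd phi t) in k2. nra. }
    exists z. split; auto. rewrite HExt_inD in Heq by auto.
    set (p := HE (bd phi) z) in *. set (J := HJ phi z).
    assert (HJp : 0 < J) by (apply HJ_pos; auto).
    (* Half the gradient at p of 1 - |p|^2 - lam (1 + |w|^2 - 2 Re (p conj w)). *)
    set (m := (RtoC lam * w - p)%C).
    assert (Hm : m = 0%C).
    { apply NNPP. intros Hm. apply (proj1 (Cmod_gt_0 m)) in Hm.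
      set (v := (Cconj (CTd (bd phi) z) * m - Cconj (CTd (bdc phi) z * m))%C).
      assert (Ev : HEd phi z v = (RtoC J * m)%C) by apply HEd_adjugate.
      assert (hv := Cmod_ge_0 v).
      (* The step s v should displace the image by s J m; this eta keeps the linearisation error
         below half of that length. *)
      set (eta := J * Cmod m / (2 * (Cmod v + 1))).
      assert (heta : 0 < eta) by (apply Rdiv_lt_0_compat; nra).
      destruct (HE_derive phi Hphi z HzD eta heta) as [d [hd Hd]].
      unfold inD in HzD.
      (* The bound 1 / (3 J) gives s J <= 1/3, so the second-order term (9/4) (s J)^2 |m|^2 cannot
         reach the first-order gain s J |m|^2. *)
      set (s := Rmin (Rmin d (1 - Cmod z)) (/ (3 * J)) / (Cmod v + 1)).
      assert (hs : 0 < s /\ s * (Cmod v + 1) <= d /\ s * (Cmod v + 1) <= 1 - Cmod z /\ s * (Cmod v + 1) <= / (3 * J)).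
      { assert (k0 : 0 < / (3 * J)) by (apply Rinv_0_lt_compat; lra).
        assert (es : s * (Cmod v + 1) = Rmin (Rmin d (1 - Cmod z)) (/ (3 * J))) by (unfold s; field; lra).
        split; [apply Rdiv_lt_0_compat; [|lra]; repeat apply Rmin_pos; lra|]. rewrite es.
        repeat split.
        - eapply Rle_trans; [apply Rmin_l | apply Rmin_l].
        - eapply Rle_trans; [apply Rmin_l | apply Rmin_r].
        - apply Rmin_r. }
      destruct hs as [s0 [s1 [s2 s3]]].
      assert (ms : Cmod (RtoC s * v) = s * Cmod v) by (rewrite Cmod_mult, Cmod_R, Rabs_right; lra).
      set (u := (z + RtoC s * v)%C).
      assert (eu : (u - z)%C = (RtoC s * v)%C) by (unfold u; ring).
      assert (HuD : inD u).
      { unfold inD, u. eapply Rle_lt_trans; [apply Cmod_triangle|]. rewrite ms. nra. }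
      assert (k := Hd u). rewrite eu, ms in k. specialize (k ltac:(nra)).
      assert (ed : HEd phi z (RtoC s * v)%C = (RtoC (s * J) * m)%C).
      { rewrite RtoC_mult, <- Cmult_assoc, <- Ev. unfold HEd. rewrite !Cmult_conj, Cconj_RtoC. ring. }
      rewrite ed in k. fold p in k.
      set (r := (HE (bd phi) u - p - RtoC (s * J) * m)%C) in *.
      assert (hr : Cmod r <= s * (J * Cmod m / 2)).
      { eapply Rle_trans; [exact k|]. unfold eta.
        replace (s * (J * Cmod m / 2)) with (J * Cmod m / (2 * (Cmod v + 1)) * (s * (Cmod v + 1))) by (field; lra).
        apply Rmult_le_compat_l; [apply Rlt_le; exact heta | nra]. }
      assert (Q := Hq u ltac:(unfold inDbar; unfold inD in HuD; lra)). rewrite HExt_inD in Q by auto.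
      replace (HE (bd phi) u) with (p + (RtoC (s * J) * m + r))%C in Q by (unfold r; ring).
      set (D := (RtoC (s * J) * m + r)%C) in *.
      assert (Q2 : 2 * (Re m * Re D + Im m * Im D) <= Cmod D ^ 2).
      { rewrite Cmod2_alt. unfold m. clearbody D p. clear - Q Heq.
        destruct D as [D1 D2], p as [p1 p2], w as [w1 w2]. simpl in *. nra. }
      assert (hD : Cmod D <= s * (3 / 2 * (J * Cmod m))).
      { unfold D. eapply Rle_trans; [apply Cmod_triangle|].
        rewrite Cmod_mult, Cmod_R, Rabs_right by nra. nra. }
      assert (Q3 : s * J * Cmod m ^ 2 - Cmod m * Cmod r <= Re m * Re D + Im m * Im D).
      { assert (k2 := Rabs_Re_le (r * Cconj m)). rewrite Cmod_mult, Cmod_conj in k2.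
        apply Rabs_le_between in k2. unfold D. rewrite Cmod2_alt.
        clearbody r m. destruct r as [r1 r2], m as [m1 m2]. simpl in *. nra. }
      assert (hD0 := Cmod_ge_0 D).
      assert (Q4 : Cmod D ^ 2 <= s * s * (9 / 4) * (J * J) * Cmod m ^ 2).
      { replace (s * s * (9 / 4) * (J * J) * Cmod m ^ 2) with ((s * (3 / 2 * (J * Cmod m))) ^ 2) by field.
        apply pow_incr; auto. }
      assert (Q5 : Cmod m * Cmod r <= s * J * Cmod m ^ 2 / 2) by nra.
      assert (Q6 : s * J * Cmod m ^ 2 <= s * s * (9 / 4) * (J * J) * Cmod m ^ 2) by lra.
      assert (Q7 : s <= / (3 * J)) by nra.
      assert (Q8 : s * J <= 1 / 3).
      { apply Rle_trans with (/ (3 * J) * J); [apply Rmult_le_compat_r; lra | right; field; lra]. }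
      assert (Q9 : 0 < s * J * Cmod m ^ 2) by (apply Rmult_lt_0_compat; [apply Rmult_lt_0_compat; auto | apply pow_lt; auto]).
      set (X := s * J * Cmod m ^ 2) in *.
      replace (s * s * (9 / 4) * (J * J) * Cmod m ^ 2) with (9 / 4 * ((s * J) * X)) in Q6 by (unfold X; ring).
      nra. }
    assert (Ep : p = (RtoC lam * w)%C).
    { replace p with (RtoC lam * w - m)%C by (unfold m; ring). rewrite Hm. ring. }
    assert (hp := HE_bd_inD phi Hphi z HzD). fold p in hp.
    assert (hp2 := inD_sqr p hp). assert (hw2 := inD_sqr w Hw).
    rewrite Ep in Heq, hp2. rewrite Cmod_mult, Cmod_R, Rabs_right, Rpow_mult_distr in hp2 by lra.
    (* The second root lam = 1 / |w|^2 would make p the reflection of w in the unit circle, outside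
       the disk. *)
    assert (F : (1 - lam) * (1 - lam * Cmod w ^ 2) = 0).
    { rewrite Cmod2_alt in *. clear - Heq. destruct w as [w1 w2]. simpl in *. nra. }
    apply Rmult_integral in F. destruct F as [F|F].
    + rewrite Ep. replace lam with 1 by lra. ring.
    + exfalso. assert (1 < lam) by nra. nra.
Qed.
Lemma HExt_bij : bij_onto inDbar inDbar HExt.
Proof.
  assert (HPI := PI_RGT_0).
  split; [exact HExt_inDbar|]. split.
  - intros z w Hz Hw E.
    destruct (inDbar_cases z Hz) as [hz|[s [hs Es]]], (inDbar_cases w Hw) as [hw|[t [ht Et]]].
    + rewrite !HExt_inD in E by auto. apply (HE_bd_inj phi Hphi); auto.
    + exfalso. subst w. rewrite HExt_cis, HExt_inD in E by auto.
      assert (k := HE_bd_inD phi Hphi z hz). rewrite E in k. unfold inD, bd in k. rewrite Cmod_cis in k. lra.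
    + exfalso. subst z. rewrite HExt_cis, HExt_inD in E by auto.
      assert (k := HE_bd_inD phi Hphi w hw). rewrite <- E in k. unfold inD, bd in k. rewrite Cmod_cis in k. lra.
    + subst z w. rewrite !HExt_cis in E. f_equal.
      assert (W : forall s t, 0 <= s < 2 * PI -> 0 <= t < 2 * PI -> s < t -> bd phi s <> bd phi t).
      { clear - Hphi HPI. intros s t hs ht hst e. apply cis_inj in e.
        - assert (k := ol_incr phi Hphi s t hst). lra.
        - assert (k := ol_incr phi Hphi s t hst).
          assert (k2 := ol_incr phi Hphi t (s + 2 * PI) ltac:(lra)).
          rewrite odd_lift_period in k2 by auto. apply Rabs_def1; lra. }
      destruct (Rtotal_order s t) as [l|[l|l]]; auto; exfalso.
      * apply (W s t); auto.
      * apply (W t s); auto.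
  - intros w Hw. destruct (inDbar_cases w Hw) as [hw|[t [_ Et]]].
    + destruct (HE_bd_onto w hw) as [z [Hz E]]. exists z. rewrite HExt_inD by auto.
      split; auto. apply Rlt_le. exact Hz.
    (* The rotation by - phi 0 brings the target angle to phi 0 + s with 0 <= s < 2 PI, within the
       range of one turn of phi. *)
    + destruct (cis_surj (w * cis (- phi 0))%C) as [s [hs Es]].
      { rewrite Cmod_mult, Cmod_cis, Et, Cmod_cis. ring. }
      destruct (IVT_R phi 0 (0 + 2 * PI) (phi 0 + s) (cphi phi Hphi)) as [x [_ Ex]]; [lra| |].
      { left. rewrite odd_lift_period by auto. lra. }
      exists (cis x). split; [unfold inDbar; rewrite Cmod_cis; lra|].
      rewrite HExt_cis. unfold bd. rewrite Ex, cis_plus, <- Es.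
      transitivity (w * (cis (phi 0) * cis (- phi 0)))%C; [ring|].
      rewrite <- cis_plus, Rplus_opp_r, cis_0. ring.
Qed.

Lemma odd_lift_admissible : admissible (CTcoef (bd phi)) (CTcoef (bdc phi)).
Proof.
  assert (cb := bd_ccont phi Hphi). assert (cb' := bdc_ccont phi Hphi).
  exists (CT (bd phi)), (CT (bdc phi)). split; [|split; [|split; [|split; [|split]]]].
  - apply CT_pseries; auto. apply Cmod_bd.
  - apply CT_pseries; auto. apply Cmod_bdc.
  - unfold CTcoef. simpl. rewrite (CI_ext _ (fun t => Cconj (bd phi t))) by (intros; apply Cmult_1_r).
    rewrite CI_conj, CI_bd by auto. apply Re_Im_eq; simpl; ring.
  - split; [|split].
    + intros z Hz. apply (HE_bd_inD phi Hphi z Hz).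
    + intros z w Hz Hw E. apply (HE_bd_inj phi Hphi z w Hz Hw E).
    + intros w Hw. apply (HE_bd_onto w Hw).
  - intros z Hz. exists (CTd (bd phi) z), (CTd (bdc phi) z). split; [|split].
    + apply CT_derive; auto. apply Cmod_bd.
    + apply CT_derive; auto. apply Cmod_bdc.
    + assert (k := HJ_pos phi Hphi z HJ0 Hz). unfold HJ in k.
      assert (k1 := Cmod_ge_0 (CTd (bd phi) z)). assert (k2 := Cmod_ge_0 (CTd (bdc phi) z)). nra.
  - exists HExt. split; [|split].
    + apply homeo_of_bij; [apply HExt_bij | apply HExt_cont].
    + intros z Hz. apply HExt_inD; auto.
    + intros z Hz. destruct (cis_surj z Hz) as [t [_ ->]]. rewrite <- cis_PI, !HExt_cis.
      unfold bd. rewrite (ol_half phi Hphi). apply cis_PI.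
Qed.
End Extension.

(** * The extremal family *)

Section Ellipse.
Variable k : R.
Hypothesis Hk : 0 < k < 1.

(** The tangent of the angle from (x, k y) to (x, y). Their inner product x^2 + k y^2 is positive
    off the origin, so the angle stays within (- PI / 2, PI / 2) and [atan] provides a global
    lift. *)
Definition edir (x y : R) : R := (1 - k) * (x * y) * / (x * x + k * (y * y)).

(* [cis (ephi t)] is the direction of the point (cos t, k sin t) of a thin ellipse. *)
Definition ephi (t : R) : R := t - atan (edir (cos t) (sin t)).
Definition espeed (t : R) : R := k * / (cos t * cos t + k * k * (sin t * sin t)).

Lemma sin_cos_sqr t : sin t * sin t + cos t * cos t = 1.
Proof. exact (sin2_cos2 t). Qed.

Lemma eden_pos l t : 0 < l -> 0 < cos t * cos t + l * (sin t * sin t).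
Proof.
  intros Hl. assert (h := sin_cos_sqr t).
  assert (h1 : 0 <= cos t * cos t) by nra. assert (h2 : 0 <= sin t * sin t) by nra.
  destruct (Req_dec (cos t * cos t) 0) as [e|e]; nra.
Qed.

Lemma espeed_contR : contR espeed.
Proof.
  unfold espeed. apply (contR_mult (fun _ => k)); [contR|].
  apply (contR_inv (fun t => cos t * cos t + k * k * (sin t * sin t))); [contR|].
  intros t. assert (h := eden_pos (k * k) t ltac:(nra)). lra.
Qed.

Lemma espeed_pos t : 0 < espeed t.
Proof. apply Rmult_lt_0_compat; [lra|]. apply Rinv_0_lt_compat, eden_pos. nra. Qed.

Lemma ephi_derive t : is_derive ephi t (espeed t).
Proof.
  assert (h1 := eden_pos k t ltac:(lra)). assert (h2 := eden_pos (k * k) t ltac:(nra)).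
  assert (h := sin_cos_sqr t).
  assert (hd : is_derive (fun t => edir (cos t) (sin t)) t
    ((1 - k) * ((cos t * cos t - sin t * sin t) * (cos t * cos t + k * (sin t * sin t)) +
      2 * (1 - k) * (cos t * cos t) * (sin t * sin t)) / (cos t * cos t + k * (sin t * sin t)) ^ 2)).
  { unfold edir. auto_derive; [lra|]. field. lra. }
  evar_last.
  - apply (is_derive_minus (fun t => t) (fun t => atan (edir (cos t) (sin t)))); [apply is_derive_id|].
    apply (is_derive_comp atan); [apply is_derive_atan | exact hd].
  - unfold minus, plus, opp, scal, mult, one; simpl. unfold mult; simpl. unfold espeed, edir.
    set (c := cos t) in *. set (s := sin t) in *.
    assert (E : 1 + ((1 - k) * (c * s) * / (c * c + k * (s * s)))² =
      (c * c + k * k * (s * s)) / (c * c + k * (s * s)) ^ 2).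
    { unfold Rsqr. field_simplify_eq; [|lra].
      transitivity ((c * c + k * k * (s * s)) * (s * s + c * c)); [ring | rewrite h; ring]. }
    assert (hc : c * c = 1 - s * s) by lra.
    rewrite E. field_simplify_eq; [|split; lra].
    replace (c ^ 4) with ((c * c) * (c * c)) by ring. replace (c ^ 2) with (c * c) by ring.
    rewrite hc. ring.
Qed.

Lemma ephi_contR : contR ephi.
Proof. intros t. apply (ex_derive_continuous ephi). exists (espeed t). apply ephi_derive. Qed.

Lemma ephi_RInt s t : RInt espeed s t = ephi t - ephi s.
Proof. apply RInt_FTC; [apply ephi_derive | apply espeed_contR]. Qed.

Lemma ephi_odd_lift : odd_lift ephi.
Proof.
  split.
  - apply ephi_contR.
  - intros s t Hst. assert (h : 0 < RInt espeed s t).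
    { apply RInt_gt_0; auto; intros; [apply espeed_pos | apply espeed_contR]. }
    rewrite ephi_RInt in h. lra.
  - intros t. unfold ephi. rewrite neg_cos, neg_sin.
    replace (edir (- cos t) (- sin t)) with (edir (cos t) (sin t)); [ring|].
    unfold edir. rewrite !Rmult_opp_opp. reflexivity.
Qed.

Lemma ephi_odd t : ephi (- t) = - ephi t.
Proof.
  unfold ephi. rewrite cos_neg, sin_neg.
  replace (edir (cos t) (- sin t)) with (- edir (cos t) (sin t)).
  - rewrite atan_opp. ring.
  - unfold edir. rewrite Rmult_opp_opp. ring.
Qed.

(** On the circle this is (x + i k y) / |x + i k y|, written as a rotation of z so that angles
    simply add. *)
Definition ebd (z : C) : C := (z * cis (- atan (edir (Re z) (Im z))))%C.

Lemma ebd_cis t : ebd (cis t) = bd ephi t.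
Proof. unfold ebd, bd, ephi. rewrite <- cis_plus. reflexivity. Qed.

Lemma ebd_cont z : onT z -> cont_within onT ebd z.
Proof.
  intros Hz eps He. destruct (cis_surj z Hz) as [t [_ Et]].
  assert (hd := eden_pos k t ltac:(lra)).
  assert (C0 : continuity_2d_pt (fun x y => - atan (edir x y)) (Re z) (Im z)).
  { apply continuity_2d_pt_opp. apply continuity_1d_2d_pt_comp.
    - apply derivable_continuous_pt, derivable_pt_atan.
    - unfold edir. apply continuity_2d_pt_mult; [c2d|]. apply continuity_2d_pt_inv; [c2d|].
      rewrite Et. simpl. lra. }
  assert (Cc : continuity_2d_pt (fun x y => cos (- atan (edir x y))) (Re z) (Im z))
    by exact (c2d_comp cos _ _ _ contR_cos C0).
  assert (Cs : continuity_2d_pt (fun x y => sin (- atan (edir x y))) (Re z) (Im z))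
    by exact (c2d_comp sin _ _ _ contR_sin C0).
  assert (C1 : continuity_2d_pt (fun x y => x * cos (- atan (edir x y)) - y * sin (- atan (edir x y))) (Re z) (Im z))
    by (apply continuity_2d_pt_minus; apply continuity_2d_pt_mult; auto; c2d).
  assert (C2 : continuity_2d_pt (fun x y => x * sin (- atan (edir x y)) + y * cos (- atan (edir x y))) (Re z) (Im z))
    by (apply continuity_2d_pt_plus; apply continuity_2d_pt_mult; auto; c2d).
  assert (he : 0 < eps / 2) by lra.
  destruct (C1 (mkposreal _ he)) as [d1 H1]. destruct (C2 (mkposreal _ he)) as [d2 H2].
  exists (Rmin d1 d2). split; [apply Rmin_pos; apply cond_pos|].
  intros w _ Hw.
  assert (k1 := Rlt_le_trans _ _ _ Hw (Rmin_l _ _)). assert (k2 := Rlt_le_trans _ _ _ Hw (Rmin_r _ _)).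
  assert (r := Rabs_Re_le (w - z)). assert (i := Rabs_Im_le (w - z)).
  assert (m1 := H1 (Re w) (Im w) (Rle_lt_trans _ _ _ r k1) (Rle_lt_trans _ _ _ i k1)).
  assert (m2 := H2 (Re w) (Im w) (Rle_lt_trans _ _ _ r k2) (Rle_lt_trans _ _ _ i k2)).
  eapply Rle_lt_trans; [apply Cmod_le_Re_Im|].
  replace eps with (eps / 2 + eps / 2) by field. apply Rplus_lt_compat; [exact m1 | exact m2].
Qed.

(** Scaling y by k > 0 keeps each point in its closed quadrant; this gives the signs of the two
    diagonal moments. *)
Lemma ephi_quadrant t :
  0 <= cos t * cos (ephi t) /\ 0 <= sin t * sin (ephi t).
Proof.
  assert (hd := eden_pos k t ltac:(lra)). assert (h := sin_cos_sqr t).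
  unfold ephi. set (x := edir (cos t) (sin t)). set (A := atan x).
  assert (hA := atan_bound x). fold A in hA.
  assert (hc : 0 < cos A) by (apply cos_gt_0; lra).
  assert (hs : sin A = x * cos A).
  { assert (e : tan A = x) by apply tan_atan. unfold tan in e. rewrite <- e. field. lra. }
  rewrite cos_minus, sin_minus, hs. clearbody A.
  assert (hx : x * (cos t * cos t + k * (sin t * sin t)) = (1 - k) * (cos t * sin t)).
  { unfold x, edir. field. lra. }
  set (D := cos t * cos t + k * (sin t * sin t)) in *. clearbody x.
  set (c := cos t) in *. set (s := sin t) in *.
  split.
  - replace (c * (c * cos A + s * (x * cos A))) with (cos A * (c * c + c * s * x)) by ring.
    apply Rmult_le_pos; [lra|].
    assert (0 <= D * (c * s * x)); [|nra].
    replace (D * (c * s * x)) with ((1 - k) * ((c * s) * (c * s))); [nra|].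
    transitivity (c * s * (x * D)); [rewrite hx|]; ring.
  - replace (s * (s * cos A - c * (x * cos A))) with (cos A * (s * s - c * s * x)) by ring.
    apply Rmult_le_pos; [lra|].
    assert (0 <= D * (s * s - c * s * x)); [|nra].
    replace (D * (s * s - c * s * x)) with (k * (s * s)); [nra|].
    transitivity (D * (s * s) - c * s * (x * D)); [|ring]. rewrite hx. unfold D.
    transitivity (k * (s * s) * (s * s + c * c)); [rewrite h|]; ring.
Qed.

Lemma RInt_odd_circle f : contR f -> (forall t, f (2 * PI - t) = - f t) -> RInt f 0 (2 * PI) = 0.
Proof.
  intros Hf Ho. assert (E := RInt_reflectR f 0 (2 * PI) (2 * PI) Hf).
  rewrite (RInt_extR _ _ _ _ Ho), RInt_oppR, Rminus_0_r, Rminus_eq_0 in E by auto. lra.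
Qed.

Lemma ephi_reflect t : ephi (2 * PI - t) = 2 * PI - ephi t.
Proof.
  replace (2 * PI - t) with (- t + 2 * PI) by ring.
  rewrite (odd_lift_period ephi _ ephi_odd_lift), ephi_odd. ring.
Qed.

Lemma cos_reflect t : cos (2 * PI - t) = cos t.
Proof.
  replace (2 * PI - t) with (- t + 2 * INR 1 * PI) by (simpl; ring). rewrite cos_period. apply cos_neg.
Qed.

Lemma sin_reflect t : sin (2 * PI - t) = - sin t.
Proof.
  replace (2 * PI - t) with (- t + 2 * INR 1 * PI) by (simpl; ring). rewrite sin_period. apply sin_neg.
Qed.

Lemma ephi_cos_sin : RInt (fun t => cos t * sin (ephi t)) 0 (2 * PI) = 0.
Proof.
  assert (c := ephi_contR). apply RInt_odd_circle; [contR|].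
  intros t. rewrite ephi_reflect, cos_reflect, sin_reflect. ring.
Qed.

Lemma ephi_sin_cos : RInt (fun t => sin t * cos (ephi t)) 0 (2 * PI) = 0.
Proof.
  assert (c := ephi_contR). apply RInt_odd_circle; [contR|].
  intros t. rewrite ephi_reflect, cos_reflect, sin_reflect. ring.
Qed.

Lemma ephi_cos_cos : 0 <= RInt (fun t => cos t * cos (ephi t)) 0 (2 * PI) <= 4.
Proof.
  assert (HPI := PI_RGT_0). assert (c := ephi_contR). split.
  - apply RInt_nonnegR; [lra | contR |]. intros t _. apply ephi_quadrant.
  - assert (p : forall t, cos (t + PI) * cos (ephi (t + PI)) = cos t * cos (ephi t)).
    { intros t. rewrite (ol_half ephi ephi_odd_lift), !neg_cos. ring. }
    rewrite half_period_double by (auto; contR).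
    (* On this half period the cosine is nonnegative and has integral 2, so the full integral is at
       most 4. *)
    rewrite <- (RInt_periodR _ PI (- (PI / 2))) by (auto; contR).
    replace (- (PI / 2) + PI) with (PI / 2) by field.
    assert (L : RInt (fun t => cos t * cos (ephi t)) (- (PI / 2)) (PI / 2) <= RInt cos (- (PI / 2)) (PI / 2)).
    { apply RInt_leR; [lra | contR | contR |]. intros t Ht.
      assert (h := COS_bound (ephi t)). assert (0 <= cos t) by (apply cos_ge_0; lra). nra. }
    rewrite (RInt_FTC sin cos) in L by (try apply is_derive_sin; contR).
    rewrite sin_neg, sin_PI2 in L. lra.
Qed.

(* Integrating by parts, the integrand is [espeed * cos (ephi) * cos], at most
   [sqrt (k espeed) <= sqrt k (1 + espeed) / 2]. *)
Lemma ephi_sin_sin : 0 <= RInt (fun t => sin t * sin (ephi t)) 0 (2 * PI) <= 2 * PI * sqrt k.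
Proof.
  assert (HPI := PI_RGT_0). assert (c := ephi_contR). assert (ce := espeed_contR). split.
  - apply RInt_nonnegR; [lra | contR |]. intros t _. apply ephi_quadrant.
  - assert (E : RInt (fun t => espeed t * cos (ephi t) * cos t - sin t * sin (ephi t)) 0 (2 * PI) = 0).
    { rewrite (RInt_FTC (fun t => sin (ephi t) * cos t)).
      - replace (ephi (2 * PI)) with (ephi 0 + 2 * PI)
          by (rewrite <- (odd_lift_period ephi 0 ephi_odd_lift); f_equal; ring).
        replace (ephi 0 + 2 * PI) with (ephi 0 + 2 * INR 1 * PI) by (simpl; ring).
        rewrite sin_period, cos_2PI, cos_0. apply Rminus_eq_0.
      - intros t. evar_last.
        + apply (is_derive_mult (fun t => sin (ephi t)) cos); [|apply is_derive_cos|apply Rmult_comm].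
          apply (is_derive_comp sin ephi); [apply is_derive_sin | apply ephi_derive].
        + unfold plus, mult, scal; simpl. unfold mult; simpl. ring.
      - contR. }
    rewrite RInt_minusR in E by contR.
    assert (L : RInt (fun t => espeed t * cos (ephi t) * cos t) 0 (2 * PI) <=
      RInt (fun t => sqrt k / 2 * (1 + espeed t)) 0 (2 * PI)).
    { apply RInt_leR; [lra | contR | contR |]. intros t _.
      assert (hq : sqrt k * sqrt k = k) by (apply sqrt_sqrt; lra).
      assert (hq0 := sqrt_pos k). assert (hp := espeed_pos t).
      (* Squaring reduces the claim to [espeed * k] <= k (1 + [espeed])^2 / 4, using
         [espeed * cos^2] <= k on the left. The integral of 1 + [espeed] is 4 PI, whence 2 PI sqrt
         k. *)
      apply Rsqr_incr_0_var; [|nra]. unfold Rsqr.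
      assert (hd := eden_pos (k * k) t ltac:(nra)).
      assert (e1 : espeed t * (cos t * cos t) <= k).
      { unfold espeed. apply Rmult_le_reg_r with (cos t * cos t + k * k * (sin t * sin t)); auto.
        replace (k * / (cos t * cos t + k * k * (sin t * sin t)) * (cos t * cos t) *
          (cos t * cos t + k * k * (sin t * sin t))) with (k * (cos t * cos t)) by (field; lra).
        apply Rmult_le_compat_l; [lra|]. assert (0 <= sin t * sin t) by nra. nra. }
      assert (e2 : cos (ephi t) * cos (ephi t) <= 1) by (assert (h := COS_bound (ephi t)); nra).
      apply Rle_trans with (espeed t * k).
      - replace (espeed t * cos (ephi t) * cos t * (espeed t * cos (ephi t) * cos t)) with
          (espeed t * ((espeed t * (cos t * cos t)) * (cos (ephi t) * cos (ephi t)))) by ring.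
        apply Rmult_le_compat_l; [lra|]. assert (0 <= espeed t * (cos t * cos t)) by nra. nra.
      - replace (sqrt k / 2 * (1 + espeed t) * (sqrt k / 2 * (1 + espeed t))) with
          (sqrt k * sqrt k * ((1 + espeed t) * (1 + espeed t) / 4)) by field.
        rewrite hq. assert (0 <= (1 - espeed t) * (1 - espeed t)) by apply Rle_0_sqr. nra. }
    rewrite RInt_scalR, RInt_plusR, RInt_constR, ephi_RInt in L by contR.
    replace (ephi (2 * PI)) with (ephi 0 + 2 * PI) in L
      by (rewrite <- (odd_lift_period ephi 0 ephi_odd_lift); f_equal; ring).
    lra.
Qed.

Lemma ellipse_admissible : admissible (CTcoef (bd ephi)) (CTcoef (bdc ephi)).
Proof.
  apply (odd_lift_admissible ephi ebd ephi_odd_lift ebd_cis ebd_cont).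
  apply (HJ_0 ephi ephi_odd_lift). cbv zeta.
  rewrite ephi_cos_sin, Rmult_0_l, Rminus_0_r.
  apply Rmult_le_pos; [apply ephi_cos_cos | apply ephi_sin_sin].
Qed.

(** The mixed moments vanish and the other two are at most 4 and 2 PI sqrt k, which gives (16 + 4
    PI^2 k) / (2 PI^2). *)
Lemma ellipse_coeff_le :
  Cmod (CTcoef (bd ephi) 1) ^ 2 + Cmod (CTcoef (bdc ephi) 1) ^ 2 <= 8 / PI ^ 2 + 2 * k.
Proof.
  assert (HPI := PI_RGT_0). assert (c := ephi_contR). assert (cb := bd_ccont ephi ephi_odd_lift).
  assert (e2 : RtoC (2 * PI) = (2 * PI)%C) by (rewrite RtoC_mult; reflexivity).
  rewrite (coeff_sum_CI (bd ephi)); auto.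
  - rewrite !Cmod2_alt. unfold CI, bd, cis; simpl Re; simpl Im.
    rewrite (RInt_extR (fun t => cos t * cos (ephi t) - 0 * sin (ephi t)) (fun t => cos t * cos (ephi t))) by (intros; ring).
    rewrite (RInt_extR (fun t => cos t * sin (ephi t) + 0 * cos (ephi t)) (fun t => cos t * sin (ephi t))) by (intros; ring).
    rewrite (RInt_extR (fun t => sin t * cos (ephi t) - 0 * sin (ephi t)) (fun t => sin t * cos (ephi t))) by (intros; ring).
    rewrite (RInt_extR (fun t => sin t * sin (ephi t) + 0 * cos (ephi t)) (fun t => sin t * sin (ephi t))) by (intros; ring).
    rewrite ephi_cos_sin, ephi_sin_cos.
    assert (h1 := ephi_cos_cos). assert (h2 := ephi_sin_sin).
    revert h1 h2. generalize (RInt (fun t => cos t * cos (ephi t)) 0 (2 * PI)).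
    generalize (RInt (fun t => sin t * sin (ephi t)) 0 (2 * PI)). intros y x h1 h2.
    change (R_CompleteNormedModule : Type) with R in *.
    assert (hq : sqrt k * sqrt k = k) by (apply sqrt_sqrt; lra). assert (hq0 := sqrt_pos k).
    assert (hp : 0 < PI ^ 2) by (apply pow_lt; lra).
    assert (hy : y ^ 2 <= 4 * PI ^ 2 * k).
    { replace (4 * PI ^ 2 * k) with ((2 * PI * sqrt k) ^ 2); [apply pow_incr; lra|].
      rewrite <- hq at 2. ring. }
    assert (hx : x ^ 2 <= 4 ^ 2) by (apply pow_incr; lra).
    apply Rmult_le_reg_r with (2 * PI ^ 2); [lra|]. unfold Rdiv at 1. rewrite Rmult_assoc, Rinv_l, Rmult_1_r by lra.
    replace ((8 / PI ^ 2 + 2 * k) * (2 * PI ^ 2)) with (16 + 4 * PI ^ 2 * k) by (field; lra).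
    nra.
  - rewrite <- e2. apply RtoC_inv_mult; [lra|]. unfold CTcoef. f_equal. apply CI_ext. intros t.
    simpl. rewrite Cmult_1_r. do 2 f_equal. ring.
  - rewrite <- e2. apply RtoC_inv_mult; [lra|]. unfold CTcoef.
    rewrite Cmult_conj, Cconj_RtoC, <- CI_conj.
    + f_equal. apply CI_ext. intros t. unfold bdc. simpl. rewrite Cmult_1_r, Cmult_conj, Cconj_conj.
      rewrite <- cis_opp, Ropp_involutive, Rmult_1_l. reflexivity.
    + assert (cb' := bdc_ccont ephi ephi_odd_lift). ccont.
Qed.
End Ellipse.

Theorem theoremA2 :
  (forall a b : nat -> C, admissible a b ->
     Cmod (a 1%nat) ^ 2 + Cmod (b 1%nat) ^ 2 >= 8 / PI ^ 2) /\
  (forall eps : R, 0 < eps -> exists a b : nat -> C, admissible a b /\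
     Cmod (a 1%nat) ^ 2 + Cmod (b 1%nat) ^ 2 < 8 / PI ^ 2 + eps).
Proof.
  split; [exact admissible_ge|].
  (* The excess 2 k over 8 / PI^2 is then at most eps / 2, and 1/2 keeps k below 1. *)
  intros eps He. set (k := Rmin (1 / 2) (eps / 4)).
  assert (Hk : 0 < k < 1) by (unfold k, Rmin; destruct Rle_dec; lra).
  assert (Hk2 := Rmin_r (1 / 2) (eps / 4)). fold k in Hk2.
  exists (CTcoef (bd (ephi k))), (CTcoef (bdc (ephi k))). split.
  - apply ellipse_admissible; auto.
  - assert (h := ellipse_coeff_le k Hk). lra.
Qed.
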